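(* Let $p,q\ge0$ and let $\phi(z)=1+\sum_{i=1}^p\phi_iz^i$ and $\theta(z)=1+\sum_{i=1}^q\theta_iz^i$ be real polynomials of degrees $p$ and $q$ having no common roots and no roots in $\{z\in\mathbb C:|z|\le1\}$. Let $(Z_t)_{t\in\mathbb Z}$ be the stationary ARMA$(p,q)$ time series satisfying $\phi(B)Z_t=\theta(B)\zeta_t$, $t\in\mathbb Z$, with $\zeta_t$ i.i.d. $\mathcal N(0,1)$, where $B$ is the backshift operator $BX_t=X_{t-1}$; let $\Sigma_n$ be the covariance matrix of $\xi_n=(Z_1,\dots,Z_n)^T$ and $f$ the spectral density of $(Z_t)$. Let $(\lambda_n)_{n\ge1}\subset(0,1)$ satisfy $\frac{n\lambda_n}{\log n}\to\infty$ and $\lambda_n=o\left(\frac1{\log n}\right)$ as $n\to\infty$. Then the asymptotic minimax detection boundary for testing $$H_0: Y\sim\mathcal N_n(0,\Sigma_n)\quad\text{against}\quad H_1^n:\ \exists I\in\mathcal I(\lambda_n),\ \exists \delta\in\mathbb R,\ |\delta|\ge\Delta_n:\ Y\sim\mathcal N_n(\delta\mathbf 1_I,\Sigma_n)$$ is given by $$\Delta_n\asymp\sqrt{\frac{-2f(0)\log\lambda_n}{n\lambda_n}}=\left|\frac{1+\sum_{i=1}^q\theta_i}{1+\sum_{i=1}^p\phi_i}\right|\sqrt{\frac{-2\log\lambda_n}{n\lambda_n}},\qquad n\to\infty.$$ That is, with $\varphi_n$ denoting the right-hand side, for every $\alpha\in(0,\tfrac12)$: (upper detection bound) there is a sequence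 of tests $(\Phi^*_{n,\alpha})_{n\in\mathbb N}$ of asymptotic level $\alpha$ such that for all $c>1$, $\limsup_{n\to\infty}\bar\beta(\Phi^*_{n,\alpha},\Sigma_n,c\varphi_n,\lambda_n)\le\alpha$; (lower detection bound) for all $0<c<1$ and every sequence of tests $(\Phi_n)_{n\in\mathbb N}$ of asymptotic level $\alpha$, $\liminf_{n\to\infty}\bar\beta(\Phi_n,\Sigma_n,c\varphi_n,\lambda_n)\ge1-\alpha$.
   Context: One observes $Y=\mu_n+\xi_n\in\mathbb R^n$ with $\mu_n=0$ under $H_0$ and $\mu_n=\delta\mathbf 1_I$ under $H_1^n$; $\Sigma_n$ and $\lambda_n$ are known. The spectral density is $f(\nu)=\sum_{h\in\mathbb Z}\gamma(h)e^{-2\pi ih\nu}$, $\nu\in[-1/2,1/2)$, with $\gamma(h)=\mathbb E[Z_tZ_{t+h}]$. For an interval $I\subset[0,1]$, $\mathbf 1_I\in\mathbb R^n$ is the vector with entries $\mathbf 1_I(i)=1$ if $\frac in\in I$ and $\mathbf 1_I(i)=0$ otherwise, $1\le i\le n$. For $\lambda\in(0,1)$, $\mathcal I(\lambda)=\{[a,b): 0\le a<b\le1,\ b-a=\lambda\}$. A test is a (measurable) map $\Phi_n:\mathbb R^n\to\{0,1\}$. Let $\mathbb P_0$ and $\mathbb P_{I,\delta}$ denote the laws $\mathcal N_n(0,\Sigma_n)$ and $\mathcal N_n(\delta\mathbf 1_I,\Sigma_n)$ of $Y$. The type I error is $\bar\alpha(\Phi_n,\Sigma_n)=\mathbb P_0[\Phi_n(Y)=1]$;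 the sequence $(\Phi_n)$ has asymptotic level $\alpha$ if $\limsup_{n\to\infty}\bar\alpha(\Phi_n,\Sigma_n)\le\alpha$. The type II error is $\bar\beta(\Phi_n,\Sigma_n,\Delta_n,\lambda_n)=\sup_{I\in\mathcal I(\lambda_n)}\sup_{|\delta|\ge\Delta_n}\mathbb P_{I,\delta}[\Phi_n(Y)=0]$. For positive sequences, $a_n\asymp b_n$ means $a_n/b_n\to1$. *)

(* Defs.v *)
From HB Require Import structures.
From mathcomp Require Import all_boot all_order all_algebra.
From mathcomp Require Import all_classical all_reals all_analysis.
From mathcomp Require Import complex.

Set Implicit Arguments.
Unset Strict Implicit.
Unset Printing Implicit Defensive.

Import Order.TTheory GRing.Theory Num.Theory.
Import numFieldNormedType.Exports.

Local Open Scope classical_set_scope.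
Local Open Scope ring_scope.

Lemma product_sigma_finite d1 d2 (T1 : measurableType d1)
    (T2 : measurableType d2) (R : realType)
    (m1 : {sigma_finite_measure set T1 -> \bar R})
    (m2 : {sigma_finite_measure set T2 -> \bar R}) :
  sigma_finite setT (m1 \x m2)%E.
Proof.
have /sigma_finiteP[F [TF ndF Foo]] := sigma_finiteT m1.
have /sigma_finiteP[G [TG ndG Goo]] := sigma_finiteT m2.
exists (fun n => F n `*` G n).
  rewrite -setXTT TF TG predeqE => -[x y]; split.
    move=> [/= [n _ Fnx] [k _ Gky]]; exists (maxn n k) => //; split.
    - by move: x Fnx; exact/subsetPset/ndF/leq_maxl.
    - by move: y Gky; exact/subsetPset/ndG/leq_maxr.
  by move=> [n _ []/= ? ?]; split; exists n.
move=> k; have [? ?] := Foo k; have [? ?] := Goo k.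
split; first exact: measurableX.
by rewrite product_measure1E// lte_mul_pinfty// ge0_fin_numE.
Qed.

Lemma ex_sigma_finite_measure d (T : measurableType d) (R : realType)
    (nu : {measure set T -> \bar R}) : sigma_finite setT nu ->
  exists m : {sigma_finite_measure set T -> \bar R},
    (nu : set T -> \bar R) = m.
Proof.
move=> nu_sf.
pose H1 := isSFinite.Build _ _ _ _ (sfinite_measure_sigma_finite nu_sf).
pose H2 := isSigmaFinite.Build _ _ _ _ nu_sf.
by exists (HB.pack_for (SigmaFiniteMeasure.type T R) (Measure.sort nu) H1 H2).
Qed.

Section lebesgue_tuple.
Context {R : realType}.

Definition cons_pair n (p : measurableTypeR R * n.-tuple R) : n.+1.-tuple R :=
  [tuple of p.1 :: p.2].

Lemma measurable_cons_pair n : measurable_fun setT (@cons_pair n).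
Proof. exact: measurable_cons measurable_fst measurable_snd. Qed.

(** Lebesgue measure on R^n, obtained by iterating the binary product measure;
    R^0 is a point, of measure 1. *)
Fixpoint lebesgue_tuple n : set (n.-tuple R) -> \bar R :=
  if n is n'.+1
  then pushforward (lebesgue_measure \x @lebesgue_tuple n')%E (@cons_pair n')
  else \d_[tuple].

Lemma lebesgue_tuple_sigma_finite_measure n :
  exists m : {sigma_finite_measure set (n.-tuple R) -> \bar R},
    @lebesgue_tuple n = m.
Proof.
elim: n => [|n [m mE]] /=.
  by exists [the {sigma_finite_measure set (0.-tuple R) -> \bar R} of
    \d_([tuple] : 0.-tuple R)].
rewrite mE.
pose nu := pushforward (lebesgue_measure \x m)%E (@cons_pair n).
have mcons A : measurable A -> measurable (@cons_pair n @^-1` A).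
  by move=> mA; rewrite -[X in measurable X]setTI;
     exact: (measurable_cons_pair measurableT mA).
have nu_sf : sigma_finite setT nu.
  have [F TF Foo] := product_sigma_finite lebesgue_measure m.
  pose uncons (t : n.+1.-tuple R) : measurableTypeR R * n.-tuple R :=
    (thead t, [tuple of behead t]).
  have consK : cancel (@cons_pair n) uncons.
    by case=> x t; congr (_, _); exact: val_inj.
  have muncons : measurable_fun setT uncons.
    apply/measurable_fun_pairP.
    split; first exact: (measurable_tnth (T := R) ord0).
    exact: (measurable_behead (T := R)).
  exists (fun k => uncons @^-1` F k).
    by rewrite -preimage_bigcup -TF preimage_setT.
  move=> k; have [mFk Fkoo] := Foo k; split.
    by rewrite -[X in measurable X]setTI; exact: muncons.
  rewrite /nu /pushforward -comp_preimage.
  by rewrite (_ : uncons \o _ = id)// funeqE => x /=; rewrite consK.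
have mp := @measurable_cons_pair n.
exact: (@ex_sigma_finite_measure _ _ R
  (pushforward (lebesgue_measure \x m)%E (@cons_pair n)
     : {measure set (n.+1.-tuple R) -> \bar R})).
Qed.

Let lebesgue_tuple0 n : @lebesgue_tuple n set0 = 0%E.
Proof.
by have [m ->] := lebesgue_tuple_sigma_finite_measure n; exact: (measure0 m).
Qed.

Let lebesgue_tuple_ge0 n A : (0 <= @lebesgue_tuple n A)%E.
Proof.
by have [m ->] := lebesgue_tuple_sigma_finite_measure n; exact: (measure_ge0 m).
Qed.

Let lebesgue_tuple_sigma_additive n : semi_sigma_additive (@lebesgue_tuple n).
Proof.
have [m ->] := lebesgue_tuple_sigma_finite_measure n.
exact: measure_semi_sigma_additive.
Qed.

HB.instance Definition _ n := isMeasure.Build _ _ _ (@lebesgue_tuple n)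
  (lebesgue_tuple0 n) (@lebesgue_tuple_ge0 n) (@lebesgue_tuple_sigma_additive n).

Let lebesgue_tuple_sigma_finite n : sigma_finite setT (@lebesgue_tuple n).
Proof.
by have [m ->] := lebesgue_tuple_sigma_finite_measure n; exact: (sigma_finiteT m).
Qed.

HB.instance Definition _ n := Measure_isSigmaFinite.Build _ _ _
  (@lebesgue_tuple n) (@lebesgue_tuple_sigma_finite n).

End lebesgue_tuple.
Arguments lebesgue_tuple {R} n.

Section multinormal.
Context {R : realType} {n : nat}.
Implicit Types (mu : 'cV[R]_n) (Sigma : 'M[R]_n).

(** Density of N_n(mu, Sigma), for a positive definite [Sigma]. *)
Definition multinormal_pdf mu Sigma (y : n.-tuple R) : R :=
  let z := (\col_i tnth y i) - mu in
  (Num.sqrt ((2 * pi) ^+ n * \det Sigma))^-1 *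
  expR (- (z^T *m invmx Sigma *m z) 0 0 / 2).

Definition multinormal mu Sigma : set (n.-tuple R) -> \bar R :=
  fun A => (\int[lebesgue_tuple n]_(y in A) (multinormal_pdf mu Sigma y)%:E)%E.

End multinormal.

Section time_series.
Context {d} {T : measurableType d} {R : realType} (P : probability T R).
Implicit Types Z zeta : int -> {RV P >-> R}.

Definition mutually_independent zeta : Prop :=
  forall (J : seq int) (B : int -> set R),
    uniq J -> (forall t, measurable (B t)) ->
    P [set w | forall t, t \in J -> B t (zeta t w)] =
    (\prod_(t <- J) P (zeta t @^-1` B t))%E.

Definition iid_standard_normal zeta : Prop :=
  mutually_independent zeta /\
  forall t (B : set R), measurable B ->
    distribution P (zeta t) B = normal_prob 0 1 B.

Definition square_integrable Z : Prop :=
  forall t, P.-integrable setT (fun w => (Z t w ^+ 2)%:E).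

(** Stationarity in the weak (second-order) sense. *)
Definition stationary Z : Prop :=
  [/\ square_integrable Z,
      forall s t, 'E_P[Z s]%E = 'E_P[Z t]%E &
      forall s t h, covariance P (Z s) (Z (s + h)) =
                    covariance P (Z t) (Z (t + h))].

(** phi(B) Z_t = theta(B) zeta_t, where B is the backshift operator. *)
Definition arma_equation (phi theta : {poly R}) Z zeta : Prop :=
  forall t : int, {ae P, forall w,
    \sum_(i < size phi) phi`_i * Z (t - i%:Z) w =
    \sum_(i < size theta) theta`_i * zeta (t - i%:Z) w}.

Definition stationary_arma (phi theta : {poly R}) Z zeta : Prop :=
  [/\ stationary Z, iid_standard_normal zeta & arma_equation phi theta Z zeta].

(** By stationarity E[Z_t Z_{t+h}] does not depend on t, so t = 0 is taken. *)
Definition autocovariance Z (h : int) : R :=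
  fine 'E_P[(fun w => Z 0 w * Z h w)%R]%E.

(** Row and column indices of matrices start at 0, times start at 1. *)
Definition covariance_mx Z (n : nat) : 'M[R]_n :=
  \matrix_(i, j) fine (covariance P (Z i.+1%:Z) (Z j.+1%:Z)).

End time_series.

Definition complex_root {R : realType} (p : {poly R}) (z : R[i]) : bool :=
  root (map_poly (real_complex R) p) z.

Definition expi {R : realType} (x : R) : R[i] := (cos x +i* sin x)%C.

(** The Fourier series over Z is the limit of the sums over |h| <= N; its value
    is real because [gamma] is even. *)
Definition spectral_density {R : realType} (gamma : int -> R) (nu : R) : R :=
  let S (N : nat) : (R[i] : numFieldType) :=
    \sum_(0 <= k < N.*2.+1)
      let h := k%:Z - N%:Z in (gamma h)%:C%C * expi (- 2 * pi * h%:~R * nu) in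
  complex.Re (limn S).

Section detection.
Context {R : realType}.

Definition intervals (l : R) : set (set R) :=
  [set I | exists a b : R,
     [/\ 0 <= a, a < b, b <= 1, b - a = l & I = `[a, b[%classic]].

Definition indicator_vec (n : nat) (I : set R) : 'cV[R]_n :=
  \col_(i < n) \1_I (i.+1%:R / n%:R).

Definition test n := {mfun n.-tuple R >-> bool}.

Definition type1_error n (Phi : test n) (Sigma : 'M[R]_n) : \bar R :=
  multinormal 0 Sigma [set y | Phi y = true].

Definition type2_error n (Phi : test n) (Sigma : 'M[R]_n) (Delta l : R) :
    \bar R :=
  ereal_sup [set
    ereal_sup [set
      multinormal (delta *: indicator_vec n I) Sigma [set y | Phi y = false]
      | delta in [set delta : R | Delta <= `|delta|]]
    | I in intervals l].

Definition asymptotic_level (Sigma : forall n, 'M[R]_n) (alpha : R)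
    (Phi : forall n, test n) : Prop :=
  (limn_esup (fun n => type1_error (Phi n) (Sigma n)) <= alpha%:E)%E.

Definition upper_detection_bound (Sigma : forall n, 'M[R]_n)
    (lambda varphi : nat -> R) (alpha : R) : Prop :=
  exists2 Phi : forall n, test n, asymptotic_level Sigma alpha Phi &
    forall c : R, 1 < c ->
      (limn_esup (fun n =>
         type2_error (Phi n) (Sigma n) (c * varphi n) (lambda n))
       <= alpha%:E)%E.

Definition lower_detection_bound (Sigma : forall n, 'M[R]_n)
    (lambda varphi : nat -> R) (alpha : R) : Prop :=
  forall c : R, 0 < c < 1 ->
  forall Phi : forall n, test n, asymptotic_level Sigma alpha Phi ->
    ((1 - alpha)%:E <= limn_einf (fun n =>
       type2_error (Phi n) (Sigma n) (c * varphi n) (lambda n)))%E.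

Definition minimax_detection_boundary (Sigma : forall n, 'M[R]_n)
    (lambda varphi : nat -> R) : Prop :=
  forall alpha : R, 0 < alpha < 2^-1 ->
    upper_detection_bound Sigma lambda varphi alpha /\
    lower_detection_bound Sigma lambda varphi alpha.

End detection.

(* Main.v *)
From HB Require Import structures.
Require Import Defs.
From mathcomp Require Import all_boot all_order all_algebra.
From mathcomp Require Import all_classical all_reals all_analysis.
From mathcomp Require Import measurable_realfun complex ring lra zify.

(** Why the boundary is sqrt (2 f(0) |log lambda| / (n lambda)).

    Write gamma for the autocovariance of the ARMA process. Since phi has no
    root in the closed unit disc, 1 / phi is a power series with geometrically
    decaying coefficients ([reciprocal_seriesP]). Taking covariances of both
    sides of the ARMA equation gives a difference equation for gamma
    ([acov_eq]); inverting phi(B) and its adjoint on the bounded sequence gamma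
    shows that gamma decays geometrically ([arma_decaying]) and that its sum is
    f(0) = (theta(1) / phi(1))^2 ([arma_total]). The same reciprocals, for phi
    and for theta, bound the Toeplitz quadratic forms of gamma from below
    ([arma_toeplitz_ge]), so that the covariance matrices have uniformly bounded
    inverses.

    Consequently Sigma_n acts on the indicator of a block of indices as
    multiplication by f(0), up to an error that is concentrated near the two ends
    of the block and has bounded l1 norm ([block_residual]). Hence, for an
    interval I of length lambda, with x its indicator vector,
    x^T Sigma x = f(0) n lambda + O(1) and
    x^T Sigma^-1 x = n lambda / f(0) + O(1), while disjoint intervals satisfy
    x^T Sigma^-1 y = O(1) ([interval_estimates]). For the purpose of detection
    the observations behave as independent ones of variance f(0). Put
    s^2 = - log lambda.

    Upper bound. The scan test rejects when |sum of Y over a window| is at least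
    sqrt (2 V) (s + 1), where V = f(0) n lambda + O(1) bounds the variances of
    the sums and the windows of length lambda start at the multiples of
    lambda / s. About s / lambda windows and a Gaussian tail lambda exp (- 2 s)
    make the type I error vanish ([scan_type1]). Some window nearly coincides
    with the interval of the signal, and c phi_n with c > 1 lifts its mean above
    the threshold by an unbounded number of standard deviations ([scan_type2]).

    Lower bound. Put the uniform prior on about 1 / lambda disjoint intervals. The
    likelihood ratio of the mixture has mean 1 under H_0; once each component is
    truncated where its log-likelihood is atypically large, which costs
    vanishing probability as c < 1, its second moment tends to 1, the
    off-diagonal terms being exp (o(1)) because the corresponding mean shifts
    are almost orthogonal. So the mixture is asymptotically indistinguishable
    from H_0 ([mixture_bound], [mixture_type2]), and a test of level alpha has
    type II error at least 1 - alpha - o(1). *)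


Set Implicit Arguments.
Unset Strict Implicit.
Unset Printing Implicit Defensive.

Import Order.TTheory GRing.Theory Num.Theory.
Import numFieldNormedType.Exports.

Local Open Scope classical_set_scope.
Local Open Scope ring_scope.

(** * Reciprocals of polynomials without roots in the unit disc *)

Lemma eq_coefM_trunc (F : nzRingType) (p q q' : {poly F}) (M : nat) :
  (forall j, (j < M)%N -> q`_j = q'`_j) ->
  forall j, (j < M)%N -> (p * q)`_j = (p * q')`_j.
Proof.
move=> qq' j jM; rewrite !coefM; apply: eq_bigr => i _; congr (_ * _).
by rewrite qq'// (leq_ltn_trans _ jM)// leq_subr.
Qed.

(** [a] is the series 1 / p, read off its truncations: below degree [M] a product
    only sees the first [M] coefficients. *)
Definition reciprocal_series (F : nzRingType) (p : {poly F}) (a : nat -> F) :=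
  forall M j, (j < M)%N -> (p * \poly_(k < M) a k)`_j = (j == 0)%N%:R.

(** Dividing a series by X - z solves a recursion of order one whose homogeneous
    solutions decay like |z|^-j; the factors are treated one at a time. *)
Lemma reciprocal_prodXsubC (F : numFieldType) (rs : seq F) :
  (forall z, z \in rs -> 1 < `|z|) ->
  exists (a : nat -> F) (C t : F), [/\ 0 <= C, 0 < t < 1,
    forall j, `|a j| <= C * t ^+ j &
    reciprocal_series (\prod_(z <- rs) ('X - z%:P)) a].
Proof.
elim: rs => [_|z rs IH rs1].
  exists (fun j => (j == 0)%N%:R), 1, 2^-1; split => //.
  - by rewrite invr_gt0 ltr0n/= invf_lt1 ?ltr0n// ltr1n.
  - case=> [|j]; first by rewrite expr0 mulr1 normr1.
    by rewrite normr0 mul1r exprn_ge0// invr_ge0 ler0n.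
  - by move=> M j jM; rewrite big_nil mul1r coef_poly jM.
have [|a [C [t [C0 /andP[t0 t1] aC ra]]]] := IH.
  by move=> y yrs; apply: rs1; rewrite inE yrs orbT.
have z1 : 1 < `|z| by apply: rs1; rewrite mem_head.
have z_gt0 : 0 < `|z| by apply: lt_trans z1.
have z0 : z != 0 by rewrite -normr_gt0.
pose rho := z^-1.
have rho0 : 0 < `|rho| by rewrite normr_gt0 invr_neq0.
have rho1 : `|rho| < 1 by rewrite normfV invf_lt1.
pose b := fix b j := if j is j'.+1 then rho * (b j' - a j) else - rho * a 0.
(* any rate between max t |rho| and 1 does; this one avoids comparing them *)
pose u := 1 - (1 - t) * (1 - `|rho|) / 2.
have tR : 0 < 1 - t by rewrite subr_gt0.
have rR : 0 < 1 - `|rho| by rewrite subr_gt0.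
have u1 : u < 1 by rewrite /u gtrBl divr_gt0 ?mulr_gt0.
have half_lt (x y : F) : 0 < x -> 0 < y -> y < 1 -> x * y / 2 < x.
  move=> x0 y0 y1; rewrite ltr_pdivrMr ?ltr0n//.
  apply: (@lt_le_trans _ _ (x * 1)); first by rewrite ltr_pM2l.
  by rewrite mulr1 ler_peMr ?ler1n// ltW.
have ur : `|rho| < u.
  rewrite /u ltrBrDl -ltrBrDr (mulrC (1 - t)).
  by apply: half_lt => //; rewrite gtrBl.
have ut : t <= u.
  rewrite /u lerBrDl -lerBrDr; apply/ltW.
  by apply: half_lt => //; rewrite gtrBl.
have u0 : 0 < u by apply: lt_le_trans ut.
have uD : 0 < u - `|rho| by rewrite subr_gt0.
pose C' := C * u / (u - `|rho|).
have C'0 : 0 <= C' by rewrite divr_ge0 ?mulr_ge0// ltW.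
have C'E : `|rho| * C' + C * u = C' * u.
  rewrite /C' -[in X in _ + X](divfK (lt0r_neq0 uD) (C * u)).
  by rewrite -/C' [in RHS](_ : u = `|rho| + (u - `|rho|)) ?mulrDr 1?mulrC// addrC subrK.
exists b, C', u; split => //; first by rewrite u0.
- elim => [|j IHj].
    rewrite expr0 mulr1 /= mulNr normrN normrM.
    have a0 := aC 0; rewrite expr0 mulr1 in a0.
    apply: (@le_trans _ _ (1 * C)).
      by apply: ler_pM => //; apply: ltW.
    rewrite mul1r /C' -mulrA ler_peMr// ler_pdivlMr// mul1r.
    by rewrite gerBl.
  rewrite [b _]/= normrM -(ler_pM2r u0).
  apply: (@le_trans _ _ ((`|rho| * (C' * u ^+ j) + C * u ^+ j.+1) * u)).
    rewrite ler_pM2r//; apply: (@le_trans _ _ (`|rho| * (`|b j| + `|a j.+1|))).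
      by rewrite ler_wpM2l// ler_normB.
    rewrite mulrDr; apply: lerD; first by rewrite ler_wpM2l.
    apply: (@le_trans _ _ (1 * `|a j.+1|)); first by rewrite ler_wpM2r// ltW.
    rewrite mul1r; apply: (le_trans (aC _)); rewrite ler_wpM2l//.
    by rewrite lerXn2r ?nnegrE// ltW.
  rewrite [X in _ + C * X]exprS.
  have -> : (`|rho| * (C' * u ^+ j) + C * (u * u ^+ j)) =
    (`|rho| * C' + C * u) * u ^+ j by rewrite [RHS]mulrDl !mulrA.
  by rewrite C'E exprS mulrA.
- move=> M j jM; rewrite big_cons mulrAC mulrC -(ra M j jM).
  apply: (@eq_coefM_trunc _ _ _ _ M) => // k kM.
  rewrite mulrBl coefB coefXM coefCM !coef_poly kM.
  case: k kM => [|k] kM /=; first by rewrite mulNr mulrN sub0r opprK mulrA divff// mul1r.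
  by rewrite (ltnW kM) mulrA divff// mul1r opprB addrC subrK.
Qed.

Lemma Re_sum (R : rcfType) (I : Type) (s : seq I) (F : I -> R[i]) :
  complex.Re (\sum_(i <- s) F i) = \sum_(i <- s) complex.Re (F i).
Proof. by apply: (big_morph (@complex.Re R)) => // -[? ?] [? ?]. Qed.

Lemma Re_mulC (R : rcfType) (x : R) (z : R[i]) :
  complex.Re (x%:C%C * z) = x * complex.Re z.
Proof. by case: z => u v; simpc. Qed.

(** Over the complex numbers [P] splits into factors [X - z] with |z| > 1; the
    real parts of the coefficients of its complex reciprocal are the
    coefficients of the real one. *)
Lemma reciprocal_seriesP (R : realType) (P : {poly R}) :
  P != 0 -> (forall z : R[i], `|z| <= 1 -> ~ complex_root P z) ->
  exists (a : nat -> R) (C t : R), [/\ 0 <= C, 0 < t < 1,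
    forall j, `|a j| <= C * t ^+ j & reciprocal_series P a].
Proof.
move=> P0 Proot; set Q := map_poly (real_complex R) P.
have Q0 : Q != 0 by rewrite map_poly_eq0.
have [rs Qrs] := closed_field_poly_normal Q.
have l0 : lead_coef Q != 0 by rewrite lead_coef_eq0.
have [|A [C [t [C0 /andP[t0 t1] AC rA]]]] := @reciprocal_prodXsubC R[i] rs.
  move=> z zrs; have := @Proot z; rewrite /complex_root -/Q => zQ.
  have rz : root Q z.
    by rewrite Qrs rootZ// root_prod_XsubC.
  rewrite real_ltNge ?normr_real ?real1//.
  by apply/negP => z1; apply: (zQ z1).
pose l := lead_coef Q.
have cR (x : R[i]) : 0 <= x -> x = (complex.Re x)%:C%C.
  by move=> x0; rewrite [LHS]complexE (ger0_Im x0) mulr0 addr0.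
have tE := cR _ (ltW t0).
have CE := cR _ (divr_ge0 C0 (normr_ge0 l)).
exists (fun j => complex.Re (A j / l)), (complex.Re (C / `|l|)), (complex.Re t).
split.
- by rewrite -lecR -CE divr_ge0.
- by rewrite -!ltcR -tE t0.
- move=> j; rewrite -lecR (le_trans (normc_ge_Re _))// normrM normfV.
  rewrite [leRHS](_ : _ = (complex.Re (C / `|l|))%:C%C * (complex.Re t)%:C%C ^+ j).
    by rewrite -CE -tE mulrAC ler_pM2r// invr_gt0 normr_gt0.
  by rewrite -rmorphXn -rmorphM.
- move=> M j jM; have := rA M j jM; rewrite !coefM => rAj.
  have -> : (j == 0)%N%:R = complex.Re ((j == 0)%N%:R : R[i]) by case: (j == 0)%N.
  rewrite -rAj Re_sum; apply: eq_bigr => i _.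
  have ijM : (j - i < M)%N by rewrite (leq_ltn_trans _ jM)// leq_subr.
  rewrite !coef_poly ijM -Re_mulC; congr complex.Re.
  rewrite (_ : (P`_i)%:C%C = Q`_i); last by rewrite /Q coef_map.
  by rewrite {1}Qrs coefZ -/l (mulrC l) -mulrA (mulrCA l) divff// mulr1.
Qed.

(** * Filters on two-sided sequences *)

Section filter.
Context {R : realType}.
Implicit Types (s h : int) (P Q U V : {poly R}) (w : int -> R).

(** The polynomial [P] in the shift by [s]: [s = -1] gives [P(B)], with [B] the
    backshift, and [s = 1] its adjoint. *)
Definition filt s P w h : R := \sum_(i < size P) P`_i * w (h + s * i%:Z).

Definition l1 P : R := \sum_(i < size P) `|P`_i|.

Definition sqnorm P : R := \sum_(i < size P) P`_i ^+ 2.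

Definition delta0 : int -> R := fun h => (h == 0)%:R.

Lemma sum_coef_trunc P (F : nat -> R) N : (size P <= N)%N ->
  (forall i, P`_i = 0 -> F i = 0) ->
  \sum_(i < size P) F i = \sum_(i < N) F i.
Proof.
move=> PN F0; rewrite (big_ord_widen _ F PN) big_mkcond; apply: eq_bigr => i _.
by case: ltnP => // Pi; rewrite F0// nth_default.
Qed.

Lemma filt_trunc s P w h N : (size P <= N)%N ->
  filt s P w h = \sum_(i < N) P`_i * w (h + s * i%:Z).
Proof.
move=> PN; apply: (sum_coef_trunc (F := fun i => P`_i * w (h + s * i%:Z))) => //.
by move=> i ->; rewrite mul0r.
Qed.

Lemma l1_trunc P N : (size P <= N)%N -> l1 P = \sum_(i < N) `|P`_i|.
Proof.
move=> PN; apply: (sum_coef_trunc (F := fun i => `|P`_i|)) => //.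
by move=> i ->; rewrite normr0.
Qed.

Lemma sqnorm_trunc P N : (size P <= N)%N -> sqnorm P = \sum_(i < N) P`_i ^+ 2.
Proof.
move=> PN; apply: (sum_coef_trunc (F := fun i => P`_i ^+ 2)) => //.
by move=> i ->; rewrite expr0n.
Qed.

Lemma l1_ge0 P : 0 <= l1 P. Proof. exact: sumr_ge0. Qed.

Lemma sqnorm_ge0 P : 0 <= sqnorm P.
Proof. by apply: sumr_ge0 => i _; exact: sqr_ge0. Qed.

Lemma filtD s P Q w h : filt s (P + Q) w h = filt s P w h + filt s Q w h.
Proof.
pose N := maxn (size P) (size Q).
rewrite !(@filt_trunc _ _ _ _ N) ?leq_maxl ?leq_maxr ?(leq_trans (size_polyD _ _))//.
by rewrite -big_split; apply: eq_bigr => i _; rewrite coefD mulrDl.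
Qed.

Lemma filtC s c w h : filt s c%:P w h = c * w h.
Proof.
rewrite (@filt_trunc _ _ _ _ 1) ?size_polyC_leq1//.
by rewrite big_ord1 coefC mulr0 addr0.
Qed.

Lemma filt1 s w h : filt s 1 w h = w h.
Proof. by rewrite filtC mul1r. Qed.

Lemma filtMX s P w h : filt s (P * 'X) w h = filt s P w (h + s).
Proof.
rewrite (@filt_trunc _ _ _ _ (size P).+1); last first.
  have [->|P0] := eqVneq P 0; first by rewrite mul0r size_poly0.
  by rewrite size_mulX.
rewrite big_ord_recl coefMX mul0r add0r; apply: eq_bigr => i _.
by rewrite coefMX/=; congr (_ * w _); rewrite /bump/=; lia.
Qed.

Lemma eq_filt s P w w' : w =1 w' -> filt s P w =1 filt s P w'.
Proof. by move=> ww' h; apply: eq_bigr => i _; rewrite ww'. Qed.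

Lemma filt_poly_ind s P c w h :
  filt s (P * 'X + c%:P) w h = filt s P w (h + s) + c * w h.
Proof. by rewrite filtD filtMX filtC. Qed.

Lemma filt0 s w h : filt s 0 w h = 0.
Proof. by rewrite /filt size_poly0 big_ord0. Qed.

Lemma filtM s P Q w h : filt s (P * Q) w h = filt s P (filt s Q w) h.
Proof.
elim/poly_ind: P h => [|P c IH] h; first by rewrite mul0r !filt0.
rewrite mulrDl -mulrA (mulrC 'X) mulrA filtD filtMX IH filt_poly_ind.
congr (_ + _); rewrite (@filt_trunc _ (c%:P * Q) _ _ (size Q)).
  by rewrite mulr_sumr; apply: eq_bigr => i _; rewrite coefCM mulrA.
by rewrite mul_polyC size_scale_leq.
Qed.

Lemma filtC_comm s s' P Q w h :
  filt s P (filt s' Q w) h = filt s' Q (filt s P w) h.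
Proof.
rewrite /filt; under eq_bigr do rewrite mulr_sumr.
rewrite exchange_big; apply: eq_bigr => j _; rewrite mulr_sumr.
by apply: eq_bigr => i _; rewrite mulrCA addrAC.
Qed.

Lemma filt_bound s P w h (K : R) : (forall h, `|w h| <= K) -> `|filt s P w h| <= l1 P * K.
Proof.
move=> wK; apply: (le_trans (ler_norm_sum _ _ _)).
by rewrite mulr_suml; apply: ler_sum => i _; rewrite normrM ler_wpM2l.
Qed.

End filter.

(** * Geometrically decaying sequences *)

Section decay.
Context {R : realType}.
Implicit Types (s h : int) (P Q U V : {poly R}) (w : int -> R).

Definition decay_at (C t : R) w := forall h, `|w h| <= C * t ^+ `|h|%N.

Definition decaying w :=
  exists C t : R, [/\ 0 <= C, 0 < t < 1 & decay_at C t w].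

Lemma decay_at_weaken (C C' t t' : R) w : 0 <= C -> C <= C' -> 0 <= t -> t <= t' ->
  decay_at C t w -> decay_at C' t' w.
Proof.
move=> C0 CC t0 tt wC h; apply: (le_trans (wC h)).
apply: ler_pM => //; first exact: exprn_ge0.
by rewrite lerXn2r ?nnegrE// (le_trans t0).
Qed.

Lemma decayingD w w' : decaying w -> decaying w' ->
  decaying (fun h => w h + w' h).
Proof.
move=> [C [t [C0 /andP[t0 t1] wC]]] [C' [t' [C'0 /andP[t'0 t'1] w'C]]].
exists (C + C'), (Num.max t t'); split; first exact: addr_ge0.
  by rewrite lt_max t0/= gt_max t1.
move=> h; apply: (le_trans (ler_normD _ _)); rewrite mulrDl.
have tm : t <= Num.max t t' by rewrite le_max lexx.
have t'm : t' <= Num.max t t' by rewrite le_max lexx orbT.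
apply: lerD; first exact: (decay_at_weaken C0 (lexx C) (ltW t0) tm wC).
exact: (decay_at_weaken C'0 (lexx C') (ltW t'0) t'm w'C).
Qed.

Lemma decayingZ c w : decaying w -> decaying (fun h => c * w h).
Proof.
move=> [C [t [C0 t01 wC]]]; exists (`|c| * C), t; split => //.
  exact: mulr_ge0.
by move=> h; rewrite normrM -mulrA ler_wpM2l.
Qed.

Lemma decaying_shift s w : decaying w -> decaying (fun h => w (h + s)).
Proof.
move=> [C [t [C0 /andP[t0 t1] wC]]]; exists (C / t ^+ `|s|%N), t; split.
- by rewrite divr_ge0// exprn_ge0// ltW.
- by rewrite t0.
move=> h; apply: (le_trans (wC _)); rewrite -mulrA ler_wpM2l//.
rewrite -(ler_pM2l (exprn_gt0 `|s|%N t0)) mulrA divff ?mul1r; last first.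
  by rewrite expf_neq0// gt_eqF.
rewrite -exprD; apply: ler_wiXn2l; rewrite ?ltW//; lia.
Qed.

Lemma decaying_filt s P w : decaying w -> decaying (filt s P w).
Proof.
move=> wd; elim/poly_ind: P => [|P c IH].
  exists 1, 2^-1; split => //; first by rewrite invr_gt0 ltr0n/= invf_lt1// ltr1n.
  by move=> h; rewrite filt0 normr0 mul1r exprn_ge0// invr_ge0.
have := decayingD (decaying_shift s IH) (decayingZ c wd).
congr decaying; apply: funext => h; exact/esym/filt_poly_ind.
Qed.

Lemma decaying_delta0 : decaying (@delta0 R).
Proof.
exists 1, 2^-1; split => //; first by rewrite invr_gt0 ltr0n/= invf_lt1// ltr1n.
move=> h; rewrite mul1r /delta0; case: eqP => [->|_].
  by rewrite normr1 expr0.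
by rewrite normr0 exprn_ge0// invr_ge0.
Qed.

Lemma geometric_small (t K e : R) : 0 <= t < 1 -> 0 < e ->
  exists M : nat, K * t ^+ M <= e.
Proof.
move=> /andP[t0 t1] e0.
have : (fun M => K * t ^+ M) @ \oo --> K * 0.
  by apply: cvgMl_tmp; apply: cvg_expr; rewrite ger0_norm.
rewrite mulr0 => /cvgrPdist_le /(_ e e0)[M _ /(_ M (leqnn M))] /=.
by rewrite sub0r normrN => H; exists M; apply: le_trans H; exact: ler_norm.
Qed.

Lemma geometric_sum_le (t : R) M : 0 <= t < 1 ->
  \sum_(i < M) t ^+ i <= (1 - t)^-1.
Proof.
move=> /andP[t0 t1]; have t1' : 0 < 1 - t by rewrite subr_gt0.
rewrite -[leRHS]mul1r ler_pdivlMr// mulrC.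
have -> : (1 - t) * \sum_(i < M) t ^+ i = 1 - t ^+ M.
  by have := subrX1 t M => E; rewrite -[RHS]opprB E; ring.
by rewrite gerBl exprn_ge0.
Qed.

(** [P * \poly_(k < M) a k] agrees with 1 below degree M, and beyond only
    coefficients of [a] of index at least [M - size P] occur. *)
Lemma l1_reciprocal_error P (a : nat -> R) (C t : R) : 0 <= C -> 0 < t < 1 ->
  (forall j, `|a j| <= C * t ^+ j) -> reciprocal_series P a ->
  exists D : R, 0 <= D /\
    forall M, l1 (P * \poly_(k < M) a k - 1) <= D * t ^+ M.
Proof.
move=> C0 /andP[t0 t1] aC ra.
have tn0 n : 0 < t ^+ n by exact: exprn_gt0.
have ge0 : 0 <= l1 P * (C / t ^+ size P).
  by rewrite mulr_ge0 ?l1_ge0// divr_ge0// ltW.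
exists ((size P).+1%:R * (l1 P * (C / t ^+ size P) + 1)); split.
  by rewrite mulr_ge0// addr_ge0.
move=> M; set A := \poly_(k < M) a k.
rewrite (@l1_trunc _ _ (M + (size P).+1)%N); last first.
  rewrite (leq_trans (size_polyD _ _))// size_polyN geq_max; apply/andP; split.
    rewrite (leq_trans (size_polyMleq _ _))//.
    rewrite (leq_trans (leq_pred _))// addnC leq_add ?size_poly//.
  by rewrite (leq_trans (size_polyC_leq1 _))// addnS.
rewrite big_split_ord/= big1 ?add0r; last first.
  by move=> i _; rewrite coefB ra// coef1 subrr normr0.
rewrite -mulrA mulr_natl -[X in _ *+ X]card_ord -sumr_const; apply: ler_sum => i _.
have gM0 : 0 <= C / t ^+ size P * t ^+ M by rewrite mulr_ge0 ?divr_ge0// ltW.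
rewrite coefB coef1 mulrDl mul1r; apply: (le_trans (ler_normB _ _)).
apply: lerD; last first.
  case: eqP => [|_]; last by rewrite normr0 ltW.
  by move/eqP; rewrite addn_eq0 => /andP[/eqP -> _]; rewrite normr1 expr0.
rewrite coefM; apply: (le_trans (ler_norm_sum _ _ _)).
rewrite (@l1_trunc _ P (size P + (M + i).+1)%N) ?leq_addr//.
rewrite -mulrA mulr_suml.
rewrite (_ : (size P + (M + i).+1 = (M + i).+1 + size P)%N); last by rewrite addnC.
rewrite big_split_ord/= ler_wpDr//.
  by apply: sumr_ge0 => j _; apply: mulr_ge0.
apply: ler_sum => j _; rewrite normrM.
have [Pj|jP] := leqP (size P) j.
  by rewrite nth_default// normr0 !mul0r.
rewrite ler_wpM2l// coef_poly; case: ifPn => [_|_]; last first.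
  by rewrite normr0.
apply: (le_trans (aC _)); rewrite -mulrA ler_wpM2l//.
rewrite ler_pdivlMl// -exprD; apply: ler_wiXn2l; rewrite ?ltW//.
by rewrite -leq_subLR leq_sub ?leq_addr// ltnW.
Qed.

(** * Inverting a filter on bounded sequences *)

(** The composite filter is [P * \poly_(k < M) a k], whose l1 distance to 1 is
    O(t^M); the direction of time [s] does not matter. *)
Lemma inverse_filter_approx s P (a : nat -> R) (C t : R) w (K : R) : 0 <= C -> 0 < t < 1 ->
  (forall j, `|a j| <= C * t ^+ j) -> reciprocal_series P a ->
  (forall h, `|w h| <= K) ->
  forall h (e : R), 0 < e ->
  exists M, `|w h - filt s (\poly_(k < M) a k) (filt s P w) h| <= e.
Proof.
move=> C0 t01 aC ra wK h e e0; have /andP[t0 t1] := t01.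
have [D [D0 DM]] := l1_reciprocal_error C0 t01 aC ra.
have [|M Me] := @geometric_small t (D * K) e _ e0; first by rewrite ltW.
exists M; rewrite -filtM mulrC.
set Y := P * _; have -> : Y = 1 + (Y - 1) by rewrite addrC subrK.
rewrite filtD filt1 opprD addNKr normrN.
apply: (le_trans (filt_bound _ _ _ wK)); apply: le_trans Me.
rewrite mulrAC ler_wpM2r//; first exact: le_trans (wK 0).
exact: DM.
Qed.

Lemma eq_absz1 s : (`|s| = 1)%N -> s = 1 \/ s = -1.
Proof. by case: s => [[|[|n]]|[|n]] //; [left|right]. Qed.

Lemma absz_shift s h (i : nat) : (`|s| = 1)%N ->
  (`|h| + i <= 2 * i + 2 * `|(h + s * i%:Z)%R|)%N.
Proof. by move=> /eq_absz1[->|->]; rewrite ?mul1r ?mulN1r; lia. Qed.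

(** Being bounded, [w] is recovered from [filt s P w] by the reciprocal filter.
    The convolution of two geometric sequences of rate [v] is bounded by one of
    rate sqrt v. *)
Lemma bounded_solution_decaying s P w : (`|s| = 1)%N ->
  P != 0 -> (forall z : R[i], `|z| <= 1 -> ~ complex_root P z) ->
  (exists K, forall h, `|w h| <= K) -> decaying (filt s P w) -> decaying w.
Proof.
move=> s1 P0 Proot [K wK] [D [u [D0 /andP[u0 u1] gD]]].
have [a [C [t [C0 t01 aC ra]]]] := reciprocal_seriesP P0 Proot.
have /andP[t0 t1] := t01.
pose v := Num.max t u.
have tv : t <= v by rewrite le_max lexx.
have uv : u <= v by rewrite le_max lexx orbT.
have v0 : 0 < v by rewrite lt_max t0.
have v1 : v < 1 by rewrite gt_max t1.
pose tau := Num.sqrt v.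
have tau0 : 0 < tau by rewrite sqrtr_gt0.
have vE : v = tau ^+ 2 by rewrite sqr_sqrtr// ltW.
have tau1 : tau < 1 by rewrite -[ltRHS]sqrtr1 ltr_sqrt.
have t1' : 0 < 1 - tau by rewrite subr_gt0.
have B0 : 0 <= C * D / (1 - tau) by rewrite divr_ge0 ?mulr_ge0// ltW.
exists (C * D / (1 - tau)), tau; split => //; first by rewrite tau0.
move=> h; apply/ler_addgt0Pr => e e0.
have [M wM] := inverse_filter_approx s C0 t01 aC ra wK h e0.
rewrite -(subrK (filt s (\poly_(k < M) a k) (filt s P w) h) (w h)).
apply: (le_trans (ler_normD _ _)); rewrite addrC lerD//.
rewrite (@filt_trunc _ _ _ _ _ M) ?size_poly//.
apply: (le_trans (ler_norm_sum _ _ _)).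
apply: (@le_trans _ _ (\sum_(i < M) C * D * tau ^+ `|h|%N * tau ^+ i)); last first.
  rewrite -mulr_sumr [leRHS]mulrAC ler_wpM2l//.
    by rewrite !mulr_ge0// exprn_ge0// ltW.
  by rewrite geometric_sum_le// ltW.
apply: ler_sum => i _; rewrite coef_poly ltn_ord normrM.
apply: (@le_trans _ _ (C * tau ^+ (2 * i) * (D * tau ^+ (2 * `|h + s * i%:Z|)))).
  apply: ler_pM => //.
    apply: (le_trans (aC i)); rewrite ler_wpM2l// exprM -vE.
    by rewrite lerXn2r ?nnegrE// ltW.
  apply: (le_trans (gD _)); rewrite ler_wpM2l// exprM -vE.
  by rewrite lerXn2r ?nnegrE// ltW.
rewrite mulrACA -!mulrA ler_wpM2l// ler_wpM2l// -!exprD.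
by apply: ler_wiXn2l; [exact: ltW|exact: ltW|exact: absz_shift].
Qed.

End decay.

(** * Sums of geometrically decaying sequences *)

Section total.
Context {R : realType}.
Implicit Types (s h : int) (P Q U V : {poly R}) (w : int -> R).

Lemma geometric_tail (w : nat -> R) (C t : R) : 0 <= C -> 0 < t < 1 ->
  (forall k, `|w k| <= C * t ^+ k) ->
  exists r : nat -> R, (forall N, r N - r N.+1 = w N) /\
    (forall N, `|r N| <= C / (1 - t) * t ^+ N).
Proof.
move=> C0 /andP[t0 t1] wC.
have t1' : 0 < 1 - t by rewrite subr_gt0.
have cw : cvgn (series w).
  apply: normed_cvg; apply: (series_le_cvg (v_ := geometric C t)) => //.
  - by move=> n /=.
  - by move=> n; rewrite /geometric/= mulr_ge0// exprn_ge0// ltW.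
  - by apply: is_cvg_geometric_series; rewrite ger0_norm// ltW.
exists (fun N => limn (series w) - series w N); split.
  by move=> N; rewrite opprB addrC addrA subrK seriesSr addrC addKr.
move=> N; have cwN : `|series w M - series w N| @[M --> \oo]
    --> `|limn (series w) - series w N|.
  by apply: cvg_norm; apply: cvgB => //; exact: cvg_cst.
apply: (cvgr_to_le cwN); near=> M.
have NM : (N <= M)%N by near: M; exact: nbhs_infty_ge.
rewrite sub_series_geq//; apply: (le_trans (ler_norm_sum _ _ _)).
rewrite -{1}(add0n N) big_addn big_mkord.
apply: (@le_trans _ _ (\sum_(i < M - N) C * t ^+ N * t ^+ i)).
  by apply: ler_sum => i _; rewrite (le_trans (wC _))// addnC exprD mulrA.
rewrite -mulr_sumr [leRHS]mulrAC ler_wpM2l ?geometric_sum_le//.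
  by rewrite mulr_ge0// exprn_ge0// ltW.
by rewrite ltW.
Unshelve. all: by end_near. Qed.

(** Rather than as the limit of the sums over |h| <= N, the sum of a sequence is
    encoded by summation by parts: [w] has sum [f] when [w] and [f] times the
    unit impulse differ by the increments of a decaying sequence. *)
Definition has_total w (f : R) := exists2 H : int -> R, decaying H &
  forall x, w x = f * delta0 x + (H (x + 1) - H x).

(** [H] is a tail sum of [w] on the left of the origin and minus a tail sum on the
    right; its jump at the origin is made up for by the total. *)
Lemma decaying_has_total w : decaying w -> exists f, has_total w f.
Proof.
move=> [C [t [C0 t01 wC]]]; have /andP[t0 t1] := t01.
have t1' : 0 < 1 - t by rewrite subr_gt0.
have [r [rw rC]] := @geometric_tail (fun k => w k%:Z) _ _ C0 t01 (fun k => wC k%:Z).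
have [|l [lw lC]] := @geometric_tail (fun k => w (- k%:Z)) _ _ C0 t01.
  by move=> k; have := wC (- k%:Z); rewrite abszN.
exists (r 0 + l 1).
pose H (x : int) := match x with
  | Posz 0 => l 1 | Posz m.+1 => - r m.+1 | Negz m => l m.+2 end.
have D0 : 0 <= C / (1 - t) by rewrite divr_ge0// ltW.
have tle (m n : nat) : (m <= n)%N -> C / (1 - t) * t ^+ n <= C / (1 - t) * t ^+ m.
  by move=> mn; rewrite ler_wpM2l// ler_wiXn2l// ltW.
exists H.
  exists (C / (1 - t)), t; split => // -[[|m]|m]; rewrite /H.
  - by apply: le_trans (lC _) _; exact: tle.
  - by rewrite normrN.
  - by apply: le_trans (lC _) _; exact: tle.
move=> [[|m]|[|m]]; rewrite /delta0.
- by rewrite mulr1 add0r /= -(rw 0); ring.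
- rewrite mulr0 add0r (_ : m.+1%:Z + 1 = m.+2%:Z); last by rewrite -PoszD addn1.
  by rewrite /H -rw; ring.
- rewrite mulr0 add0r (_ : Negz 0 + 1 = 0)// /H.
  by rewrite NegzE -lw.
- rewrite [Negz m.+1 == 0](_ : _ = false)// mulr0 add0r.
  rewrite (_ : Negz m.+1 + 1 = Negz m)//; last by rewrite !NegzE; lia.
  by rewrite /H NegzE -lw.
Qed.

(** The increments of [H] telescope. *)
Lemma has_total_cvg w f : has_total w f ->
  (fun N : nat => \sum_(0 <= k < N.*2.+1) w (k%:Z - N%:Z)) @ \oo --> f.
Proof.
move=> [H [C [t [C0 /andP[t0 t1] HC]]] wH].
have -> : (fun N : nat => \sum_(0 <= k < N.*2.+1) w (k%:Z - N%:Z)) =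
    (fun N : nat => f + (H N.+1%:Z - H (- N%:Z))).
  apply: funext => N.
  rewrite (eq_bigr (fun k : nat => f * delta0 (k%:Z - N%:Z) +
      (H (k.+1%:Z - N%:Z) - H (k%:Z - N%:Z)))); last first.
    by move=> k _; rewrite wH; congr (_ + (H _ - _)); lia.
  rewrite big_split/= telescope_sumr// sub0r; congr (_ + (H _ - _)); last lia.
  rewrite -mulr_sumr big_mkord (bigD1 (inord N))//= inordK; last by lia.
  rewrite /delta0 subrr eqxx big1 ?addr0 ?mulr1// => i /eqP iN.
  case: eqP => // iN'; case: iN; apply: val_inj; rewrite /= inordK; lia.
rewrite -[X in _ --> X]addr0; apply: cvgD; first exact: cvg_cst.
have tc : (fun N => C * t ^+ N) @ \oo --> (0 : R).
  by rewrite -(mulr0 C); apply: cvgMl_tmp; apply: cvg_expr; rewrite ger0_norm// ltW.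
have H0 (u : nat -> int) : (forall N, (N <= `|u N|)%N) ->
    (fun N => H (u N)) @ \oo --> (0 : R).
  move=> uN; apply/norm_cvg0P; apply: squeeze_cvgr tc; last exact: cvg_cst.
  apply: nearW => N; rewrite normr_ge0/=; apply: (le_trans (HC _)).
  by rewrite ler_wpM2l// ler_wiXn2l// ltW.
rewrite -[X in _ --> X]subr0; apply: cvgB; apply: H0 => N; lia.
Qed.

Lemma has_total_unique w f f' : has_total w f -> has_total w f' -> f = f'.
Proof. move=> /has_total_cvg wf /has_total_cvg; exact: cvg_unique wf. Qed.

Lemma has_total_delta0 : has_total (@delta0 R) 1.
Proof.
exists (fun=> 0); last by move=> x; rewrite mul1r subr0 addr0.
exists 0, 2^-1; split => //; first by rewrite invr_gt0 ltr0n/= invf_lt1// ltr1n.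
by move=> h; rewrite normr0 mul0r.
Qed.

Lemma has_totalD w w' f f' : has_total w f -> has_total w' f' ->
  has_total (fun h => w h + w' h) (f + f').
Proof.
move=> [H Hd wH] [H' Hd' wH']; exists (fun h => H h + H' h).
  exact: decayingD.
by move=> x; rewrite wH wH'; ring.
Qed.

Lemma has_totalZ c w f : has_total w f -> has_total (fun h => c * w h) (c * f).
Proof.
move=> [H Hd wH]; exists (fun h => c * H h); first exact: decayingZ.
by move=> x; rewrite wH; ring.
Qed.

Lemma has_total_shift s w f : (`|s| = 1)%N -> decaying w -> has_total w f ->
  has_total (fun h => w (h + s)) f.
Proof.
move=> s1 dw [H Hd wH]; have [->|->] := eq_absz1 s1.
  exists (fun h => H h + w h); first exact: decayingD.
  by move=> x; rewrite {1}[in RHS]addrAC opprD [RHS]addrA; have := wH x; lra.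
exists (fun h => H h + -1 * w (h + -1)).
  by apply: decayingD => //; apply: decayingZ; exact: decaying_shift.
by move=> x; have := wH x; rewrite (_ : x + 1 + -1 = x) ?addrK//; lra.
Qed.

(** A shift adds one telescoping term to the encoding and leaves the sum alone, so
    that [P] acts on sums through its value at 1. *)
Lemma has_total_filt s P w f : (`|s| = 1)%N -> decaying w -> has_total w f ->
  has_total (filt s P w) (P.[1] * f).
Proof.
move=> s1 dw wf; elim/poly_ind: P => [|P c IH].
  rewrite horner0 mul0r; have := has_totalZ 0 wf; rewrite mul0r.
  by congr has_total; apply: funext => h; rewrite filt0 mul0r.
rewrite hornerMXaddC mulr1 mulrDl.
have := has_totalD (has_total_shift s1 (decaying_filt s P dw) IH) (has_totalZ c wf).
by congr has_total; apply: funext => h; rewrite filt_poly_ind.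
Qed.

End total.

(** * The autocovariance of an ARMA process *)

Section arma_autocovariance.
Context {R : realType}.
Implicit Types (s h : int) (P Q U V W : {poly R}) (w : int -> R).

(** The quadratic form of the Toeplitz kernel [w] at the coefficients of [V]. *)
Definition toeplitz w V : R := filt (-1) V (filt 1 V w) 0.

Lemma eq_toeplitz w w' V : w =1 w' -> toeplitz w V = toeplitz w' V.
Proof. by move=> ww'; apply: eq_filt => h; exact: eq_filt. Qed.

Lemma filtM2 P V w h :
  filt (-1) (P * V) (filt 1 (P * V) w) h =
  filt (-1) P (filt 1 P (filt (-1) V (filt 1 V w))) h.
Proof.
rewrite filtM; apply: eq_filt => k; rewrite [RHS]filtC_comm.
by apply: eq_filt => l; exact: filtM.
Qed.

Lemma toeplitzM w P V :
  toeplitz w (P * V) = toeplitz (filt (-1) P (filt 1 P w)) V.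
Proof. by rewrite /toeplitz mulrC filtM2. Qed.

Lemma sum_delta0 (s h : int) N : (`|s| = 1)%N ->
  \sum_(i < N) delta0 (h + s * i%:Z) <= 1 :> R.
Proof.
move=> s1; case: (pickP (fun i : 'I_N => h + s * i%:Z == 0)) => [i /eqP i0|no0].
  rewrite (bigD1 i)//= /delta0 i0 eqxx big1 ?addr0// => j /eqP ji.
  case: eqP => // j0; case: ji; apply: val_inj => /=.
  by have [sE|sE] := eq_absz1 s1; move: i0 j0; rewrite sE; lia.
by rewrite big1// => i _; rewrite /delta0 no0.
Qed.

(** By |a b| <= (a^2 + b^2) / 2, as each index belongs to at most one pair of
    indices at a given lag. *)
Lemma autocorrelation_le V h :
  `|filt (-1) V (filt 1 V delta0) h| <= sqnorm V.
Proof.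
rewrite /filt; under eq_bigr do rewrite mulr_sumr.
apply: (le_trans (ler_norm_sum _ _ _)).
apply: (@le_trans _ _ (\sum_(i < size V) \sum_(j < size V)
   (2^-1 * (V`_i ^+ 2 * delta0 (h + -1 * i%:Z + 1 * j%:Z)) +
    2^-1 * (V`_j ^+ 2 * delta0 (h + 1 * j%:Z + -1 * i%:Z))))).
  apply: ler_sum => i _; apply: (le_trans (ler_norm_sum _ _ _)).
  apply: ler_sum => j _; rewrite [h + 1 * _ + _]addrAC -mulrDr -mulrDl.
  rewrite /delta0; case: eqP => _; last by rewrite !mulr0 normr0.
  by rewrite !mulr1 normrM; have := sqr_ge0 (`|V`_i| - `|V`_j|);
     rewrite sqrrB !real_normK ?num_real//; lra.
under eq_bigr do rewrite big_split/= -!mulr_sumr.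
rewrite big_split/= -!mulr_sumr.
have half (F : 'I_(size V) -> R) : (forall i, F i <= 1) ->
   2^-1 * \sum_(i < size V) V`_i ^+ 2 * F i <= 2^-1 * sqnorm V.
  move=> F1; rewrite ler_pM2l ?invr_gt0 ?ltr0n//; apply: ler_sum => i _.
  by rewrite ler_piMr// sqr_ge0.
rewrite [leRHS](_ : _ = 2^-1 * sqnorm V + 2^-1 * sqnorm V); last by field.
apply: lerD.
  by apply: half => i; exact: sum_delta0.
rewrite exchange_big/=; under eq_bigr do rewrite -mulr_sumr; apply: half => i.
exact: sum_delta0.
Qed.

Lemma toeplitz_delta0 V : toeplitz delta0 V = sqnorm V.
Proof.
apply: eq_bigr => i _; rewrite expr2; congr (_ * _).
rewrite /filt (bigD1 i)//= big1 ?addr0.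
  by rewrite /delta0 add0r mulN1r mul1r addNr mulr1.
move=> j ji; rewrite /delta0 add0r mulN1r mul1r addrC subr_eq0 eqz_nat.
by rewrite (inj_eq val_inj) (negbTE ji) mulr0.
Qed.

(** Young's inequality: the coefficients of [P * V] are those of a convolution. *)
Lemma sqnormM_le P V : sqnorm (P * V) <= l1 P ^+ 2 * sqnorm V.
Proof.
rewrite -toeplitz_delta0 mulrC /toeplitz mulrC filtM2.
apply: (le_trans (ler_norm _)); rewrite expr2 -mulrA; apply: filt_bound => h.
by apply: filt_bound => {}h; exact: autocorrelation_le.
Qed.

Lemma coef_reciprocal_mul P (a : nat -> R) V M j : reciprocal_series P a ->
  (j < M)%N -> (P * \poly_(k < M) a k * V)`_j = V`_j.
Proof.
move=> ra jM; rewrite -[in RHS](mulr1 V) mulrC.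
apply: (eq_coefM_trunc V _ jM) => i iM.
by rewrite ra// coef1.
Qed.

Lemma sqnorm_le_trunc V V' M : (size V <= M)%N ->
  (forall j, (j < M)%N -> V'`_j = V`_j) -> sqnorm V <= sqnorm V'.
Proof.
move=> VM VV'; rewrite (sqnorm_trunc VM).
rewrite (@sqnorm_trunc _ V' (M + size V')) ?leq_addl// big_split_ord/=.
rewrite ler_wpDr//; first by apply: sumr_ge0 => i _; exact: sqr_ge0.
by apply: ler_sum => i _; rewrite VV'.
Qed.

Lemma l1_reciprocal_le (a : nat -> R) (C t : R) M : 0 <= C -> 0 < t < 1 ->
  (forall j, `|a j| <= C * t ^+ j) -> l1 (\poly_(k < M) a k) <= C / (1 - t).
Proof.
move=> C0 /andP[t0 t1] aC; rewrite (@l1_trunc _ _ M) ?size_poly//.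
apply: (@le_trans _ _ (\sum_(i < M) C * t ^+ i)).
  by apply: ler_sum => i _; rewrite coef_poly ltn_ord.
by rewrite -mulr_sumr ler_wpM2l// geometric_sum_le// ltW.
Qed.

(** A truncation [A] of the reciprocal series of [P] recovers [V] from [P * V] in
    all degrees below [size V], and the l1 norms of the truncations are
    bounded. *)
Lemma sqnorm_le_mul P :
  P != 0 -> (forall z : R[i], `|z| <= 1 -> ~ complex_root P z) ->
  exists2 B : R, 0 < B & forall V, sqnorm V <= B * sqnorm (P * V).
Proof.
move=> P0 Proot; have [a [C [t [C0 t01 aC ra]]]] := reciprocal_seriesP P0 Proot.
have /andP[t0 t1] := t01.
have B0 : 0 <= C / (1 - t) by rewrite divr_ge0// subr_ge0 ltW.
exists ((C / (1 - t)) ^+ 2 + 1) => [|V]; first by rewrite ltr_wpDl ?sqr_ge0.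
pose A := \poly_(k < size V) a k.
apply: (@le_trans _ _ (sqnorm (A * (P * V)))).
  apply: (@sqnorm_le_trunc _ _ (size V)) => // j jV.
  by rewrite mulrA (mulrC A) coef_reciprocal_mul.
apply: (le_trans (sqnormM_le _ _)); rewrite ler_wpM2r ?sqnorm_ge0//.
rewrite ler_wpDr// lerXn2r ?nnegrE ?l1_ge0//; exact: l1_reciprocal_le.
Qed.

(** The factor [Y] filters the kernel once in each direction of time, and a
    filter close to 1 in l1 moves a bounded sequence by at most [e] times its
    bound. *)
Lemma toeplitz_perturb w K V Y e : (forall h, `|w h| <= K) ->
  l1 (Y - 1) <= e -> toeplitz w (V * Y) <=
    toeplitz w V + l1 V ^+ 2 * K * (2 * e + e ^+ 2).
Proof.
move=> wK Ye; have e0 : 0 <= e by apply: le_trans Ye; exact: l1_ge0.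
have K0 : 0 <= K by apply: le_trans (wK 0).
rewrite toeplitzM -/(toeplitz w V).
set k := filt (-1) V (filt 1 V w).
have -> : toeplitz w V = k 0 by [].
have kK h : `|k h| <= l1 V ^+ 2 * K.
  by rewrite expr2 -mulrA; do 2?[apply: filt_bound => ?].
set K' := l1 V ^+ 2 * K in kK *.
have K'0 : 0 <= K' by rewrite mulr_ge0 ?sqr_ge0.
have step s u L : 0 <= L -> (forall h, `|u h| <= L) ->
    forall h, `|filt s Y u h - u h| <= e * L.
  move=> L0 uL h; rewrite -{1}(subrK 1 Y) filtD filt1 addrK.
  by apply: (le_trans (filt_bound _ _ _ uL)); rewrite ler_wpM2r.
have k1 := step 1 k K' K'0 kK.
have k1K h : `|filt 1 Y k h| <= (1 + e) * K'.
  rewrite -(subrK (k h) (filt 1 Y k h)); apply: (le_trans (ler_normD _ _)).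
  by rewrite mulrDl mul1r addrC lerD.
have k2 := step (-1) _ _ (mulr_ge0 (addr_ge0 ler01 e0) K'0) k1K 0.
have := k1 0; rewrite /toeplitz; move: k2; rewrite !ler_norml.
by move=> /andP[_ H1] /andP[_ H2]; nra.
Qed.

Variables (phi theta : {poly R}) (gamma : int -> R).
Hypotheses (phi0 : phi != 0) (theta0 : theta != 0).
Hypothesis phi_root : forall z : R[i], `|z| <= 1 -> ~ complex_root phi z.
Hypothesis theta_root : forall z : R[i], `|z| <= 1 -> ~ complex_root theta z.
Hypothesis gamma_bounded : exists K, forall h, `|gamma h| <= K.
Hypothesis gamma_eq : forall h, filt (-1) phi (filt 1 phi gamma) h =
  filt (-1) theta (filt 1 theta delta0) h.

(** [phi(B)] and its adjoint are inverted in turn; the right hand side vanishes at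
    large lags. *)
Lemma arma_decaying : decaying gamma.
Proof.
have [K gK] := gamma_bounded.
apply: (@bounded_solution_decaying _ 1 phi) => //.
apply: (@bounded_solution_decaying _ (-1) phi) => //.
  by exists (l1 phi * K) => h; exact: filt_bound.
rewrite (_ : filt _ _ _ = filt (-1) theta (filt 1 theta delta0)); last exact: funext.
by do 2!apply: decaying_filt; exact: decaying_delta0.
Qed.

Lemma complex_root_real P (x : R) : root P x -> complex_root P x%:C%C.
Proof. by rewrite /complex_root /root horner_map/= => /eqP ->. Qed.

Lemma horner1_neq0 P : (forall z : R[i], `|z| <= 1 -> ~ complex_root P z) ->
  P.[1] != 0.
Proof.
by move=> Proot; apply/negP => P1; apply: (Proot 1); rewrite ?normr1//;
   exact: (@complex_root_real P 1).
Qed.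

(** The two sides of [gamma_eq] have the sums [phi.[1] ^+ 2 * f] and
    [theta.[1] ^+ 2]. *)
Lemma arma_total : has_total gamma ((theta.[1] / phi.[1]) ^+ 2).
Proof.
have [f gf] := decaying_has_total arma_decaying.
have e1 : has_total (filt (-1) phi (filt 1 phi gamma)) (phi.[1] * (phi.[1] * f)).
  by do 2?apply: has_total_filt => //; do ?apply: decaying_filt; exact: arma_decaying.
have e2 : has_total (filt (-1) theta (filt 1 theta (@delta0 R)))
    (theta.[1] * (theta.[1] * 1)).
  do 2?apply: has_total_filt => //; do ?apply: decaying_filt;
  by [exact: decaying_delta0|exact: has_total_delta0].
rewrite (funext gamma_eq) in e1.
have f1 := has_total_unique e1 e2.
have p1 := horner1_neq0 phi_root.
suff -> : (theta.[1] / phi.[1]) ^+ 2 = f by [].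
rewrite expr_div_n; apply: (mulfI (expf_neq0 2 p1)).
by rewrite mulrC divfK ?expf_neq0// !expr2 -mulrA f1 mulr1.
Qed.

(** The spectral density of an ARMA process is bounded away from 0. Without
    Fourier series: pick [W] with [phi * W] close to [V]; then the form at [V]
    is close to the squared norm of [theta * W], which dominates that of [W],
    hence that of [V]. *)
Lemma arma_toeplitz_ge :
  exists2 c : R, 0 < c & forall V, c * sqnorm V <= toeplitz gamma V.
Proof.
have [K gK] := gamma_bounded.
have [B B0 Btheta] := sqnorm_le_mul theta0 theta_root.
have [a [C [t [C0 t01 aC ra]]]] := reciprocal_seriesP phi0 phi_root.
have /andP[t0 t1] := t01.
have [D [D0 DM]] := l1_reciprocal_error C0 t01 aC ra.
have l0 : 0 < l1 phi ^+ 2 + 1 by rewrite ltr_wpDl ?sqr_ge0.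
exists ((B * (l1 phi ^+ 2 + 1))^-1) => [|V]; first by rewrite invr_gt0 mulr_gt0.
apply/ler_addgt0Pr => e e0.
have K0 : 0 <= K by apply: le_trans (gK 0).
have L0 : 0 <= l1 V ^+ 2 * K by rewrite mulr_ge0 ?sqr_ge0.
pose e' := Num.min 1 (e / (3 * (l1 V ^+ 2 * K + 1))).
have d0 : 0 < 3 * (l1 V ^+ 2 * K + 1) by rewrite mulr_gt0 ?ltr_wpDl.
have e'0 : 0 < e' by rewrite lt_min ltr01 divr_gt0.
have [|M0 M0e] := @geometric_small _ t D e' _ e'0; first by rewrite t1 ltW.
pose M := (M0 + size V)%N.
pose A := \poly_(k < M) a k.
have Ye : l1 (phi * A - 1) <= e'.
  apply: (le_trans (DM M)); apply: le_trans M0e; rewrite ler_wpM2l//.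
  by rewrite ler_wiXn2l ?leq_addr// ltW.
have := toeplitz_perturb V gK Ye; rewrite (mulrC V) -(mulrA phi) toeplitzM.
rewrite (eq_toeplitz _ gamma_eq) -toeplitzM toeplitz_delta0 => H.
have W1 := Btheta (A * V).
have W2 := sqnormM_le phi (A * V).
have W3 : sqnorm V <= sqnorm (phi * (A * V)).
  apply: (@sqnorm_le_trunc _ _ M) => [|j jM]; first by rewrite leq_addl.
  by rewrite mulrA coef_reciprocal_mul.
have He : l1 V ^+ 2 * K * (2 * e' + e' ^+ 2) <= e.
  have e1 : e' <= 1 by rewrite ge_min lexx.
  have e2 : e' * (3 * (l1 V ^+ 2 * K + 1)) <= e.
    by rewrite -ler_pdivlMr// ge_min lexx orbT.
  apply: le_trans e2; rewrite [leRHS](_ : _ = l1 V ^+ 2 * K * (3 * e') + 3 * e').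
    apply: ler_wpDr; first by rewrite mulr_ge0// ltW.
    by apply: ler_wpM2l => //; nra.
  by ring.
have : (B * (l1 phi ^+ 2 + 1))^-1 * sqnorm V <= sqnorm (theta * (A * V)).
  rewrite ler_pdivrMl ?mulr_gt0// (le_trans W3)// (le_trans W2)//.
  rewrite (mulrC B) -[leRHS]mulrA; apply: ler_pM => //; [exact: sqr_ge0|exact: sqnorm_ge0|].
  by rewrite lerDl.
lra.
Qed.

End arma_autocovariance.

(** * Gaussian integrals on R^n *)

Section quadratic_form.
Context {R : realType}.

Definition bform n (A : 'M[R]_n) (u v : 'cV[R]_n) : R := (u^T *m A *m v) 0 0.

Definition posdef n (A : 'M[R]_n) : Prop :=
  A^T = A /\ forall v : 'cV[R]_n, v != 0 -> 0 < bform A v v.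

Lemma mx11_mulE (x y : 'M[R]_1) : (x *m y) 0 0 = x 0 0 * y 0 0.
Proof. by rewrite mxE big_ord1. Qed.

Definition schur n (A : 'M[R]_(1 + n)) : 'M[R]_n :=
  drsubmx A - (A 0 0)^-1 *: ((ursubmx A)^T *m ursubmx A).

Lemma sym_block n (A : 'M[R]_(1 + n)) : A^T = A ->
  A = block_mx (A 0 0)%:M (ursubmx A) (ursubmx A)^T (drsubmx A).
Proof.
move=> At; rewrite -{1}[A]submxK; congr block_mx; last by rewrite trmx_ursub At.
by rewrite [LHS]mx11_scalar; congr (_%:M); rewrite !mxE; congr (A _ _); exact: val_inj.
Qed.

(** Completing the square in the first variable. *)
Lemma bform_schur n (A : 'M[R]_(1 + n)) (x : R) (z : 'cV[R]_n) :
  A^T = A -> A 0 0 != 0 ->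
  bform A (col_mx x%:M z) (col_mx x%:M z) =
  A 0 0 * (x + (A 0 0)^-1 * (ursubmx A *m z) 0 0) ^+ 2 + bform (schur A) z z.
Proof.
move=> At a0; rewrite /bform {1}(sym_block At) tr_col_mx mul_row_block mul_row_col.
rewrite /schur mulmxBr mulmxBl -scalemxAr -scalemxAl !mulmxA.
set b := ursubmx A; set C := drsubmx A; set a := A 0 0 in a0 *.
have bz : (z^T *m b^T) 0 0 = (b *m z) 0 0 by rewrite -trmx_mul mxE.
rewrite !mulmxDl tr_scalar_mx !mul_scalar_mx !mul_mx_scalar -!scalemxAl.
have E (u v : 'M[R]_1) : (u + v) 0 0 = u 0 0 + v 0 0 by rewrite mxE.
have F (c : R) (u : 'M[R]_1) : (c *: u) 0 0 = c * u 0 0 by rewrite mxE.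
have G (u : 'M[R]_1) : (- u) 0 0 = - u 0 0 by rewrite mxE.
rewrite -(mulmxA _ b z) !E G !F mx11_mulE bz mxE eqxx mulr1n.
by field.
Qed.

Lemma posdef_corner n (A : 'M[R]_(1 + n)) : posdef A -> 0 < A 0 0.
Proof.
move=> [_ Apos]; pose e : 'cV[R]_(1 + n) := delta_mx 0 0.
have -> : A 0 0 = bform A e e by rewrite /bform trmx_delta -rowE -colE !mxE.
apply: Apos; apply/eqP => /matrixP/(_ 0 0); rewrite !mxE !eqxx => /eqP.
by rewrite oner_eq0.
Qed.

Lemma posdef_schur n (A : 'M[R]_(1 + n)) : posdef A -> posdef (schur A).
Proof.
move=> Apd; have a0 := posdef_corner Apd; case: Apd => At Apos; split.
  rewrite /schur linearB/= linearZ/= trmx_mul trmxK; congr (_ - _).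
  by rewrite trmx_drsub At.
move=> v v0; pose x := - ((A 0 0)^-1 * (ursubmx A *m v) 0 0).
have := Apos (col_mx x%:M v); rewrite bform_schur ?gt_eqF// addNr expr0n mulr0 add0r.
by apply; rewrite col_mx_eq0 (negbTE v0) andbF.
Qed.

Lemma det_schur n (A : 'M[R]_(1 + n)) : A^T = A -> A 0 0 != 0 ->
  \det A = A 0 0 * \det (schur A).
Proof.
move=> At a0; set a := A 0 0 in a0 *; set b := ursubmx A.
rewrite [in LHS](_ : A =
  block_mx 1%:M 0 (a^-1 *: b^T) 1%:M *m block_mx a%:M b 0 (schur A)); last first.
  rewrite mulmx_block !mul1mx !mul0mx ?mulmx0 !addr0 {1}(sym_block At) -/a -/b.
  congr block_mx; first by rewrite mul_mx_scalar scalerA divff// scale1r.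
  by rewrite /schur -/a -/b -scalemxAl addrC subrK.
by rewrite det_mulmx det_lblock det_ublock !det1 !mul1r det_scalar1.
Qed.

Lemma posdef_det_gt0 n (A : 'M[R]_n) : posdef A -> 0 < \det A.
Proof.
elim: n A => [|n IH] A Apd; first by rewrite det_mx00.
have a0 := @posdef_corner n A Apd.
rewrite (@det_schur n) ?gt_eqF//; last by case: Apd.
by rewrite mulr_gt0//; apply: IH; exact: posdef_schur.
Qed.

Lemma posdef_unit n (A : 'M[R]_n) : posdef A -> A \in unitmx.
Proof. by move=> /posdef_det_gt0 d; rewrite unitmxE unitfE gt_eqF. Qed.

Lemma posdef_inv n (A : 'M[R]_n) : posdef A -> posdef (invmx A).
Proof.
move=> Apd; have Au := posdef_unit Apd; case: Apd => At Apos.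
have it : (invmx A)^T = invmx A by rewrite trmx_inv At.
split=> // v v0; rewrite /bform.
have -> : v^T *m invmx A *m v = (invmx A *m v)^T *m A *m (invmx A *m v).
  by rewrite trmx_mul it -!mulmxA (mulmxA A) mulmxV// mul1mx.
apply: Apos; apply: contra_neq v0 => H.
by rewrite -(mul1mx v) -(mulmxV Au) -mulmxA H mulmx0.
Qed.

Lemma bformDl n (A : 'M[R]_n) u u' v : bform A (u + u') v = bform A u v + bform A u' v.
Proof. by rewrite /bform linearD/= !mulmxDl mxE. Qed.

Lemma bformDr n (A : 'M[R]_n) u v v' : bform A u (v + v') = bform A u v + bform A u v'.
Proof. by rewrite /bform mulmxDr mxE. Qed.

Lemma bformZl n (A : 'M[R]_n) c u v : bform A (c *: u) v = c * bform A u v.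
Proof. by rewrite /bform linearZ/= -!scalemxAl mxE. Qed.

Lemma bformZr n (A : 'M[R]_n) c u v : bform A u (c *: v) = c * bform A u v.
Proof. by rewrite /bform -scalemxAr mxE. Qed.

Lemma bformC n (A : 'M[R]_n) u v : A^T = A -> bform A u v = bform A v u.
Proof.
move=> At; rewrite /bform [u^T *m A *m v](_ : _ = (v^T *m A *m u)^T) ?mxE//.
by rewrite !trmx_mul trmxK At mulmxA.
Qed.

End quadratic_form.

Section gaussian_integral.
Context {R : realType}.
Local Notation mu := (@lebesgue_measure R).

Definition col_of_tuple n (y : n.-tuple R) : 'cV[R]_n := \col_i tnth y i.

Lemma measurable_row_col n (v : 'rV[R]_n) :
  measurable_fun setT (fun y : n.-tuple R => (v *m col_of_tuple y) 0 0).
Proof.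
under eq_fun do rewrite mxE.
apply: measurable_sum => i; apply: measurable_funM => //.
by under eq_fun do rewrite mxE; exact: measurable_tnth.
Qed.

Lemma measurable_bform n (A : 'M[R]_n) (m : 'cV[R]_n) :
  measurable_fun setT (fun y : n.-tuple R =>
    bform A (col_of_tuple y - m) (col_of_tuple y - m)).
Proof.
under eq_fun do rewrite /bform mxE.
have mi (i : 'I_n) :
    measurable_fun setT (fun y : n.-tuple R => (col_of_tuple y - m) i 0).
  under eq_fun do rewrite !mxE; apply: measurable_funB => //.
  exact: measurable_tnth.
apply: measurable_sum => i; apply: measurable_funM => //.
under eq_fun do rewrite mxE; apply: measurable_sum => j.
apply: measurable_funM => //; under eq_fun do rewrite mxE; exact: mi.
Qed.

Lemma integral_gauss_shift (a m : R) : 0 < a ->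
  (\int[mu]_x (expR (- (a * (x + m) ^+ 2) / 2))%:E)%E = (Num.sqrt (2 * pi / a))%:E.
Proof.
move=> a0; pose s : R := (Num.sqrt a)^-1.
have s0 : s != 0 by rewrite invr_neq0// gt_eqF// sqrtr_gt0.
have sE : s ^+ 2 = a^-1 by rewrite exprVn sqr_sqrtr// ltW.
have p0 : 0 < normal_peak s by exact: normal_peak_gt0.
have := integral_normal_pdf (- m) s; rewrite normal_pdfE//.
under eq_integral do rewrite EFinM.
rewrite ge0_integralZl//; last 3 first.
- by apply/measurable_EFinP; exact: measurable_normal_fun.
- by move=> x _; rewrite lee_fin normal_fun_ge0.
- by rewrite lee_fin ltW.
rewrite [X in (_ * X)%E](_ : _ =
   (\int[mu]_x (expR (- (a * (x + m) ^+ 2) / 2))%:E)%E); last first.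
  apply: eq_integral => x _; congr (expR _)%:E; rewrite opprK sE.
  by rewrite -[_ *+ 2]mulr_natl; field; rewrite gt_eqF.
move=> H; rewrite (_ : Num.sqrt (2 * pi / a) = (normal_peak s)^-1).
  by rewrite -[RHS]mule1 -H muleA -EFinM mulVf ?gt_eqF// mul1e.
rewrite /normal_peak invrK sE; congr Num.sqrt.
by rewrite -[_ *+ 2]mulr_natl; field; rewrite gt_eqF.
Qed.

(** Fubini and induction on the dimension: the square completed in the first
    variable integrates to a constant and leaves the Schur complement. *)
Lemma integral_gauss n (A : 'M[R]_n) (m : 'cV[R]_n) : posdef A ->
  (\int[lebesgue_tuple n]_y
     (expR (- bform A (col_of_tuple y - m) (col_of_tuple y - m) / 2))%:E)%E
  = (Num.sqrt ((2 * pi) ^+ n / \det A))%:E.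
Proof.
elim: n A m => [|n IH] A m Apd.
  rewrite det_mx00 expr0 divr1 sqrtr1.
  rewrite (eq_integral (fun=> 1%E)); last first.
    by move=> y _; rewrite /bform mxE big_ord0 oppr0 mul0r expR0.
  by rewrite integral_cst// mul1e; exact: diracT.
have a0 := @posdef_corner _ n A Apd; have At := Apd.1.
have Spd := @posdef_schur _ n A Apd.
have dS := posdef_det_gt0 Spd.
pose m0 := m 0 0; pose m' : 'cV[R]_n := dsubmx (m : 'cV_(1 + n)).
pose f (y : n.+1.-tuple R) :=
  (expR (- bform A (col_of_tuple y - m) (col_of_tuple y - m) / 2))%:E : \bar R.
have mf : measurable_fun setT f.
  apply/measurable_EFinP; apply: measurableT_comp => //.
  apply: measurable_funM => //; apply: measurableT_comp => //.
  exact: measurable_bform.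
have f0 y : (0 <= f y)%E by rewrite lee_fin expR_ge0.
have -> : (\int[lebesgue_tuple n.+1]_y f y =
    \int[(lebesgue_measure \x lebesgue_tuple n)%E]_x (f (cons_pair x)))%E.
  by rewrite /= (ge0_integral_pushforward (@measurable_cons_pair R n)).
have mfc : measurable_fun setT (fun x : measurableTypeR R * n.-tuple R => f (cons_pair x)).
  by apply: measurableT_comp => //; exact: measurable_cons_pair.
rewrite fubini_tonelli2//= /fubini_G.
have colE (x : R) (y : n.-tuple R) : col_of_tuple (cons_pair (x, y)) - m =
    col_mx (x - m0)%:M (col_of_tuple y - m') :> 'cV_(1 + n).
  apply/matrixP => i j; rewrite !mxE; case: splitP => k ik; rewrite !mxE.
    have -> : i = 0 by apply: val_inj; rewrite /= ik (ord1 k).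
    by rewrite (ord1 k) (ord1 j) tnth0.
  have -> : i = lift ord0 k by apply: val_inj; rewrite /= ik.
  rewrite tnthS (ord1 j); congr (_ - m _ _); exact: val_inj.
rewrite (eq_integral (fun y => (Num.sqrt (2 * pi / A 0 0))%:E *
  (expR (- bform (schur A) (col_of_tuple y - m') (col_of_tuple y - m') / 2))%:E)%E);
  last first.
  move=> y _; pose b := (ursubmx (A : 'M[R]_(1 + n)) *m (col_of_tuple y - m')) 0 0.
  rewrite -(@integral_gauss_shift _ (- m0 + (A 0 0)^-1 * b) a0).
  rewrite muleC -ge0_integralZl//.
  - apply: eq_integral => x _; rewrite /f colE bform_schur ?gt_eqF//.
    rewrite -EFinM -expRD addrA; congr (expR _)%:E.
    by rewrite -/b; set q := bform (schur A) _ _; set c := (A 0 0)^-1 * b; ring.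
  - apply/measurable_EFinP; apply: measurableT_comp => //.
    apply: measurable_funM => //; apply: measurableT_comp => //.
    apply: measurable_funM => //; apply: measurable_funX.
    exact: measurable_funD.
rewrite ge0_integralZl//; last first.
  apply/measurable_EFinP; apply: measurableT_comp => //.
  apply: measurable_funM => //; apply: measurableT_comp => //.
  exact: measurable_bform.
rewrite IH// -EFinM -sqrtrM ?divr_ge0 ?mulr_ge0 ?pi_ge0 ?ltW//.
rewrite (@det_schur _ n) ?gt_eqF// exprS; congr (Num.sqrt _)%:E.
by field; rewrite !gt_eqF.
Qed.

End gaussian_integral.

(** * Expectations under a multivariate normal law *)

Section multinormal_expectation.
Context {R : realType} {n : nat}.
Implicit Types (mu u v : 'cV[R]_n) (S : 'M[R]_n) (g h : n.-tuple R -> R).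

Definition dotp v (y : n.-tuple R) : R := (v^T *m col_of_tuple y) 0 0.

Definition dot v u : R := (v^T *m u) 0 0.

(** Expectation under N(mu, S), written as an integral against the density, which
    is how [multinormal] measures sets. *)
Definition gexp mu S g : \bar R :=
  (\int[lebesgue_tuple n]_y (g y * multinormal_pdf mu S y)%:E)%E.

Lemma measurable_dotp v : measurable_fun setT (dotp v).
Proof. exact: measurable_row_col. Qed.

Lemma multinormal_pdfE mu S y : multinormal_pdf mu S y =
  (Num.sqrt ((2 * pi) ^+ n * \det S))^-1 *
  expR (- bform (invmx S) (col_of_tuple y - mu) (col_of_tuple y - mu) / 2).
Proof. by []. Qed.

Lemma multinormal_pdf_ge0 mu S y : 0 <= multinormal_pdf mu S y.
Proof. by rewrite mulr_ge0 ?expR_ge0// invr_ge0. Qed.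

Lemma measurable_multinormal_pdf mu S :
  measurable_fun setT (multinormal_pdf mu S : n.-tuple R -> R).
Proof.
apply: measurable_funM => //; apply: measurableT_comp => //.
apply: measurable_funM => //; apply: measurableT_comp => //.
exact: measurable_bform.
Qed.

Lemma measurable_gexp mu S g : measurable_fun setT g ->
  measurable_fun setT (fun y => (g y * multinormal_pdf mu S y)%:E).
Proof.
move=> mg; apply/measurable_EFinP; apply: measurable_funM => //.
exact: measurable_multinormal_pdf.
Qed.

Lemma gexp_le mu S g h : measurable_fun setT g -> measurable_fun setT h ->
  (forall y, 0 <= g y) -> (forall y, g y <= h y) -> (gexp mu S g <= gexp mu S h)%E.
Proof.
move=> mg mh g0 gh; apply: ge0_le_integral => //.
- by move=> y _; rewrite lee_fin mulr_ge0 ?multinormal_pdf_ge0.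
- exact: measurable_gexp.
- exact: measurable_gexp.
- by move=> y _; rewrite lee_fin ler_wpM2r ?multinormal_pdf_ge0.
Qed.

Lemma gexpD mu S g h : measurable_fun setT g -> measurable_fun setT h ->
  (forall y, 0 <= g y) -> (forall y, 0 <= h y) ->
  gexp mu S (fun y => g y + h y) = (gexp mu S g + gexp mu S h)%E.
Proof.
move=> mg mh g0 h0; rewrite /gexp -ge0_integralD//.
- by apply: eq_integral => y _; rewrite mulrDl EFinD.
- by move=> y _; rewrite lee_fin mulr_ge0 ?multinormal_pdf_ge0.
- exact: measurable_gexp.
- by move=> y _; rewrite lee_fin mulr_ge0 ?multinormal_pdf_ge0.
- exact: measurable_gexp.
Qed.

Lemma gexpZ mu S c g : 0 <= c -> measurable_fun setT g -> (forall y, 0 <= g y) ->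
  gexp mu S (fun y => c * g y) = (c%:E * gexp mu S g)%E.
Proof.
move=> c0 mg g0; rewrite /gexp -ge0_integralZl//.
- by apply: eq_integral => y _; rewrite -mulrA EFinM.
- exact: measurable_gexp.
- by move=> y _; rewrite lee_fin mulr_ge0 ?multinormal_pdf_ge0.
Qed.

Lemma gexp_sum mu S (I : Type) (s : seq I) (g : I -> n.-tuple R -> R) :
  (forall i, measurable_fun setT (g i)) -> (forall i y, 0 <= g i y) ->
  gexp mu S (fun y => \sum_(i <- s) g i y) = (\sum_(i <- s) gexp mu S (g i))%E.
Proof.
move=> mg g0; rewrite /gexp -ge0_integral_sum//.
- by apply: eq_integral => y _; rewrite mulr_suml -sumEFin.
- by move=> i; exact: measurable_gexp.
- by move=> i y _; rewrite lee_fin mulr_ge0 ?multinormal_pdf_ge0.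
Qed.

Lemma multinormalE mu S (A : set (n.-tuple R)) : measurable A ->
  multinormal mu S A = gexp mu S (\1_A).
Proof.
move=> mA; rewrite /multinormal integral_mkcond; apply: eq_integral => y _.
rewrite patchE indicE; by case: ifPn => _; rewrite ?mul1r ?mul0r.
Qed.

Lemma gexp1 mu S : posdef S -> gexp mu S (fun=> 1) = 1%E.
Proof.
move=> Spd; have dS := posdef_det_gt0 Spd.
have c0 : 0 < Num.sqrt ((2 * pi) ^+ n * \det S) :> R.
  by rewrite sqrtr_gt0 mulr_gt0// exprn_gt0// mulr_gt0// pi_gt0.
rewrite /gexp (eq_integral (fun y => (Num.sqrt ((2 * pi) ^+ n * \det S))^-1%:E *
  (expR (- bform (invmx S) (col_of_tuple y - mu) (col_of_tuple y - mu) / 2))%:E)%E);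
  last by move=> y _; rewrite mul1r multinormal_pdfE EFinM.
rewrite ge0_integralZl; [|exact: measurableT| | |].
- rewrite integral_gauss; last exact: posdef_inv.
  by rewrite det_inv invrK -EFinM mulVf// gt_eqF.
- apply/measurable_EFinP; apply: measurableT_comp => //.
  apply: measurable_funM => //; apply: measurableT_comp => //.
  exact: measurable_bform.
- by move=> y _; rewrite lee_fin expR_ge0.
- by rewrite lee_fin invr_ge0 ltW.
Qed.

(** Exponential tilting of a normal density is a translation. *)
Lemma multinormal_pdf_tilt mu S v y : posdef S ->
  expR (dotp v y) * multinormal_pdf mu S y =
  expR (dot v mu + bform S v v / 2) * multinormal_pdf (mu + S *m v) S y.
Proof.
move=> Spd; have Su := posdef_unit Spd; have It := (posdef_inv Spd).1.
have St := Spd.1.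
rewrite !multinormal_pdfE mulrCA [RHS]mulrCA -!expRD; congr (_ * expR _).
rewrite opprD addrA.
have -> : dotp v y = dot v (col_of_tuple y - mu) + dot v mu.
  by rewrite /dotp -{1}(subrK mu (col_of_tuple y)) mulmxDr mxE.
move: (col_of_tuple y - mu) => z.
rewrite -(scaleN1r (S *m v)) !(bformDl, bformDr, bformZl, bformZr).
have e1 : bform (invmx S) z (S *m v) = dot v z.
  rewrite (bformC _ _ It) /bform trmx_mul St -!mulmxA (mulmxA S) mulmxV//.
  by rewrite mul1mx.
have e2 : bform (invmx S) (S *m v) z = dot v z by rewrite (bformC _ _ It) e1.
have e3 : bform (invmx S) (S *m v) (S *m v) = bform S v v.
  by rewrite /bform trmx_mul St -!mulmxA (mulmxA (invmx S)) mulVmx// mul1mx.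
by rewrite e1 e2 e3; field.
Qed.

Lemma gexp_expR mu S v : posdef S ->
  gexp mu S (fun y => expR (dotp v y)) = (expR (dot v mu + bform S v v / 2))%:E.
Proof.
move=> Spd; rewrite /gexp.
under eq_integral do rewrite multinormal_pdf_tilt// EFinM.
rewrite ge0_integralZl; [|exact: measurableT| | |].
- rewrite -[RHS]mule1 -(gexp1 (mu + S *m v) Spd); congr (_ * _)%E.
  by apply: eq_integral => y _; rewrite mul1r.
- by apply/measurable_EFinP; exact: measurable_multinormal_pdf.
- by move=> y _; rewrite lee_fin multinormal_pdf_ge0.
- by rewrite lee_fin expR_ge0.
Qed.

Lemma measurable_expR_dotp v : measurable_fun setT (fun y => expR (dotp v y)).
Proof. by apply: measurableT_comp => //; exact: measurable_dotp. Qed.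

(** The tilting identity read backwards, with [v] chosen so that [S *m v = mu]. *)
Lemma multinormal_pdf_ratio mu S y : posdef S ->
  multinormal_pdf mu S y =
  expR (dotp (invmx S *m mu) y - bform (invmx S) mu mu / 2) * multinormal_pdf 0 S y.
Proof.
move=> Spd; have Su := posdef_unit Spd; have It := (posdef_inv Spd).1.
rewrite expRD mulrAC multinormal_pdf_tilt// add0r mulKVmx// mulrAC -expRD.
rewrite /dot mulmx0 mxE add0r [bform S _ _](_ : _ = bform (invmx S) mu mu).
  by rewrite subrr expR0 mul1r.
by rewrite /bform trmx_mul It -!mulmxA (mulmxA S) mulmxV// mul1mx.
Qed.

Lemma dotZl (c : R) v u : dot (c *: v) u = c * dot v u.
Proof. by rewrite /dot linearZ/= -scalemxAl mxE. Qed.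

Lemma dotpZ (c : R) v y : dotp (c *: v) y = c * dotp v y.
Proof. exact: dotZl. Qed.

Lemma dotpN v y : dotp (- v) y = - dotp v y.
Proof. by rewrite -scaleN1r dotpZ mulN1r. Qed.

Lemma dotpD u v y : dotp (u + v) y = dotp u y + dotp v y.
Proof. by rewrite /dotp linearD/= mulmxDl mxE. Qed.

Lemma gexp_chernoff mu S v (s t V : R) : posdef S -> 0 <= s ->
  bform S v v <= V ->
  (gexp mu S (fun y => expR (s * (dotp v y - t))) <=
   (expR (s * (dot v mu - t) + s ^+ 2 * V / 2))%:E)%E.
Proof.
move=> Spd s0 vV.
have -> : (fun y => expR (s * (dotp v y - t))) =
    (fun y => expR (- (s * t)) * expR (dotp (s *: v) y)).
  by apply: funext => y; rewrite -expRD dotpZ; congr expR; ring.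
rewrite gexpZ ?expR_ge0//; last exact: measurable_expR_dotp.
rewrite gexp_expR// -EFinM -expRD lee_fin ler_expR dotZl bformZl bformZr.
have : s ^+ 2 * bform S v v <= s ^+ 2 * V by rewrite ler_wpM2l// sqr_ge0.
by rewrite expr2; lra.
Qed.

(** Markov's inequality for the exponential of a linear statistic, at the optimal
    exponent. *)
Lemma multinormal_lower_tail mu S v (t V : R) : posdef S -> 0 < V ->
  bform S v v <= V -> t <= dot v mu ->
  forall A : set (n.-tuple R), measurable A -> A `<=` [set y | dotp v y <= t] ->
  (multinormal mu S A <= (expR (- (dot v mu - t) ^+ 2 / (2 * V)))%:E)%E.
Proof.
move=> Spd V0 vV tm A mA At; rewrite multinormalE//.
pose s := (dot v mu - t) / V.
have s0 : 0 <= s by rewrite divr_ge0 ?subr_ge0// ltW.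
have vV' : bform S (- v) (- v) <= V.
  by rewrite -scaleN1r bformZl bformZr !mulN1r opprK.
have := gexp_chernoff mu (- t) Spd s0 vV'.
rewrite -[X in dot X mu]scaleN1r dotZl mulN1r => H.
have -> : - (dot v mu - t) ^+ 2 / (2 * V) = s * (- dot v mu - - t) + s ^+ 2 * V / 2.
  by rewrite /s; field; rewrite gt_eqF.
apply: le_trans H; apply: gexp_le => //.
- apply: measurableT_comp => //; apply: measurable_funM => //.
  by apply: measurable_funD => //; exact: measurable_dotp.
- move=> y; rewrite indicE; case: (boolP (y \in A)) => [|_]; last exact: expR_ge0.
  rewrite inE => /At /= yt; rewrite -expR0 ler_expR dotpN opprK.
  by rewrite mulr_ge0// addrC subr_ge0.
Qed.

(** Union bound over the K statistics and the two signs. *)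
Lemma multinormal_scan_tail S K (v : 'I_K -> 'cV[R]_n) (t V : R) : posdef S ->
  0 < V -> 0 <= t -> (forall k, bform S (v k) (v k) <= V) ->
  forall A : set (n.-tuple R), measurable A ->
  A `<=` [set y | exists k, t <= `|dotp (v k) y|] ->
  (multinormal 0 S A <= ((2 * K)%:R * expR (- t ^+ 2 / (2 * V)))%:E)%E.
Proof.
move=> Spd V0 t0 vV A mA At; rewrite multinormalE//.
pose s := t / V; have s0 : 0 <= s by rewrite divr_ge0// ltW.
pose g u (y : n.-tuple R) := expR (s * (dotp u y - t)).
have mg u : measurable_fun setT (g u).
  apply: measurableT_comp => //; apply: measurable_funM => //.
  by apply: measurable_funD => //; exact: measurable_dotp.
have g0 u y : 0 <= g u y by exact: expR_ge0.
have gb u : bform S u u <= V -> (gexp 0 S (g u) <= (expR (- t ^+ 2 / (2 * V)))%:E)%E.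
  move=> uV; apply: (le_trans (gexp_chernoff 0 t Spd s0 uV)).
  rewrite lee_fin ler_expR /dot mulmx0 mxE le_eqVlt; apply/orP; left; apply/eqP.
  by rewrite /s; field; rewrite gt_eqF.
apply: (@le_trans _ _ (gexp 0 S (fun y => \sum_(k < K) (g (v k) y + g (- v k) y)))).
  apply: gexp_le => //.
  - by apply: measurable_sum => k; exact: measurable_funD.
  - move=> y; rewrite indicE; case: (boolP (y \in A)) => [|_]; last first.
      by apply: sumr_ge0 => k _; rewrite addr_ge0.
    rewrite inE => /At /= [k kt]; rewrite (bigD1 k)//= ler_wpDr//.
      by apply: sumr_ge0 => j _; rewrite addr_ge0.
    move: kt; rewrite ler_normr => /orP[kt|kt].
      rewrite ler_wpDr// -expR0 ler_expR mulr_ge0// subr_ge0//.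
    by rewrite ler_wpDl// -expR0 ler_expR mulr_ge0// subr_ge0 dotpN.
rewrite gexp_sum => [|k|k y]; [|exact: measurable_funD|by rewrite addr_ge0].
apply: (@le_trans _ _ (\sum_(k < K) (2 * expR (- t ^+ 2 / (2 * V)))%:E)%E).
  apply: lee_sum => k _; rewrite gexpD// mulr_natl EFinD; apply: leeD.
    exact: gb.
  by apply: gb; rewrite -scaleN1r bformZl bformZr !mulN1r opprK.
by rewrite sumEFin lee_fin sumr_const card_ord -[leLHS]mulr_natl natrM mulrCA mulrA.
Qed.

End multinormal_expectation.

(** * Moments of the standard normal law *)

Section normal_moments.
Context {R : realType}.
Local Notation mu := (@lebesgue_measure R).
Local Notation nu := (normal_prob (0 : R) 1).

Lemma measurable_normal_pdfE (m s : R) :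
  measurable_fun setT (fun x => (normal_pdf m s x)%:E).
Proof. by apply/measurable_EFinP; exact: measurable_normal_pdf. Qed.

(** The Radon-Nikodym derivative of the law has the same integrals as the density,
    hence agrees with it almost everywhere. *)
Lemma ge0_integral_normal_prob (m s : R) (f : R -> \bar R) :
  measurable_fun setT f -> (forall x, (0 <= f x)%E) ->
  (\int[normal_prob m s]_x f x = \int[mu]_x (f x * (normal_pdf m s x)%:E))%E.
Proof.
move=> mf f0.
have dom := @normal_prob_dominates R m s.
rewrite -(Radon_Nikodym_SigmaFinite.change_of_variables dom)//.
have ig := Radon_Nikodym_SigmaFinite.f_integrable dom.
apply: ae_eq_integral => //.
- by apply: emeasurable_funM => //; exact: measurable_int ig.
- by apply: emeasurable_funM => //; exact: measurable_normal_pdfE.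
have : ae_eq mu setT (Radon_Nikodym_SigmaFinite.f (normal_prob m s) mu)
    (fun x => (normal_pdf m s x)%:E).
  apply: integral_ae_eq => //; first exact: measurable_normal_pdfE.
  by move=> E _ mE; rewrite -Radon_Nikodym_SigmaFinite.f_integral.
by apply: filterS => x /= H _; rewrite H.
Qed.

Lemma normal_pdf01E (s x : R) : 0 < s ->
  s * normal_pdf 0 s x = normal_peak 1 * expR (- x ^+ 2 / (2 * s ^+ 2)).
Proof.
move=> s0; rewrite normal_pdfE ?gt_eqF// /normal_fun subr0 mulrA.
congr (_ * expR _); last by rewrite -[_ *+ 2]mulr_natl.
rewrite /normal_peak expr1n mul1r -mulrnAr sqrtrM ?sqr_ge0// sqrtr_sqr.
by rewrite (ger0_norm (ltW s0)) invfM mulrA divff ?gt_eqF// mul1r.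
Qed.

Lemma normal_second_moment_le (e : R) : 0 < e -> e <= 1 ->
  (\int[nu]_x (x ^+ 2)%:E <= (1 + 2 * e)%:E)%E.
Proof.
move=> e0 e1; pose u : R := 1 + e.
pose k : R := (u ^+ 2 - 1) / (2 * u ^+ 2).
have u0 : 0 < u by rewrite addr_gt0.
have k0 : 0 < k by rewrite divr_gt0 ?mulr_gt0 ?exprn_gt0// /u; nra.
have mx : measurable_fun setT (fun x : R => (x ^+ 2)%:E).
  by apply/measurable_EFinP; exact: measurable_funX.
have x0 (x : R) : (0 <= (x ^+ 2)%:E :> \bar R)%E by rewrite lee_fin sqr_ge0.
have : (1 + k%:E * \int[nu]_x (x ^+ 2)%:E <= u%:E)%E.
  have -> : u%:E = (\int[mu]_x (u * normal_pdf 0 u x)%:E)%E.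
    under eq_integral do rewrite EFinM.
    rewrite ge0_integralZl; [|exact: measurableT|exact: measurable_normal_pdfE| |].
    - by rewrite integral_normal_pdf mule1.
    - by move=> x _; rewrite lee_fin normal_pdf_ge0.
    - by rewrite lee_fin ltW.
  rewrite ge0_integral_normal_prob// -(integral_normal_pdf 0 1).
  have mxp : measurable_fun setT (fun x : R => ((x ^+ 2)%:E * (normal_pdf 0 1 x)%:E)%E).
    by apply: emeasurable_funM => //; exact: measurable_normal_pdfE.
  have xp0 (x : R) : (0 <= (x ^+ 2)%:E * (normal_pdf 0 1 x)%:E :> \bar R)%E.
    by rewrite mule_ge0// lee_fin normal_pdf_ge0.
  rewrite -ge0_integralZl//; last by rewrite lee_fin ltW.
  rewrite -ge0_integralD//.
  - apply: ge0_le_integral => //.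
    + move=> x _; apply: adde_ge0; first by rewrite lee_fin normal_pdf_ge0.
      by apply: mule_ge0 => //; rewrite lee_fin ltW.
    + apply: emeasurable_funD; first exact: measurable_normal_pdfE.
      by apply: measurable_funeM.
    + apply/measurable_EFinP; apply: measurable_funM => //.
      exact: measurable_normal_pdf.
    + move=> x _; rewrite -!EFinM -EFinD lee_fin.
      rewrite -[normal_pdf 0 1 x]mul1r !normal_pdf01E//.
      rewrite expr1n mulr1 [leLHS](_ : _ = normal_peak 1 *
        ((1 + k * x ^+ 2) * expR (- x ^+ 2 / 2))); last by ring.
      rewrite ler_wpM2l ?normal_peak_ge0//.
      rewrite (_ : - x ^+ 2 / (2 * u ^+ 2) = - x ^+ 2 / 2 + k * x ^+ 2); last first.
        by rewrite /k; field; rewrite gt_eqF.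
      by rewrite expRD mulrC ler_wpM2l ?expR_ge0// expR_ge1Dx.
  - by move=> x _; rewrite lee_fin normal_pdf_ge0.
  - exact: measurable_normal_pdfE.
  - by move=> x _; rewrite mule_ge0// lee_fin ltW.
  - by apply: measurable_funeM.
have : (0 <= \int[nu]_x (x ^+ 2)%:E)%E by exact: integral_ge0.
case: (\int[nu]_x (x ^+ 2)%:E)%E => [r|_|//].
  rewrite -EFinM -EFinD !lee_fin => r0 H.
  have kr : k * r <= e by move: H; rewrite /u; lra.
  move: kr; rewrite /k mulrAC ler_pdivrMr ?mulr_gt0 ?exprn_gt0// /u; nra.
by rewrite gt0_muley ?lte_fin.
Qed.

Lemma normal_second_moment_ge (e : R) : 0 < e -> e < 1 ->
  ((1 - 2 * e)%:E <= \int[nu]_x (x ^+ 2)%:E)%E.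
Proof.
move=> e0 e1; pose u : R := 1 - e.
pose k : R := (1 - u ^+ 2) / (2 * u ^+ 2).
have u0 : 0 < u by rewrite subr_gt0.
have k0 : 0 < k by rewrite divr_gt0 ?mulr_gt0 ?exprn_gt0// /u; nra.
have mx : measurable_fun setT (fun x : R => (x ^+ 2)%:E).
  by apply/measurable_EFinP; exact: measurable_funX.
have x0 (x : R) : (0 <= (x ^+ 2)%:E :> \bar R)%E by rewrite lee_fin sqr_ge0.
have : (1 <= u%:E + k%:E * \int[nu]_x (x ^+ 2)%:E)%E.
  have -> : u%:E = (\int[mu]_x (u * normal_pdf 0 u x)%:E)%E.
    under eq_integral do rewrite EFinM.
    rewrite ge0_integralZl; [|exact: measurableT|exact: measurable_normal_pdfE| |].
    - by rewrite integral_normal_pdf mule1.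
    - by move=> x _; rewrite lee_fin normal_pdf_ge0.
    - by rewrite lee_fin ltW.
  rewrite ge0_integral_normal_prob// -(integral_normal_pdf 0 1).
  have mxp : measurable_fun setT (fun x : R => ((x ^+ 2)%:E * (normal_pdf 0 1 x)%:E)%E).
    by apply: emeasurable_funM => //; exact: measurable_normal_pdfE.
  have xp0 (x : R) : (0 <= (x ^+ 2)%:E * (normal_pdf 0 1 x)%:E :> \bar R)%E.
    by rewrite mule_ge0// lee_fin normal_pdf_ge0.
  have mu_ : measurable_fun setT (fun x : R => (u * normal_pdf 0 u x)%:E).
    apply/measurable_EFinP; apply: measurable_funM => //.
    exact: measurable_normal_pdf.
  rewrite -ge0_integralZl//; last by rewrite lee_fin ltW.
  rewrite -ge0_integralD//.
  - apply: ge0_le_integral => //.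
    + by move=> x _; rewrite lee_fin normal_pdf_ge0.
    + exact: measurable_normal_pdfE.
    + by apply: emeasurable_funD => //; apply: measurable_funeM.
    + move=> x _; rewrite -!EFinM -EFinD lee_fin.
      rewrite -[normal_pdf 0 1 x]mul1r !normal_pdf01E//.
      rewrite expr1n mulr1.
      rewrite [leRHS](_ : _ = normal_peak 1 * (expR (- x ^+ 2 / (2 * u ^+ 2)) +
        k * x ^+ 2 * expR (- x ^+ 2 / 2))); last by ring.
      rewrite ler_wpM2l ?normal_peak_ge0//.
      rewrite (_ : - x ^+ 2 / (2 * u ^+ 2) = - x ^+ 2 / 2 + - (k * x ^+ 2)); last first.
        by rewrite /k; field; rewrite gt_eqF.
      rewrite expRD; set E := expR (- x ^+ 2 / 2).
      have H := expR_ge1Dx (- (k * x ^+ 2)).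
      have : E * (1 - k * x ^+ 2) <= E * expR (- (k * x ^+ 2)).
        by rewrite ler_wpM2l ?expR_ge0.
      lra.
  - by move=> x _; rewrite lee_fin mulr_ge0 ?normal_pdf_ge0// ltW.
  - by move=> x _; rewrite mule_ge0// lee_fin ltW.
  - by apply: measurable_funeM.
have : (0 <= \int[nu]_x (x ^+ 2)%:E)%E by exact: integral_ge0.
case: (\int[nu]_x (x ^+ 2)%:E)%E => [r|_ _|//]; last by rewrite leey.
rewrite -EFinM -EFinD !lee_fin => r0 H.
have kr : e <= k * r by move: H; rewrite /u; lra.
move: kr; rewrite /k mulrAC ler_pdivlMr ?mulr_gt0 ?exprn_gt0// /u; nra.
Qed.

(** Comparing the densities of N(0, u^2) and N(0, 1) through exp y >= 1 + y, for
    u on either side of 1, squeezes the second moment. *)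
Lemma normal_second_moment : (\int[nu]_x (x ^+ 2)%:E = 1)%E.
Proof.
apply/eqP; rewrite eq_le; apply/andP; split.
  apply/lee_addgt0Pr => e e0; pose e' := Num.min 1 (e / 2).
  have e'0 : 0 < e' by rewrite lt_min ltr01 divr_gt0.
  have e'1 : e' <= 1 by rewrite ge_min lexx.
  apply: (le_trans (normal_second_moment_le e'0 e'1)).
  rewrite -EFinD lee_fin lerD2l mulrC -ler_pdivlMr//.
  by rewrite ge_min lexx orbT.
apply/lee_addgt0Pr => e e0; pose e' := Num.min 2^-1 (e / 2).
have e'0 : 0 < e' by rewrite lt_min invr_gt0 ltr0n divr_gt0.
have e'1 : e' < 1 by rewrite gt_min invf_lt1// ltr1n.
apply: (@le_trans _ _ ((1 - 2 * e')%:E + e%:E)%E); last first.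
  by rewrite leeD2r// normal_second_moment_ge.
rewrite -EFinD lee_fin -addrA lerDl addrC subr_ge0 mulrC -ler_pdivlMr//.
by rewrite ge_min lexx orbT.
Qed.

Lemma integrable_normal_sqr : nu.-integrable setT (fun x => (x ^+ 2)%:E).
Proof.
apply/integrableP; split; first by apply/measurable_EFinP; exact: measurable_funX.
under eq_integral do rewrite gee0_abs ?lee_fin ?sqr_ge0//.
by rewrite normal_second_moment ltry.
Qed.

Lemma integrable_normal_id : nu.-integrable setT (fun x : R => x%:E).
Proof.
have i1 : nu.-integrable setT (cst 1%:E : R -> \bar R).
  exact: finite_measure_integrable_cst.
apply: (le_integrable measurableT _ _ (integrableD measurableT i1 integrable_normal_sqr)).
  by apply/measurable_EFinP.
move=> x _; rewrite -EFinD !abse_EFin lee_fin [leRHS]ger0_norm ?addr_ge0 ?sqr_ge0//.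
have := sqr_ge0 (`|x| - 1); rewrite sqrrB1 real_normK ?num_real//.
have := normr_ge0 x; lra.
Qed.

Lemma normal_mgf (s : R) : (\int[nu]_x (expR (s * x))%:E = (expR (s ^+ 2 / 2))%:E)%E.
Proof.
rewrite ge0_integral_normal_prob; last 2 first.
- by apply/measurable_EFinP; apply: measurableT_comp.
- by move=> x; rewrite lee_fin expR_ge0.
rewrite -[RHS]mule1 -(integral_normal_pdf s 1) -ge0_integralZl; first last.
- by rewrite lee_fin expR_ge0.
- by move=> x _; rewrite lee_fin normal_pdf_ge0.
- exact: measurable_normal_pdfE.
- exact: measurableT.
apply: eq_integral => x _; rewrite -!EFinM; congr (_%:E).
rewrite !normal_pdfE ?oner_neq0// /normal_fun mulrCA [RHS]mulrCA -!expRD.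
by congr (_ * expR _); rewrite expr1n -[_ *+ 2]mulr_natl subr0; field.
Qed.

(** From 1 + s x <= exp (s x): the mean m satisfies 1 + s m <= exp (s^2 / 2) for
    all s, which forces m = 0. *)
Lemma normal_mean : (\int[nu]_x x%:E = 0)%E.
Proof.
have iid := integrable_normal_id.
have fin := integrable_fin_num measurableT iid.
set m := (\int[nu]_x x%:E)%E in fin *; rewrite -(fineK fin); congr (_%:E).
have key (s : R) : 1 + s * fine m <= expR (s ^+ 2 / 2).
  have i1 : nu.-integrable setT (cst 1%:E : R -> \bar R).
    exact: finite_measure_integrable_cst.
  have i2 : nu.-integrable setT (fun x => (s%:E * x%:E)%E) by exact: integrableZl.
  rewrite -lee_fin -normal_mgf EFinD EFinM fineK//.
  rewrite /m -integralZl// (_ : 1%:E = \int[nu]_x (cst 1%:E x))%E; last first.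
    by rewrite integral_cst// mul1e; apply/esym/integral_normal_pdf.
  rewrite -integralD//; apply: le_integral => //.
  - exact: integrableD.
  - apply/integrableP; split.
      by apply/measurable_EFinP; apply: measurableT_comp.
    under eq_integral do rewrite gee0_abs ?lee_fin ?expR_ge0//.
    by rewrite normal_mgf ltry.
  - by move=> x _; rewrite /= -EFinM -EFinD lee_fin expR_ge1Dx.
set a := fine m in key *; apply/eqP/negPn/negP => a0.
have a2 : 0 < a ^+ 2 by rewrite exprn_even_gt0.
pose s := a / (1 + a ^+ 2); have d0 : 0 < 1 + a ^+ 2 by rewrite addr_gt0.
have sE : s * (1 + a ^+ 2) = a by rewrite /s divfK// gt_eqF.
have sa : s * a * (1 + a ^+ 2) = a ^+ 2 by rewrite mulrAC sE -expr2.
have ss : s ^+ 2 * (1 + a ^+ 2) = s * a by rewrite expr2 -mulrA sE.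
have s1 : s ^+ 2 <= 4^-1.
  have : 0 <= (a ^+ 2 - 1) ^+ 2 by exact: sqr_ge0.
  rewrite /s expr_div_n ler_pdivrMr ?exprn_gt0//; nra.
have := key s; have := expR_ge1Dx (- (s ^+ 2 / 2)).
have := expR_gt0 (s ^+ 2 / 2); have := expRN (s ^+ 2 / 2) => ->.
set E := expR _ => E0 H1 H2.
have H3 : (1 - s ^+ 2 / 2) * E <= 1 by rewrite -ler_pdivlMr// mul1r.
have sa0 : 0 < s * a by rewrite -(pmulr_lgt0 _ d0) sa.
have : (1 - s ^+ 2 / 2) * (1 + s * a) <= 1.
  by apply: le_trans H3; rewrite ler_wpM2l//; lra.
nra.
Qed.

End normal_moments.

(** * Second-order structure of the ARMA equation *)

Section second_order.
Context {d} {T : measurableType d} {R : realType} (P : probability T R).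
Implicit Types X Y : T -> R.

Definition L2 X := measurable_fun setT X /\ P.-integrable setT (fun w => (X w ^+ 2)%:E).

Lemma L2_Lfun X : L2 X -> X \in Lfun P 2%:E.
Proof.
move=> [mX iX]; rewrite inE; apply/andP; split; rewrite inE//=.
rewrite /finite_norm unlock; apply: poweR_lty.
have /integrableP[_] := iX; apply: le_lt_trans; apply: ge0_le_integral => //.
- by move=> w _; rewrite lee_fin powR_ge0.
- apply/measurable_EFinP.
  by apply: (@measurableT_comp _ _ _ _ _ _ (fun x : R => x `^ 2)%R) => //;
    exact: measurableT_comp.
- by apply: measurableT_comp => //; apply/measurable_EFinP; exact: measurable_funX.
- by move=> w _ /=; rewrite lee_fin normrX powR_mulrn.
Qed.

Lemma L2D X Y : L2 X -> L2 Y -> L2 (fun w => X w + Y w).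
Proof.
move=> [mX iX] [mY iY]; split; first exact: measurable_funD.
have i2 := integrableZl measurableT (2 : R) (integrableD measurableT iX iY).
apply: (le_integrable measurableT _ _ i2).
  by apply/measurable_EFinP; apply: measurable_funX; exact: measurable_funD.
move=> w _; rewrite /= lee_fin (ger0_norm (sqr_ge0 _)) ger0_norm; last first.
  by apply: mulr_ge0 => //; apply: addr_ge0; exact: sqr_ge0.
have := sqr_ge0 (X w - Y w); rewrite sqrrB sqrrD; lra.
Qed.

Lemma L2Z (c : R) X : L2 X -> L2 (fun w => c * X w).
Proof.
move=> [mX iX]; split; first exact: measurable_funM.
have i2 := integrableZl measurableT (c ^+ 2) iX.
apply: (le_integrable measurableT _ _ i2).
  by apply/measurable_EFinP; apply: measurable_funX; exact: measurable_funM.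
by move=> w _; rewrite /= exprMn.
Qed.

Lemma L2_cst (c : R) : L2 (fun=> c).
Proof. by split=> //; exact: finite_measure_integrable_cst. Qed.

Lemma L2_sum n (c : 'I_n -> R) (X : 'I_n -> T -> R) : (forall i, L2 (X i)) ->
  L2 (fun w => \sum_(i < n) c i * X i w).
Proof.
elim: n c X => [|n IH] c X LX.
  by under eq_fun do rewrite big_ord0; exact: L2_cst.
under eq_fun do rewrite big_ord_recl; apply: L2D; first exact: L2Z.
by apply: (IH (fun i => c (lift ord0 i)) (fun i => X (lift ord0 i))).
Qed.

Definition cov X Y : R := fine (covariance P X Y).

Definition mean X : R := fine 'E_P[X].

Lemma L2_Lfun1 X : L2 X -> X \in Lfun P 1.
Proof. by move=> /L2_Lfun; apply: Lfun_subset12; exact: fin_num_measure. Qed.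

Lemma L2_mul X Y : L2 X -> L2 Y -> (X * Y)%R \in Lfun P 1.
Proof. by move=> /L2_Lfun X2 /L2_Lfun Y2; exact: Lfun2_mul_Lfun1. Qed.

Lemma L2_cov_fin X Y : L2 X -> L2 Y -> covariance P X Y \is a fin_num.
Proof.
move=> LX LY.
by apply: covariance_fin_num; [exact: L2_Lfun1|exact: L2_Lfun1|exact: L2_mul].
Qed.

Lemma covC X Y : cov X Y = cov Y X.
Proof. by rewrite /cov covarianceC. Qed.

Lemma covDl X Y Z : L2 X -> L2 Y -> L2 Z ->
  cov (fun w => X w + Y w) Z = cov X Z + cov Y Z.
Proof.
move=> LX LY LZ; rewrite /cov covarianceDl ?L2_Lfun// fineD//;
  exact: L2_cov_fin.
Qed.

Lemma covZl (c : R) X Y : L2 X -> L2 Y -> cov (fun w => c * X w) Y = c * cov X Y.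
Proof.
move=> LX LY; rewrite /cov (_ : (fun w => c * X w) = (c \o* X)); last first.
  by apply: funext => w /=; rewrite mulrC.
rewrite covarianceZl; [|exact: L2_Lfun1|exact: L2_Lfun1|exact: L2_mul].
by rewrite fineM//; exact: L2_cov_fin.
Qed.

Lemma cov0l Y : L2 Y -> cov (fun=> 0) Y = 0.
Proof. by move=> LY; have := covZl 0 (L2_cst 0) LY; rewrite !mul0r. Qed.

Lemma cov_suml n (c : 'I_n -> R) (X : 'I_n -> T -> R) Y :
  (forall i, L2 (X i)) -> L2 Y ->
  cov (fun w => \sum_(i < n) c i * X i w) Y = \sum_(i < n) c i * cov (X i) Y.
Proof.
move=> LX LY; elim: n c X LX => [|n IH] c X LX.
  by under eq_fun do rewrite big_ord0; rewrite big_ord0 cov0l.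
under eq_fun do rewrite big_ord_recl; rewrite covDl//; last 2 first.
- exact: L2Z.
- exact: (@L2_sum n (fun i => c (lift ord0 i)) (fun i => X (lift ord0 i))).
rewrite big_ord_recl covZl//; congr (_ + _).
exact: (IH (fun i => c (lift ord0 i)) (fun i => X (lift ord0 i))).
Qed.

Lemma cov_sumr n (c : 'I_n -> R) (X : 'I_n -> T -> R) Y :
  (forall i, L2 (X i)) -> L2 Y ->
  cov Y (fun w => \sum_(i < n) c i * X i w) = \sum_(i < n) c i * cov Y (X i).
Proof.
move=> LX LY; rewrite covC cov_suml//; apply: eq_bigr => i _; by rewrite covC.
Qed.

Lemma expectation_ae X X' : measurable_fun setT X -> measurable_fun setT X' ->
  {ae P, forall w, X w = X' w} -> ('E_P[X] = 'E_P[X'])%E.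
Proof.
move=> mX mX' XX'; rewrite unlock; apply: ae_eq_integral => //;
  try exact/measurable_EFinP.
by apply: filterS XX' => w /= -> _.
Qed.

Lemma cov_ae X X' Y Y' : L2 X -> L2 X' -> L2 Y -> L2 Y' ->
  {ae P, forall w, X w = X' w} -> {ae P, forall w, Y w = Y' w} ->
  cov X Y = cov X' Y'.
Proof.
move=> [mX _] [mX' _] [mY _] [mY' _] XX' YY'; rewrite /cov unlock.
rewrite (expectation_ae mX mX' XX') (expectation_ae mY mY' YY').
congr fine; apply: expectation_ae.
- by apply: measurable_funM; exact: measurable_funB.
- by apply: measurable_funM; exact: measurable_funB.
apply: filterS2 XX' YY' => w Xw Yw.
by change ((X w - fine ('E_P[X'])%E) * (Y w - fine ('E_P[Y'])%E) =
  (X' w - fine ('E_P[X'])%E) * (Y' w - fine ('E_P[Y'])%E)); rewrite Xw Yw.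
Qed.

Lemma covE X Y : L2 X -> L2 Y ->
  cov X Y = fine ('E_P[X * Y])%E - mean X * mean Y.
Proof.
move=> LX LY; rewrite /cov covarianceE; [|exact: L2_Lfun1|exact: L2_Lfun1|exact: L2_mul].
have fX := expectation_fin_num (L2_Lfun1 LX).
have fY := expectation_fin_num (L2_Lfun1 LY).
by rewrite fineB ?fineM ?fin_numM//; apply/expectation_fin_num/L2_mul.
Qed.

Lemma meanD X Y : L2 X -> L2 Y -> mean (fun w => X w + Y w) = mean X + mean Y.
Proof.
move=> LX LY; rewrite /mean (_ : (fun w => X w + Y w) = X \+ Y)//.
by rewrite expectationD ?L2_Lfun1// fineD ?expectation_fin_num ?L2_Lfun1.
Qed.

Lemma meanZ (c : R) X : L2 X -> mean (fun w => c * X w) = c * mean X.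
Proof.
move=> LX; rewrite /mean (_ : (fun w => c * X w) = (c \o* X)); last first.
  by apply: funext => w /=; rewrite mulrC.
by rewrite expectationZl ?L2_Lfun1// fineM ?expectation_fin_num ?L2_Lfun1.
Qed.

Lemma mean_sum n (c : 'I_n -> R) (X : 'I_n -> T -> R) : (forall i, L2 (X i)) ->
  mean (fun w => \sum_(i < n) c i * X i w) = \sum_(i < n) c i * mean (X i).
Proof.
elim: n c X => [|n IH] c X LX.
  under eq_fun do rewrite big_ord0; rewrite big_ord0.
  by have := meanZ 0 (L2_cst 0); rewrite !mul0r.
under eq_fun do rewrite big_ord_recl; rewrite meanD//; last 2 first.
- exact: L2Z.
- exact: (@L2_sum n (fun i => c (lift ord0 i)) (fun i => X (lift ord0 i))).
rewrite big_ord_recl meanZ//; congr (_ + _).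
exact: (IH (fun i => c (lift ord0 i)) (fun i => X (lift ord0 i))).
Qed.

End second_order.

Section white_noise.
Context {d} {T : measurableType d} {R : realType} (P : probability T R).
Variable zeta : int -> {RV P >-> R}.
Hypothesis zeta_iid : iid_standard_normal zeta.
Local Notation nu := (normal_prob (0 : R) 1).

(** The normal law lives on the generated Borel sigma-algebra of R, so [zeta] is
    regarded as taking its values there. *)
Definition noise t : T -> measurableTypeR R := zeta t.

Lemma measurable_noise t : measurable_fun setT (noise t).
Proof. exact: (@measurable_funPT _ _ _ _ (zeta t)). Qed.

Lemma pushforward_noise t A : measurable A -> pushforward P (noise t) A = nu A.
Proof. exact: zeta_iid.2. Qed.

Lemma ge0_integral_zeta t (f : R -> \bar R) :
  measurable_fun (setT : set (measurableTypeR R)) f ->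
  (forall x, (0 <= f x)%E) -> (\int[P]_w f (zeta t w) = \int[nu]_x f x)%E.
Proof.
move=> mf f0; transitivity (\int[pushforward P (noise t)]_x f x)%E.
  by rewrite (ge0_integral_pushforward (measurable_noise t)).
apply: (eq_measure_integral nu) => [|? A mA _]; first exact: measurable_noise.
exact: pushforward_noise.
Qed.

Lemma L2_zeta t : L2 P (zeta t).
Proof.
split; first by [].
apply/integrableP; split; first by apply/measurable_EFinP; exact: measurable_funX.
under eq_integral do rewrite gee0_abs ?lee_fin ?sqr_ge0//.
rewrite (@ge0_integral_zeta t (fun x => (x ^+ 2)%:E)); last 2 first.
- by apply/measurable_EFinP; exact: measurable_funX.
- by move=> x; rewrite lee_fin sqr_ge0.
by rewrite normal_second_moment ltry.
Qed.

Lemma mean_zeta t : mean P (zeta t) = 0.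
Proof.
have iz : P.-integrable setT (fun w => (zeta t w)%:E).
  by have /Lfun1_integrable := L2_Lfun1 (L2_zeta t).
rewrite /mean unlock.
have -> : (\int[P]_w (zeta t w)%:E = \int[pushforward P (noise t)]_x x%:E)%E.
  by rewrite (integral_pushforward (measurable_noise t)).
have -> : (\int[pushforward P (noise t)]_x x%:E = \int[nu]_x x%:E)%E.
  apply: (eq_measure_integral nu) => [|? A mA _]; first exact: measurable_noise.
  exact: pushforward_noise.
by rewrite normal_mean.
Qed.

Lemma expectation_zeta_sqr t : ('E_P[(zeta t : T -> R) * zeta t])%E = 1%E.
Proof.
rewrite unlock -normal_second_moment -(@ge0_integral_zeta t (fun x => (x ^+ 2)%:E)).
- by apply: eq_integral => w _; rewrite expr2.
- by apply/measurable_EFinP; exact: measurable_funX.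
- by move=> x; rewrite lee_fin sqr_ge0.
Qed.

(** By independence the joint law of two noise variables is a product measure, to
    which Fubini applies. *)
Lemma expectation_zeta_mul s t : s != t ->
  ('E_P[(zeta s : T -> R) * zeta t])%E = 0%E.
Proof.
move=> st; rewrite unlock.
pose Y w := (noise s w, noise t w) : measurableTypeR R * measurableTypeR R.
have mY : measurable_fun setT Y.
  by apply/measurable_fun_pairP; split; exact: measurable_noise.
pose f (z : measurableTypeR R * measurableTypeR R) : \bar R := (z.1 * z.2)%:E.
have mf : measurable_fun setT f.
  by apply/measurable_EFinP; apply: measurable_funM.
have ifY : P.-integrable setT (f \o Y).
  by have /Lfun1_integrable := L2_mul (L2_zeta s) (L2_zeta t).
transitivity (\int[pushforward P Y]_z f z)%E.
  by rewrite (integral_pushforward mY).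
have joint : forall A, measurable A -> A `<=` setT ->
    pushforward P Y A = (nu \x nu)%E A.
  move=> A mA _; apply/esym.
  apply: (@product_measure_unique _ _ _ _ _ _ _ (pushforward P Y)) => // B C mB mC.
  pose D r := if r == s then B else C.
  have := zeta_iid.1 [:: s; t] D; rewrite /= inE st => /(_ isT) H.
  rewrite /pushforward (_ : Y @^-1` _ =
     [set w | forall r, r \in [:: s; t] -> D r (zeta r w)]); last first.
    apply/seteqP; split => [w [/= Bw Cw] r|w /= H'].
      rewrite !inE => /orP[/eqP ->|/eqP ->]; rewrite /D ?eqxx//.
      by rewrite eq_sym (negbTE st).
    split => /=; first by have := H' s; rewrite inE eqxx /D eqxx; apply.
    by have := H' t; rewrite !inE eqxx orbT /D eq_sym (negbTE st); apply.
  rewrite H => [|r]; last by rewrite /D; case: ifP.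
  rewrite !big_cons big_nil mule1 /D eqxx eq_sym (negbTE st).
  by rewrite -(pushforward_noise s mB) -(pushforward_noise t mC).
have -> : (\int[pushforward P Y]_z f z = \int[(nu \x nu)%E]_z f z)%E.
  by apply: (eq_measure_integral (nu \x nu)%E).
have iid := @integrable_normal_id R.
have iprod : (nu \x nu)%E.-integrable setT f.
  apply/integrable12ltyP => //.
  have iabs := integrable_abse iid.
  have fin : (\int[nu]_y `|y%:E|)%E \is a fin_num by exact: integrable_fin_num.
  rewrite (eq_integral (fun x : measurableTypeR R => (\int[nu]_y `|y%:E|) * `|x%:E|)%E); last first.
    move=> x _; rewrite muleC -ge0_integralZl//; last exact: measurable_int iabs.
    by apply: eq_integral => y _; rewrite /f/= normrM EFinM.
  rewrite ge0_integralZl//; [|exact: measurable_int iabs|exact: integral_ge0].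
  by rewrite -ge0_fin_numE ?fin_numM// mule_ge0// integral_ge0.
rewrite -integral12_prod_meas1// /fubini_F.
rewrite (eq_integral (fun=> 0%E)) ?integral0// => x _.
rewrite /f/=; under eq_integral do rewrite EFinM.
by rewrite integralZl// normal_mean mule0.
Qed.

Lemma cov_zeta s t : cov P (zeta s) (zeta t) = (s == t)%:R.
Proof.
rewrite (covE (L2_zeta s) (L2_zeta t)) !mean_zeta mulr0 subr0.
by case: eqVneq => [->|st]; rewrite ?expectation_zeta_sqr// expectation_zeta_mul.
Qed.

End white_noise.

Section arma_covariance.
Context {d} {T : measurableType d} {R : realType} (P : probability T R).
Variables (phi theta : {poly R}) (Z zeta : int -> {RV P >-> R}).
Hypothesis armaZ : stationary_arma phi theta Z zeta.

Let iid : iid_standard_normal zeta. Proof. by case: armaZ. Qed.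

Lemma L2_stationary t : L2 P (Z t).
Proof. by split => //; case: armaZ => -[]. Qed.

Definition acov (h : int) : R := cov P (Z 0) (Z h).

Lemma cov_acov s t : cov P (Z s) (Z t) = acov (t - s).
Proof.
case: armaZ => -[_ _ /(_ s 0 (t - s)) H] _ _.
by move: H; rewrite addrC subrK add0r /acov /cov => ->.
Qed.

Lemma cov_ge0 X : 0 <= cov P X X.
Proof. by apply: fine_ge0; exact: variance_ge0. Qed.

(** The variances of [Z 0 + Z h] and [Z 0 - Z h] are nonnegative. *)
Lemma acov_bounded h : `|acov h| <= acov 0.
Proof.
have LZ := L2_stationary.
have key (c : R) : 0 <= acov 0 + c ^+ 2 * acov 0 + 2 * c * acov h.
  have LcZ := L2Z c (LZ h); have LS := L2D (LZ 0) LcZ.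
  have expand Y : L2 P Y -> cov P (fun w => Z 0 w + c * Z h w) Y =
      cov P (Z 0) Y + c * cov P (Z h) Y by move=> LY; rewrite covDl// covZl.
  have := cov_ge0 (fun w => Z 0 w + c * Z h w).
  rewrite expand// [cov P (Z 0) _]covC [cov P (Z h) _]covC !expand//.
  by rewrite [cov P (Z h) (Z 0)]covC !cov_acov !subrr subr0; lra.
have := key 1; have := key (-1); rewrite ler_norml; lra.
Qed.

(** Both sides of the ARMA equation have the same autocovariance; bilinearity
    turns this into a difference equation for that of [Z] alone. *)
Lemma acov_eq h : filt (-1) phi (filt 1 phi acov) h =
  filt (-1) theta (filt 1 theta delta0) h.
Proof.
pose X t w := \sum_(i < size phi) phi`_i * Z (t - i%:Z) w.
pose Y t w := \sum_(i < size theta) theta`_i * zeta (t - i%:Z) w.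
have LX t : L2 P (X t) by apply: L2_sum => i; exact: L2_stationary.
have LY t : L2 P (Y t) by apply: L2_sum => i; exact: L2_zeta.
have XY t : {ae P, forall w, X t w = Y t w} by case: armaZ => _ _; apply.
have := cov_ae (LX 0) (LY 0) (LX h) (LY h) (XY 0) (XY h).
have cX : cov P (X 0) (X h) = filt 1 phi (filt (-1) phi acov) h.
  rewrite cov_suml; [|by move=> i; exact: L2_stationary|exact: LX].
  apply: eq_bigr => i _; congr (_ * _).
  rewrite cov_sumr; [|by move=> j; exact: L2_stationary|exact: L2_stationary].
  apply: eq_bigr => j _; rewrite cov_acov; congr (_ * acov _); lia.
have cY : cov P (Y 0) (Y h) = filt 1 theta (filt (-1) theta delta0) h.
  rewrite cov_suml; [|by move=> i; exact: L2_zeta|exact: LY].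
  apply: eq_bigr => i _; congr (_ * _).
  rewrite cov_sumr; [|by move=> j; exact: L2_zeta|exact: L2_zeta].
  apply: eq_bigr => j _; rewrite cov_zeta// /delta0; congr (_ * (nat_of_bool _)%:R).
  by apply/eqP/eqP; lia.
by move=> E; rewrite [LHS]filtC_comm [RHS]filtC_comm -cX -cY.
Qed.

(** Taking expectations in the ARMA equation multiplies the constant mean by
    phi(1), and the noise has mean 0. *)
Lemma mean_stationary : phi.[1] != 0 -> forall t, mean P (Z t) = 0.
Proof.
move=> p1; have mE t : mean P (Z t) = mean P (Z 0).
  by case: armaZ => -[_ H _] _ _; rewrite /mean (H t 0).
suff m0 : mean P (Z 0) = 0 by move=> t; rewrite mE.
pose X w := \sum_(i < size phi) phi`_i * Z (0 - i%:Z) w.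
pose Y w := \sum_(i < size theta) theta`_i * zeta (0 - i%:Z) w.
have LX : L2 P X by apply: L2_sum => i; exact: L2_stationary.
have LY : L2 P Y by apply: L2_sum => i; exact: L2_zeta.
have XY : {ae P, forall w, X w = Y w} by case: armaZ => _ _; apply.
have : mean P X = mean P Y by rewrite /mean (expectation_ae LX.1 LY.1 XY).
rewrite mean_sum; last by move=> i; exact: L2_stationary.
rewrite mean_sum; last by move=> i; exact: L2_zeta.
rewrite [RHS]big1; last by move=> i _; rewrite mean_zeta// mulr0.
under eq_bigr do rewrite mE; rewrite -mulr_suml.
rewrite (_ : \sum_(i < size phi) phi`_i = phi.[1]); last first.
  by rewrite horner_coef; apply: eq_bigr => i _; rewrite expr1n mulr1.
by move=> /eqP; rewrite mulf_eq0 (negbTE p1) => /eqP.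
Qed.

Lemma autocovariance_acov : phi.[1] != 0 -> autocovariance Z = acov.
Proof.
move=> p1; apply: funext => h; rewrite /autocovariance /acov.
rewrite (covE (L2_stationary 0) (L2_stationary h)) !mean_stationary// mulr0 subr0.
by [].
Qed.

Lemma covariance_mx_acov n :
  covariance_mx Z n = \matrix_(i, j) acov (j%:Z - i%:Z).
Proof.
apply/matrixP => i j; rewrite !mxE -/(cov P _ _) cov_acov; congr acov; lia.
Qed.

End arma_covariance.

(** * Block indicators under a Toeplitz covariance *)

Section toeplitz_matrix.
Context {R : realType}.
Variables (gamma : int -> R) (f0 c : R).
Hypotheses (gamma_sym : forall h, gamma (- h) = gamma h)
  (gamma_total : has_total gamma f0) (f0_gt0 : 0 < f0) (c_gt0 : 0 < c)
  (toeplitz_ge : forall V, c * sqnorm V <= toeplitz gamma V).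

Definition toeplitz_mx n : 'M[R]_n := \matrix_(i, j) gamma (j%:Z - i%:Z).

Definition norm1 n (v : 'cV[R]_n) : R := \sum_i `|v i 0|.

(** Entry [i] of a vector is the observation at time [i.+1]; the block consists of
    the times from [lo] to [hi.-1]. *)
Definition bvec n (lo hi : nat) : 'cV[R]_n := \col_i (lo <= i.+1 < hi)%N%:R.

Lemma dotE n (u v : 'cV[R]_n) : dot u v = \sum_i u i 0 * v i 0.
Proof. by rewrite /dot mxE; apply: eq_bigr => i _; rewrite mxE. Qed.

Lemma dotC n (u v : 'cV[R]_n) : dot u v = dot v u.
Proof. by rewrite !dotE; apply: eq_bigr => i _; rewrite mulrC. Qed.

Lemma dot_ge0 n (u : 'cV[R]_n) : 0 <= dot u u.
Proof. by rewrite dotE; apply: sumr_ge0 => i _; rewrite -expr2 sqr_ge0. Qed.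

Lemma dot_norm1 n (u : 'cV[R]_n) : dot u u <= norm1 u ^+ 2.
Proof.
rewrite dotE expr2 /norm1 mulr_suml; apply: ler_sum => i _.
rewrite (bigD1 i)//= mulrDr ler_wpDr//.
  by rewrite mulr_ge0//; apply: sumr_ge0.
by rewrite -normrM; exact: ler_norm.
Qed.

Lemma dot_bvec_norm1 n (u : 'cV[R]_n) lo hi : `|dot u (bvec n lo hi)| <= norm1 u.
Proof.
rewrite dotE; apply: (le_trans (ler_norm_sum _ _ _)); apply: ler_sum => i _.
rewrite mxE normrM ler_piMr//; case: (_ <= _ < _)%N; by rewrite ?normr1 ?normr0.
Qed.

Lemma tr_toeplitz_mx n : (toeplitz_mx n)^T = toeplitz_mx n.
Proof. by apply/matrixP => i j; rewrite !mxE -gamma_sym opprB. Qed.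

Lemma toeplitz_mx_ge n (v : 'cV[R]_n) : c * dot v v <= bform (toeplitz_mx n) v v.
Proof.
pose V := \poly_(i < n) (if insub i is Some j then v (j : 'I_n) 0 else 0).
have Vi (i : 'I_n) : V`_i = v i 0 by rewrite coef_poly ltn_ord valK.
have sV : (size V <= n)%N by exact: size_poly.
have := toeplitz_ge V; rewrite (sqnorm_trunc sV) dotE.
rewrite (eq_bigr (fun i => v i 0 * v i 0)); last by move=> i _; rewrite Vi expr2.
move=> /le_trans; apply; rewrite le_eqVlt; apply/orP; left; apply/eqP.
rewrite /toeplitz (filt_trunc _ _ _ sV) /bform -mulmxA mxE; apply: eq_bigr => i _.
rewrite Vi mxE; congr (_ * _); rewrite (filt_trunc _ _ _ sV) mxE; apply: eq_bigr => j _.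
rewrite Vi mxE mulrC; congr (gamma _ * _); lia.
Qed.

Lemma posdef_toeplitz_mx n : posdef (toeplitz_mx n).
Proof.
split; first exact: tr_toeplitz_mx.
move=> v v0; apply: lt_le_trans (toeplitz_mx_ge v); rewrite mulr_gt0//.
rewrite lt_neqAle dot_ge0 andbT eq_sym; apply: contra_neq v0 => vv.
apply/matrixP => i j; rewrite (ord1 j) mxE; apply/eqP; rewrite -sqrf_eq0 expr2.
have := vv; rewrite dotE => /eqP.
rewrite psumr_eq0 => [/allP/(_ i)|k _]; last by rewrite -expr2 sqr_ge0.
by rewrite mem_index_enum => /(_ isT).
Qed.

Let unit n : toeplitz_mx n \in unitmx := posdef_unit (posdef_toeplitz_mx n).

(** With w the solution of S w = u, the claim is that |c w - u|^2 is nonnegative,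
    combined with the lower bound for the form of S at w. *)
Lemma inv_toeplitz_le n (u : 'cV[R]_n) :
  bform (invmx (toeplitz_mx n)) u u <= dot u u / c.
Proof.
set S := toeplitz_mx n; pose w := invmx S *m u.
have Sw : S *m w = u by rewrite /w mulKVmx// unit.
have St : (invmx S)^T = invmx S := (posdef_inv (posdef_toeplitz_mx n)).1.
have q1 : bform S w w = dot w u by rewrite /bform /dot -mulmxA Sw.
have q2 : bform (invmx S) u u = dot w u by rewrite /bform /dot /w trmx_mul St.
have := toeplitz_mx_ge w; rewrite -/S q1 q2 => H.
rewrite ler_pdivlMr//.
have : 0 <= dot (c *: w - u) (c *: w - u) by exact: dot_ge0.
have -> : dot (c *: w - u) (c *: w - u) = c * (c * dot w w) - 2 * c * dot w u + dot u u.
  rewrite !dotE !mulr_sumr -sumrB -big_split/=; apply: eq_bigr => i _.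
  by rewrite !mxE; ring.
have : c * (c * dot w w) <= c * dot w u by rewrite ler_pM2l.
lra.
Qed.

(** Polarization: the form of the inverse is nonnegative at u + v and u - v. *)
Lemma inv_toeplitz_cross n (u v : 'cV[R]_n) (K : R) : 0 <= K ->
  norm1 u <= K -> norm1 v <= K ->
  `|bform (invmx (toeplitz_mx n)) u v| <= K ^+ 2 / c.
Proof.
move=> K0 uK vK; set S := invmx _.
have Spd : posdef S by exact/posdef_inv/posdef_toeplitz_mx.
have S0 w : 0 <= bform S w w.
  have [->|w0] := eqVneq w 0; first by rewrite /bform mulmx0 mxE.
  exact/ltW/Spd.2.
have le w : norm1 w <= K -> bform S w w <= K ^+ 2 / c.
  move=> wK; apply: (le_trans (inv_toeplitz_le w)); rewrite ler_pM2r ?invr_gt0//.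
  apply: (le_trans (dot_norm1 w)); rewrite lerXn2r ?nnegrE//.
  by apply: sumr_ge0.
have h1 := S0 (u + v); have h2 := S0 (u - v).
have {}uK := le _ uK; have {}vK := le _ vK.
move: h1 h2; rewrite -[- v]scaleN1r !(bformDl, bformDr, bformZl, bformZr).
rewrite (bformC v u Spd.1) ler_norml; lra.
Qed.

Lemma has_total_range (H : int -> R) lo hi (s : nat) :
  (forall x, gamma x = f0 * delta0 x + (H (x + 1) - H x)) -> (lo <= hi)%N ->
  \sum_(lo <= k < hi) gamma (k%:Z - s%:Z) =
  f0 * (lo <= s < hi)%N%:R + (H (hi%:Z - s%:Z) - H (lo%:Z - s%:Z)).
Proof.
move=> gH; elim: hi => [|hi IH].
  by case: lo => // _; rewrite big_geq// subrr addr0 andbF mulr0.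
rewrite leq_eqVlt => /orP[/eqP ->|].
  by rewrite big_geq// subrr addr0 [(s < _)%N]ltnNge andbN mulr0.
rewrite ltnS => lohi; rewrite big_nat_recr//= IH// gH.
have -> : hi%:Z - s%:Z + 1 = hi.+1%:Z - s%:Z :> int by lia.
have -> : (lo <= s < hi.+1)%N%:R = (lo <= s < hi)%N%:R + delta0 (hi%:Z - s%:Z) :> R.
  rewrite /delta0 subr_eq0 eqz_nat ltnS [(s <= hi)%N]leq_eqVlt [hi == s]eq_sym.
  have [->|sh] := eqVneq s hi; first by rewrite ltnn andbF add0r lohi.
  by rewrite addr0.
by ring.
Qed.

Lemma sum_bvec n lo hi (F : nat -> R) :
  (0 < lo)%N -> (lo <= hi)%N -> (hi <= n.+1)%N ->
  \sum_(j < n) F j.+1 * bvec n lo hi j 0 = \sum_(lo <= k < hi) F k.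
Proof.
move=> lo0 lohi hin; pose G k := F k * (lo <= k < hi)%N%:R.
rewrite (eq_bigr (fun j : 'I_n => G j.+1)); last by move=> j _; rewrite mxE.
rewrite -(big_mkord xpredT (fun j => G j.+1)) -(big_add1 _ _ 0 n.+1 xpredT G).
rewrite (@big_cat_nat _ _ _ lo)//=; last by rewrite (leq_trans lohi).
rewrite [X in _ + X](@big_cat_nat _ _ _ hi)//=.
rewrite [X in X + _]big_nat big1 ?add0r; last first.
  by move=> k /andP[_ kl]; rewrite /G leqNgt kl mulr0.
rewrite [X in _ + X]big_nat [X in _ + X]big1 ?addr0; last first.
  by move=> k /andP[hk _]; rewrite /G [(k < hi)%N]ltnNge hk andbF mulr0.
by apply: eq_big_nat => k kl; rewrite /G kl mulr1.
Qed.

(** Away from the ends of a block, [toeplitz_mx n] acts on its indicator as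
    multiplication by [f0]; the error decays geometrically with the distance to
    the ends, so its l1 norm is bounded uniformly in [n] and in the block. *)
Lemma block_residual : exists2 K : R, 0 <= K &
  forall n lo hi, (0 < lo)%N -> (lo <= hi)%N -> (hi <= n.+1)%N ->
    norm1 (toeplitz_mx n *m bvec n lo hi - f0 *: bvec n lo hi) <= K.
Proof.
have [H [C [t [C0 t01 HC]]] gH] := gamma_total.
have /andP[t0 t1] := t01.
have B0 : 0 <= C * (1 - t)^-1 by rewrite mulr_ge0// invr_ge0 subr_ge0 ltW.
have sumt (n m : nat) : \sum_(i < n) t ^+ `|(m%:Z - i.+1%:Z)%R|%N <= 2 * (1 - t)^-1.
  pose F i := t ^+ `|(m%:Z - i.+1%:Z)%R|%N.
  apply: (@le_trans _ _ (\sum_(i < m + n) F i)).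
    rewrite addnC big_split_ord/= ler_wpDr//; apply: sumr_ge0 => i _.
    by rewrite exprn_ge0// ltW.
  rewrite big_split_ord/= mulr_natl mulr2n; apply: lerD.
    rewrite (reindex_inj rev_ord_inj)/=.
    rewrite (eq_bigr (fun i : 'I_m => t ^+ i)) ?geometric_sum_le ?ltW//.
    move=> i _; rewrite /F; congr (t ^+ _); have := ltn_ord i; lia.
  apply: (@le_trans _ _ (\sum_(i < n) t ^+ i)); last by rewrite geometric_sum_le ?ltW.
  by apply: ler_sum => i _; rewrite /F ler_wiXn2l ?ltW//; lia.
exists (4 * (C * (1 - t)^-1)); first by rewrite mulr_ge0.
move=> n lo hi lo0 lohi hin.
have rE (i : 'I_n) : (toeplitz_mx n *m bvec n lo hi - f0 *: bvec n lo hi) i 0 =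
    H (hi%:Z - i.+1%:Z) - H (lo%:Z - i.+1%:Z).
  rewrite !mxE (eq_bigr (fun j : 'I_n => gamma (j.+1%:Z - i.+1%:Z) * bvec n lo hi j 0)).
    rewrite (@sum_bvec n lo hi (fun k => gamma (k%:Z - i.+1%:Z)))//.
    by rewrite (has_total_range _ gH)// addrAC subrr add0r.
  by move=> j _; rewrite mxE; congr (gamma _ * _); lia.
rewrite /norm1; under eq_bigr do rewrite rE.
apply: (@le_trans _ _ (\sum_(i < n) (C * t ^+ `|(hi%:Z - i.+1%:Z)%R|%N
    + C * t ^+ `|(lo%:Z - i.+1%:Z)%R|%N))).
  by apply: ler_sum => i _; apply: (le_trans (ler_normB _ _)); apply: lerD.
rewrite big_split/= -!mulr_sumr.
have := sumt n hi; have := sumt n lo => h1 h2.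
have {}h1 := ler_wpM2l C0 h1; have {}h2 := ler_wpM2l C0 h2.
lra.
Qed.

(** With r and r' the residuals of [block_residual], x = (S x - r) / f0 and
    y = (S y - r') / f0; expanding leaves, besides x . y / f0, only terms in r
    and r', which are bounded in l1. *)
Lemma block_estimates : exists2 K : R, 0 < K &
  forall n lo hi lo' hi', (0 < lo)%N -> (lo <= hi)%N -> (hi <= n.+1)%N ->
    (0 < lo')%N -> (lo' <= hi')%N -> (hi' <= n.+1)%N ->
  let x := bvec n lo hi in let y := bvec n lo' hi' in
  `|bform (toeplitz_mx n) x x - f0 * dot x x| <= K /\
  `|bform (invmx (toeplitz_mx n)) x y - dot x y / f0| <= K.
Proof.
have [K K0 KP] := block_residual.
have D0 : 0 <= (K + K ^+ 2 / c) / f0 ^+ 2.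
  apply: divr_ge0; last exact: sqr_ge0.
  by apply: addr_ge0 => //; apply: divr_ge0; [exact: sqr_ge0|exact: ltW].
exists (K + (K + K ^+ 2 / c) / f0 ^+ 2 + 1); first by rewrite ltr_wpDl// addr_ge0.
move=> n lo hi lo' hi' a1 a2 a3 b1 b2 b3 x y.
set S := toeplitz_mx n.
have Spd := posdef_toeplitz_mx n; have Ipd := posdef_inv Spd.
have rx := KP n lo hi a1 a2 a3; have ry := KP n lo' hi' b1 b2 b3.
rewrite -/x -/y -/S in rx ry.
set r := S *m x - f0 *: x in rx; set r' := S *m y - f0 *: y in ry.
have f2 : 0 < f0 ^+ 2 by rewrite exprn_gt0.
split.
  have -> : bform S x x - f0 * dot x x = dot r x.
    rewrite /bform -mulmxA -/(dot x (S *m x)) dotC /r !dotE.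
    rewrite mulr_sumr -sumrB; apply: eq_bigr => i _; rewrite !mxE; ring.
  apply: (le_trans (dot_bvec_norm1 _ _ _)); apply: (le_trans rx).
  by rewrite -addrA lerDl addr_ge0.
have xE : x = f0^-1 *: (S *m x - r).
  by rewrite /r opprB addrC subrK scalerA mulVf ?gt_eqF// scale1r.
have yE : y = f0^-1 *: (S *m y - r').
  by rewrite /r' opprB addrC subrK scalerA mulVf ?gt_eqF// scale1r.
have SxE u v : bform (invmx S) (S *m u) v = dot u v.
  by rewrite /bform trmx_mul Spd.1 mulmxK ?posdef_unit.
have e1 : bform (invmx S) x y = f0^-1 * (dot x y - bform (invmx S) r y).
  by rewrite {1}xE bformZl bformDl SxE -[- r]scaleN1r bformZl mulN1r.
have e2 : bform (invmx S) r y = f0^-1 * (dot r y - bform (invmx S) r r').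
  rewrite {1}yE bformZr bformDr (bformC _ (S *m y) Ipd.1) SxE -[- r']scaleN1r bformZr.
  by rewrite mulN1r dotC.
have e3 : `|dot r y| <= K by exact: le_trans (dot_bvec_norm1 _ _ _) rx.
have e4 : `|bform (invmx S) r r'| <= K ^+ 2 / c by exact: inv_toeplitz_cross.
rewrite e1 e2 [X in `|X|](_ : _ = - (f0 ^- 2 * (dot r y - bform (invmx S) r r'))).
  rewrite normrN normrM (ger0_norm (x := f0 ^- 2)) ?invr_ge0 ?sqr_ge0//.
  apply: (@le_trans _ _ ((K + K ^+ 2 / c) / f0 ^+ 2)).
    rewrite mulrC ler_pM2r ?invr_gt0//; apply: (le_trans (ler_normB _ _)).
    exact: lerD.
  by rewrite addrAC lerDr addr_ge0.
by field; rewrite gt_eqF.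
Qed.

End toeplitz_matrix.

(** * Indistinguishability of a uniform mixture *)

Section mixture.
Context {R : realType} {n N : nat}.
Variables (S : 'M[R]_n) (mu : 'I_N -> 'cV[R]_n).
Hypotheses (Spd : posdef S) (N0 : (0 < N)%N).
Variables (T u s q1 q2 e : R).
Hypotheses (u0 : 0 <= u) (s0 : 0 <= s).

Let b k l : R := bform (invmx S) (mu k) (mu l).
Let X k (y : n.-tuple R) : R := dotp (invmx S *m mu k) y.
Let lr k (y : n.-tuple R) : R := expR (X k y - b k k / 2).

Hypothesis cross_le : forall k l, k != l -> b k l <= e.
Hypothesis second_le : forall k, (2 - u) ^+ 2 * b k k / 2 - b k k + u * T <= q1.
Hypothesis tail_le : forall k, (1 + s) ^+ 2 * b k k / 2 - b k k / 2 - s * T <= q2.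

Let Su : S \in unitmx := posdef_unit Spd.
Let St : S^T = S := Spd.1.
Let It : (invmx S)^T = invmx S := (posdef_inv Spd).1.

Let bform_dual k l : bform S (invmx S *m mu k) (invmx S *m mu l) = b k l.
Proof. by rewrite /b /bform trmx_mul It -!mulmxA (mulmxA S) mulmxV// mul1mx. Qed.

Lemma gexp0_expR v (c : R) :
  gexp 0 S (fun y => expR (dotp v y + c)) = (expR (bform S v v / 2 + c))%:E.
Proof.
have -> : (fun y : n.-tuple R => expR (dotp v y + c)) =
    (fun y => expR c * expR (dotp v y)).
  by apply: funext => y; rewrite -expRD addrC.
rewrite gexpZ ?expR_ge0//; last exact: measurable_expR_dotp.
by rewrite gexp_expR// /dot mulmx0 mxE add0r -EFinM -expRD addrC.
Qed.

Let mlr k : measurable_fun setT (lr k).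
Proof.
apply: measurableT_comp => //; apply: measurable_funD => //.
exact: measurable_dotp.
Qed.

Let lr_ge0 k y : 0 <= lr k y. Proof. exact: expR_ge0. Qed.

Let lrE k : lr k = (fun y => expR (dotp (invmx S *m mu k) y + - (b k k / 2))).
Proof. by []. Qed.

Let gexp_lr k : gexp 0 S (lr k) = 1%E.
Proof. by rewrite lrE gexp0_expR bform_dual subrr expR0. Qed.

(** Second moment of the likelihood ratio truncated at [X k y <= T], the
    truncation being majorised by [expR (u * (T - X k y))]. *)
Let sec k y : R := lr k y ^+ 2 * expR (u * (T - X k y)).

Let secE k : sec k = (fun y =>
  expR (dotp ((2 - u) *: (invmx S *m mu k)) y + (u * T - b k k))).
Proof.
apply: funext => y; rewrite /sec /lr -expRM_natl -expRD dotpZ -/(X k y).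
by congr expR; rewrite mulr_natl; field.
Qed.

Let gexp_sec k : (gexp 0 S (sec k) <= (expR q1)%:E)%E.
Proof.
rewrite secE gexp0_expR lee_fin ler_expR bformZl bformZr bform_dual.
by apply: le_trans (second_le k); rewrite le_eqVlt; apply/orP; left; apply/eqP; field.
Qed.

Let tail k y : R := lr k y * expR (s * (X k y - T)).

Let tailE k : tail k = (fun y =>
  expR (dotp ((1 + s) *: (invmx S *m mu k)) y + (- (s * T) - b k k / 2))).
Proof.
apply: funext => y; rewrite /tail /lr -expRD dotpZ -/(X k y).
by congr expR; field.
Qed.

Let gexp_tail k : (gexp 0 S (tail k) <= (expR q2)%:E)%E.
Proof.
rewrite tailE gexp0_expR lee_fin ler_expR bformZl bformZr bform_dual.
by apply: le_trans (tail_le k); rewrite le_eqVlt; apply/orP; left; apply/eqP; field.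
Qed.

Let cross k l y : R := lr k y * lr l y.

Let crossE k l : cross k l = (fun y =>
  expR (dotp (invmx S *m mu k + invmx S *m mu l) y + - (b k k / 2 + b l l / 2))).
Proof.
apply: funext => y; rewrite /cross /lr -expRD dotpD -/(X k y) -/(X l y).
by congr expR; field.
Qed.

Let gexp_cross k l : k != l -> (gexp 0 S (cross k l) <= (expR e)%:E)%E.
Proof.
move=> kl; rewrite crossE gexp0_expR lee_fin ler_expR !bformDl !bformDr !bform_dual.
have lk : b l k = b k l by rewrite /b bformC.
by rewrite lk; have := cross_le kl; lra.
Qed.

Let msec k : measurable_fun setT (sec k).
Proof.
rewrite secE; apply: measurableT_comp => //; apply: measurable_funD => //.
exact: measurable_dotp.
Qed.

Let mtail k : measurable_fun setT (tail k).
Proof.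
rewrite tailE; apply: measurableT_comp => //; apply: measurable_funD => //.
exact: measurable_dotp.
Qed.

Let mcross k l : measurable_fun setT (cross k l).
Proof. exact: measurable_funM. Qed.

Let sec_ge0 k y : 0 <= sec k y. Proof. by rewrite mulr_ge0 ?sqr_ge0 ?expR_ge0. Qed.
Let tail_ge0 k y : 0 <= tail k y. Proof. by rewrite mulr_ge0 ?expR_ge0. Qed.
Let cross_ge0 k l y : 0 <= cross k l y. Proof. exact: mulr_ge0. Qed.

Let Ni : R := N%:R^-1.

Let Ni0 : 0 < Ni. Proof. by rewrite invr_gt0 ltr0n. Qed.

Let trunc k y : R := if X k y <= T then lr k y else 0.

Let trunc_ge0 k y : 0 <= trunc k y. Proof. by rewrite /trunc; case: ifP. Qed.

Let trunc_le k y : trunc k y <= lr k y. Proof. by rewrite /trunc; case: ifP. Qed.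

Let trunc_ge k y : lr k y - tail k y <= trunc k y.
Proof.
rewrite /trunc; case: (leP (X k y) T) => XT; first by rewrite gerBl.
rewrite /tail subr_le0 ler_peMr// -expR0 ler_expR mulr_ge0// subr_ge0; exact: ltW.
Qed.

Let trunc_sec k y : trunc k y ^+ 2 <= sec k y.
Proof.
rewrite /trunc /sec; case: (leP (X k y) T) => XT; last by rewrite expr0n; exact: sec_ge0.
by rewrite ler_peMr ?sqr_ge0// -expR0 ler_expR mulr_ge0// subr_ge0.
Qed.

Let mix (z : 'I_N -> R) : R := Ni * \sum_k z k.

Let D y : R := Ni ^+ 2 * (\sum_k (sec k y + \sum_(l < N | l != k) cross k l y)).

Let trunc_sqr y : mix (trunc^~ y) ^+ 2 <= D y.
Proof.
rewrite /mix /D exprMn ler_wpM2l ?sqr_ge0// expr2 mulr_suml.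
apply: ler_sum => k _; rewrite (bigD1 k)//= mulrDr -expr2; apply: lerD => //.
rewrite mulr_sumr; apply: ler_sum => l lk.
by apply: ler_pM => //; exact: trunc_le.
Qed.

(** With L the truncated mixture ratio, L >= 1 - eta - (L - 1)^2 / (4 eta). *)
Let pointwise (B : set (n.-tuple R)) (eta : R) y : 0 < eta ->
  \1_B y + (2 * eta)^-1 * mix (lr^~ y) <=
  mix (fun k => \1_B y * lr k y) + (eta + (4 * eta)^-1 *
    (D y + (1 + 2 * mix (tail^~ y)))).
Proof.
move=> eta0; set L := mix (trunc^~ y).
have L1 : L <= mix (lr^~ y) by rewrite ler_pM2l//; apply: ler_sum.
have L2 : mix (lr^~ y) - mix (tail^~ y) <= L.
  by rewrite /L /mix -mulrBr ler_pM2l// -sumrB; apply: ler_sum.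
have L3 := trunc_sqr y; rewrite -/L in L3.
have eE : (2 * eta)^-1 = 2 * (4 * eta)^-1 :> R by field; rewrite gt_eqF.
have i0 : 0 < (4 * eta)^-1 by rewrite invr_gt0 mulr_gt0.
have key : 1 - eta - (4 * eta)^-1 * (L - 1) ^+ 2 <= L.
  rewrite -(ler_pM2r (_ : 0 < 4 * eta)) ?mulr_gt0// mulrBl mulrAC mulVf ?mul1r ?gt_eqF ?mulr_gt0//.
  by have := sqr_ge0 (L - 1 + 2 * eta); rewrite !expr2; lra.
have bnd : (L - 1) ^+ 2 <= D y + 1 - 2 * (mix (lr^~ y) - mix (tail^~ y)).
  by rewrite sqrrB1; lra.
have := ler_wpM2l (ltW i0) bnd.
have ml0 : 0 <= mix (lr^~ y) by rewrite mulr_ge0 ?(ltW Ni0)//; apply: sumr_ge0.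
have sq0 : 0 <= (4 * eta)^-1 * (L - 1) ^+ 2 by rewrite mulr_ge0 ?sqr_ge0// ltW.
rewrite eE indicE; case: (y \in B) => /=.
  rewrite (_ : mix (fun k => 1 * lr k y) = mix (lr^~ y)); last first.
    by rewrite /mix; congr (_ * _); apply: eq_bigr => k _; rewrite mul1r.
  lra.
rewrite (_ : mix (fun k => 0 * lr k y) = 0); last first.
  by rewrite /mix big1 ?mulr0// => k _; rewrite mul0r.
lra.
Qed.

Let gexp_mix (z : 'I_N -> n.-tuple R -> R) : (forall k, measurable_fun setT (z k)) ->
  (forall k y, 0 <= z k y) ->
  gexp 0 S (fun y => mix (z^~ y)) = (Ni%:E * \sum_k gexp 0 S (z k))%E.
Proof.
move=> mz z0; rewrite /mix gexpZ ?(ltW Ni0)//; last 2 first.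
- exact: measurable_sum.
- by move=> y; apply: sumr_ge0.
by rewrite gexp_sum.
Qed.

Let mmix (z : 'I_N -> n.-tuple R -> R) : (forall k, measurable_fun setT (z k)) ->
  measurable_fun setT (fun y => mix (z^~ y)).
Proof. by move=> mz; apply: measurable_funM => //; exact: measurable_sum. Qed.

Let mix_ge0 (z : 'I_N -> R) : (forall k, 0 <= z k) -> 0 <= mix z.
Proof. by move=> z0; rewrite mulr_ge0 ?(ltW Ni0)//; apply: sumr_ge0. Qed.

Let mean_le (z : 'I_N -> \bar R) (r : R) : (forall k, z k <= r%:E)%E ->
  (Ni%:E * \sum_k z k <= r%:E)%E.
Proof.
move=> zr; apply: (@le_trans _ _ (Ni%:E * \sum_(k < N) r%:E)%E).
  by rewrite lee_wpmul2l ?lee_fin ?(ltW Ni0)//; apply: lee_sum.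
rewrite sumEFin sumr_const card_ord -EFinM lee_fin -[r *+ N]mulr_natl mulrA.
by rewrite mulVf ?mul1r// pnatr_eq0 -lt0n.
Qed.

Let msum k : measurable_fun setT (fun y => \sum_(l < N | l != k) cross k l y).
Proof.
rewrite (_ : (fun y => _) =
    (fun y => \sum_(l < N) (if l != k then cross k l y else 0))); last first.
  by apply: funext => y; rewrite big_mkcond.
by apply: measurable_sum => l; case: (l != k).
Qed.

Let mD : measurable_fun setT D.
Proof.
apply: measurable_funM => //; apply: measurable_sum => k.
exact: measurable_funD.
Qed.

Let gexp_zero : gexp 0 S (fun=> 0) = 0%E.
Proof. by rewrite /gexp; under eq_integral do rewrite mul0r; rewrite integral0. Qed.

Let gexp_D : (gexp 0 S D <= (Ni * expR q1 + expR e)%:E)%E.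
Proof.
have s_ge0 k y : 0 <= \sum_(l < N | l != k) cross k l y by exact: sumr_ge0.
have -> : D = (fun y => Ni * mix (fun k => sec k y + \sum_(l < N | l != k) cross k l y)).
  by apply: funext => y; rewrite /D /mix mulrA expr2.
rewrite gexpZ ?(ltW Ni0)//; last 2 first.
- by apply: mmix => k; exact: measurable_funD.
- by move=> y; apply: mix_ge0 => k; rewrite addr_ge0.
rewrite gexp_mix; last 2 first.
- by move=> k; exact: measurable_funD.
- by move=> k y; rewrite addr_ge0.
have -> : (Ni * expR q1 + expR e)%:E = (Ni%:E * (expR q1 + N%:R * expR e)%:E)%E.
  by rewrite -EFinM mulrDr mulrA mulVf ?mul1r// pnatr_eq0 -lt0n.
rewrite lee_wpmul2l ?lee_fin ?(ltW Ni0)//; apply: mean_le => k.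
rewrite gexpD//= EFinD; apply: leeD => //.
apply: (@le_trans _ _ (gexp 0 S (fun y => \sum_(l < N) (if l != k then cross k l y else 0)))).
  apply: gexp_le => //.
    by apply: measurable_sum => l; case: (l != k).
  by move=> y; rewrite big_mkcond.
rewrite gexp_sum; last 2 first.
- by move=> l; case: (l != k).
- by move=> l y; case: ifP.
apply: (@le_trans _ _ (\sum_(l < N) (expR e)%:E)%E); last first.
  by rewrite sumEFin sumr_const card_ord -[expR e *+ N]mulr_natl.
apply: lee_sum => l _; case: (eqVneq l k) => [_|lk] /=; last first.
  by apply: gexp_cross; rewrite eq_sym.
by rewrite gexp_zero lee_fin expR_ge0.
Qed.

Let gexpB (B : set (n.-tuple R)) k : measurable B ->
  gexp 0 S (fun y => \1_B y * lr k y) = multinormal (mu k) S B.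
Proof.
move=> mB; rewrite (multinormalE (mu k) S mB) /gexp; apply: eq_integral => y _.
by rewrite (multinormal_pdf_ratio (mu k) _ Spd) mulrA.
Qed.

(** The inequality [pointwise] is integrated under N(0, S). The expectations of
    the [lr k] are 1 and those of [\1_B y * lr k y] are probabilities under the
    alternatives, so that the truncated mixture ratio need only be close to 1
    in mean square. *)
Lemma mixture_bound (B : set (n.-tuple R)) (beta : \bar R) (eta : R) :
  measurable B -> 0 < eta -> (forall k, multinormal (mu k) S B <= beta)%E ->
  (multinormal 0 S B <= beta +
    (eta + (4 * eta)^-1 * (Ni * expR q1 + (expR e - 1) + 2 * expR q2))%:E)%E.
Proof.
move=> mB eta0 Bb.
have mI : measurable_fun setT (\1_B : n.-tuple R -> R) by exact: measurable_indic.
have i2 : 0 <= (2 * eta)^-1 by rewrite invr_ge0 mulr_ge0// ltW.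
have i4 : 0 <= (4 * eta)^-1 by rewrite invr_ge0 mulr_ge0// ltW.
have IB k : measurable_fun setT (fun y => \1_B y * lr k y) by exact: measurable_funM.
have IB0 k y : 0 <= \1_B y * lr k y by exact: mulr_ge0.
have D0 y : 0 <= D y by apply: le_trans (trunc_sqr y); exact: sqr_ge0.
have mm1 := mmix mlr; have mm2 := mmix mtail; have mm3 := mmix IB.
have m1 : measurable_fun setT (fun y => 2 * mix (tail^~ y)) by exact: measurable_funM.
have m2 : measurable_fun setT (fun y => 1 + 2 * mix (tail^~ y)).
  exact: measurable_funD.
have m3 : measurable_fun setT (fun y => D y + (1 + 2 * mix (tail^~ y))).
  exact: measurable_funD.
have m4 : measurable_fun setT (fun y => (4 * eta)^-1 * (D y + (1 + 2 * mix (tail^~ y)))).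
  exact: measurable_funM.
have m5 : measurable_fun setT (fun y => eta + (4 * eta)^-1 * (D y + (1 + 2 * mix (tail^~ y)))).
  exact: measurable_funD.
have t0 y : 0 <= 2 * mix (tail^~ y) by rewrite mulr_ge0// mix_ge0.
have t1 y : 0 <= 1 + 2 * mix (tail^~ y) by rewrite addr_ge0.
have t2 y : 0 <= D y + (1 + 2 * mix (tail^~ y)) by rewrite addr_ge0.
have t3 y : 0 <= (4 * eta)^-1 * (D y + (1 + 2 * mix (tail^~ y))) by exact: mulr_ge0.
have t4 y : 0 <= eta + (4 * eta)^-1 * (D y + (1 + 2 * mix (tail^~ y))).
  by rewrite addr_ge0// ltW.
have lhs : gexp 0 S (fun y => \1_B y + (2 * eta)^-1 * mix (lr^~ y)) =
    (multinormal 0 S B + ((2 * eta)^-1)%:E)%E.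
  rewrite gexpD//; last 2 first.
  - exact: measurable_funM.
  - by move=> y; rewrite mulr_ge0// mix_ge0.
  rewrite -(multinormalE 0 S mB) gexpZ//; last by move=> y; exact: mix_ge0.
  rewrite gexp_mix//; under eq_bigr do rewrite gexp_lr.
  rewrite sumEFin sumr_const card_ord -EFinM.
  by rewrite (_ : Ni * (1 *+ N) = 1) ?mulr1// mulVf// pnatr_eq0 -lt0n.
have c1 (r : R) : 0 <= r -> gexp 0 S (fun=> r) = r%:E.
  move=> r0; rewrite (_ : (fun=> r) = (fun y : n.-tuple R => r * 1)); last first.
    by apply: funext => y; rewrite mulr1.
  by rewrite gexpZ// gexp1// mule1.
have rhs : (gexp 0 S (fun y => mix (fun k => \1_B y * lr k y) + (eta + (4 * eta)^-1 *
    (D y + (1 + 2 * mix (tail^~ y)))))%R <=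
    beta + (eta + (4 * eta)^-1 * (Ni * expR q1 + expR e + (1 + 2 * expR q2)))%:E)%E.
  rewrite gexpD//; last by move=> y; exact: mix_ge0.
  apply: leeD.
    rewrite gexp_mix//; under eq_bigr do rewrite gexpB//.
    case: beta Bb => [r| |] Bb; [exact: mean_le|by rewrite leey|].
    have := Bb (Ordinal N0); rewrite (multinormalE (mu (Ordinal N0)) S mB) leeNy_eq => /eqP H.
    have : (0 <= gexp (mu (Ordinal N0)) S \1_B)%E.
      by apply: integral_ge0 => y _; rewrite lee_fin mulr_ge0 ?multinormal_pdf_ge0.
    by rewrite H.
  rewrite gexpD//; last by move=> y; exact: ltW.
  rewrite c1 ?(ltW eta0)// EFinD leeD2l// gexpZ// EFinM lee_wpmul2l ?lee_fin//.
  rewrite gexpD// EFinD; apply: leeD => //.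
  rewrite gexpD// c1// EFinD leeD2l// gexpZ//; last by move=> y; exact: mix_ge0.
  by rewrite EFinM lee_wpmul2l ?lee_fin// gexp_mix//; exact: mean_le.
have Bl : (multinormal 0 S B + ((2 * eta)^-1)%:E <=
    beta + (eta + (4 * eta)^-1 * (Ni * expR q1 + expR e + (1 + 2 * expR q2)))%:E)%E.
  rewrite -lhs; apply: le_trans rhs; apply: gexp_le => //.
  - by apply: measurable_funD => //; exact: measurable_funM.
  - exact: measurable_funD.
  - by move=> y; rewrite addr_ge0// mulr_ge0// mix_ge0.
  - by move=> y; exact: pointwise.
rewrite -(@leeD2rE _ ((2 * eta)^-1)%:E)//; apply: (le_trans Bl).
rewrite -addeA -EFinD le_eqVlt; apply/orP; left; apply/eqP; congr (_ + _%:E)%E.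
by field; rewrite gt_eqF.
Qed.

End mixture.

(** * Intervals as blocks of indices *)

Section intervals.
Context {R : realType}.

Lemma nat_ceil (x : R) : 0 <= x ->
  exists m : nat, [/\ forall k : nat, (m <= k)%N = (x <= k%:R), x <= m%:R & m%:R < x + 1].
Proof.
move=> x0; have c0 : 0 <= Num.ceil x by rewrite (le_trans _ (le_ceil x0))// ceil0.
exists `|Num.ceil x|%N.
have E k : (`|Num.ceil x| <= k)%N = (x <= k%:R).
  by rewrite -lez_nat gez0_abs// ceil_le_int.
split => //; first by rewrite -E.
case m0 : `|Num.ceil x|%N => [|m]; first by rewrite ltr_wpDl.
have := E m; rewrite m0 ltnn => /esym/negbT; rewrite -ltNge => mx.
by rewrite -natr1 ltrD2r.
Qed.

(** The lower end is [maxn 1 m] and not [m], the indices starting at 1. *)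
Lemma interval_block n (a b : R) : (0 < n)%N -> 0 <= a -> a < b -> b <= 1 ->
  exists lo hi : nat, [/\ (0 < lo)%N, (lo <= hi)%N, (hi <= n.+1)%N,
    indicator_vec n `[a, b[%classic = bvec n lo hi &
    `|(hi%:R - lo%:R) - n%:R * (b - a)| <= 1].
Proof.
move=> n0 a0 ab b1; have nR : 0 < n%:R :> R by rewrite ltr0n.
have na0 : 0 <= n%:R * a by rewrite mulr_ge0// ltW.
have nb0 : 0 < n%:R * b by rewrite mulr_gt0// (le_lt_trans a0).
have [ma [aE am ma1]] := nat_ceil na0; have [mb [bE bm mb1]] := nat_ceil (ltW nb0).
have mb0 : (0 < mb)%N by rewrite lt0n; apply: contraTneq bm => ->; rewrite -ltNge.
have mab : (ma <= mb)%N by rewrite aE (le_trans _ bm)// ler_pM2l// ltW.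
exists (maxn 1 ma), mb; split.
- by rewrite leq_max.
- by rewrite geq_max mb0.
- by rewrite ltnW// ltnS bE -[leRHS]mulr1 ler_pM2l.
- apply/matrixP => i j; rewrite !mxE indicE; congr (nat_of_bool _)%:R.
  rewrite geq_max ltn0Sn/= [(i.+1 < mb)%N]ltnNge bE aE -ltNge.
  apply/idP/idP => [|/andP[h1 h2]].
    rewrite inE/= in_itv/= => /andP[h1 h2].
    by rewrite mulrC -ler_pdivlMr// h1 mulrC -ltr_pdivrMr.
  by rewrite inE/= in_itv/= ler_pdivlMr// ltr_pdivrMr// mulrC h1 mulrC.
- rewrite mulrBr ler_norml.
  case: (posnP ma) => [m0|m0].
    have : n%:R * a = 0 by apply/eqP; rewrite eq_le na0 andbT; move: am; rewrite m0.
    by rewrite m0 maxn0 => ->; apply/andP; split; lra.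
  by rewrite (maxn_idPr m0); apply/andP; split; lra.
Qed.

Lemma dot_bvec n lo hi : (0 < lo)%N -> (lo <= hi)%N -> (hi <= n.+1)%N ->
  dot (bvec n lo hi) (bvec n lo hi) = hi%:R - lo%:R :> R.
Proof.
move=> lo0 lohi hin; rewrite dotE.
pose F (k : nat) : R := (lo <= k < hi)%N%:R.
rewrite (eq_bigr (fun j : 'I_n => F j.+1 * bvec n lo hi j 0)); last first.
  by move=> j _; rewrite mxE.
rewrite sum_bvec// (eq_big_nat _ _ (F2 := fun=> 1)); last first.
  by move=> k kl; rewrite /F kl.
by rewrite sumr_const_nat natrB.
Qed.

Lemma dot_indicator_ge n (a b : R) : (0 < n)%N -> 0 <= a -> a < b -> b <= 1 ->
  n%:R * (b - a) - 1 <= dot (indicator_vec n `[a, b[%classic) (indicator_vec n `[a, b[%classic).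
Proof.
move=> n0 a0 ab b1; have [lo [hi [h1 h2 h3 -> h5]]] := interval_block n0 a0 ab b1.
by rewrite dot_bvec//; move: h5; rewrite ler_norml; lra.
Qed.

Lemma dot_indicator_overlap n (a b a' b' : R) : a' <= a -> a < b' -> b' <= b ->
  dot (indicator_vec n `[a', b'[%classic) (indicator_vec n `[a, b[%classic) =
  dot (indicator_vec n `[a, b'[%classic) (indicator_vec n `[a, b'[%classic).
Proof.
move=> h1 h2 h3; rewrite !dotE; apply: eq_bigr => i _; rewrite !mxE !indicE !mem_setE.
rewrite -!natrM !mulnb; congr (nat_of_bool _)%:R; rewrite !in_itv/= andbb.
set x := _ / _; apply/idP/idP => [/andP[/andP[u1 u2] /andP[u3 u4]]|/andP[u1 u2]].
  by rewrite u3.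
by rewrite (le_trans h1 u1) u2 u1 (lt_le_trans u2 h3).
Qed.

Lemma dot_indicator_disjoint n (a b a' b' : R) : b' <= a ->
  dot (indicator_vec n `[a', b'[%classic) (indicator_vec n `[a, b[%classic) = 0.
Proof.
move=> h1; rewrite dotE big1// => i _; rewrite !mxE !indicE !mem_setE.
rewrite -natrM mulnb !in_itv/=; set x := _ / _.
case: (ltP x b') => xb; last by rewrite andbF.
by rewrite (leNgt a x) (lt_le_trans xb h1) andbF.
Qed.

End intervals.

Section interval_estimates.
Context {R : realType}.
Variables (gamma : int -> R) (f0 c : R).
Hypotheses (gamma_sym : forall h, gamma (- h) = gamma h)
  (gamma_total : has_total gamma f0) (f0_gt0 : 0 < f0) (c_gt0 : 0 < c)
  (toeplitz_ge : forall V, c * sqnorm V <= toeplitz gamma V).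

(** An interval contains [n] times its length many points up to an error of 1,
    which is absorbed in the constant of [block_estimates]. *)
Lemma interval_estimates : exists2 K : R, 0 < K & forall n (a b : R),
  (0 < n)%N -> 0 <= a -> a < b -> b <= 1 ->
  let x := indicator_vec n `[a, b[%classic in
  [/\ bform (toeplitz_mx gamma n) x x <= f0 * (n%:R * (b - a)) + K,
      `|bform (invmx (toeplitz_mx gamma n)) x x - n%:R * (b - a) / f0| <= K &
      forall a' b', 0 <= a' -> a' < b' -> b' <= 1 -> b <= a' \/ b' <= a ->
        bform (invmx (toeplitz_mx gamma n)) x (indicator_vec n `[a', b'[%classic) <= K].
Proof.
have [K K0 KP] := block_estimates gamma_sym gamma_total f0_gt0 c_gt0 toeplitz_ge.
have i0 : 0 < f0^-1 by rewrite invr_gt0.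
exists (K + f0 + f0^-1) => [|n a b n0 a0 ab b1 x]; first by rewrite !addr_gt0.
have [lo [hi [h1 h2 h3 xE h5]]] := interval_block n0 a0 ab b1.
have [k1 k2] := KP n lo hi lo hi h1 h2 h3 h1 h2 h3.
rewrite /x xE; move: k1 k2 h5; rewrite /= dot_bvec// => k1 k2 h5.
move: k1 k2; rewrite !ler_norml => /andP[k1 k1'] /andP[k2 k2'].
have /andP[m1 m2] : - f0 <= f0 * (hi%:R - lo%:R) - f0 * (n%:R * (b - a)) <= f0.
  by rewrite -ler_norml -mulrBr normrM gtr0_norm// ler_piMr// ltW.
have /andP[m3 m4] : - f0^-1 <= (hi%:R - lo%:R) / f0 - n%:R * (b - a) / f0 <= f0^-1.
  by rewrite -ler_norml -mulrBl normrM (gtr0_norm i0) ler_piMl// ltW.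
split; [lra|by apply/andP; split; lra|].
move=> a' b' a'0 ab' b'1 dis.
have [lo' [hi' [j1 j2 j3 yE j5]]] := interval_block n0 a'0 ab' b'1.
have [_ k3] := KP n lo hi lo' hi' h1 h2 h3 j1 j2 j3.
rewrite yE; move: k3; rewrite /= -xE -yE.
have -> : dot (indicator_vec n `[a, b[%classic) (indicator_vec n `[a', b'[%classic) = 0.
  by case: dis => ?; [rewrite dot_indicator_disjoint|rewrite dotC dot_indicator_disjoint].
rewrite mul0r subr0 ler_norml => /andP[_ k3]; lra.
Qed.

End interval_estimates.

(** * Limits along the sequence of experiments *)

Section limits.
Context {R : realType}.

Lemma near_limn_esup_le (u : nat -> \bar R) (a : \bar R) :
  (\forall n \near \oo, (u n <= a)%E) -> (limn_esup u <= a)%E.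
Proof.
move=> ua; apply: (@le_trans _ _ (ereal_sup (u @` [set n | (u n <= a)%E]))).
  by apply: ereal_inf_lbound; exists [set n | (u n <= a)%E].
by apply: ge_ereal_sup => _ [n /= una <-].
Qed.

Lemma limn_esup_lt_near (u : nat -> \bar R) (a b : \bar R) :
  (limn_esup u <= a)%E -> (a < b)%E -> \forall n \near \oo, (u n <= b)%E.
Proof.
move=> ua ab; have /ereal_inf_lt[_ [A FA <-] sA] := le_lt_trans ua ab.
apply: filterS FA => n An; apply: le_trans (ltW sA).
by apply: ereal_sup_ubound; exists n.
Qed.

Lemma near_limn_einf_ge (u : nat -> \bar R) (a : \bar R) :
  (\forall n \near \oo, (a <= u n)%E) -> (a <= limn_einf u)%E.
Proof.
move=> ua; rewrite /limn_einf leeNr; apply: near_limn_esup_le.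
by apply: filterS ua => n; rewrite leeN2.
Qed.

(** As [n * lambda n] is at least 1 eventually, [- ln (lambda n)] is at most
    [ln n], so that the comparisons with [ln n] turn into comparisons between
    [lambda n] and its own logarithm. *)
Lemma sparse_regime (lambda : nat -> R) :
  (forall n : nat, (0 < n)%N -> 0 < lambda n < 1) ->
  (fun n : nat => n%:R * lambda n / ln n%:R) @ \oo --> +oo ->
  lambda =o_\oo (fun n : nat => (ln n%:R)^-1) ->
  forall M : R, \forall n \near \oo, [/\ (0 < n)%N, M <= - ln (lambda n),
    M <= n%:R * lambda n & M * - ln (lambda n) <= n%:R * lambda n].
Proof.
move=> l01 lo up M.
pose M' := Num.max 1 M; have M1 : 1 <= M' by rewrite le_max lexx.
have MM : M <= M' by rewrite le_max lexx orbT.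
have e0 : 0 < expR (- M') by exact: expR_gt0.
move/eqoP: up => /(_ (expR (- M')) e0) up.
move/cvgryPge: lo => /(_ M') lo.
have ne : \forall n \near \oo, expR 1 <= n%:R :> R by exact: nbhs_infty_ger.
near=> n.
have n0 : (0 < n)%N by near: n; exact: nbhs_infty_gt.
have /andP[l0 l1] := l01 n n0.
have nR : 0 < n%:R :> R by rewrite ltr0n.
have ln1 : 1 <= ln n%:R :> R.
  rewrite -[leLHS]expRK ler_ln ?posrE ?expR_gt0//.
  by near: n.
have h1 : M' <= n%:R * lambda n / ln n%:R by near: n.
have h2 : `|lambda n| <= expR (- M') * `|(ln n%:R)^-1| by near: n.
have ln0 : 0 < ln n%:R :> R by apply: lt_le_trans ln1.
have X1 : M' * ln n%:R <= n%:R * lambda n by rewrite -ler_pdivlMr.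
have X2 : 1 <= n%:R * lambda n.
  by apply: le_trans X1; rewrite -[leLHS]mulr1 ler_pM.
have Lln : - ln (lambda n) <= ln n%:R.
  by rewrite -lnV ?posrE// ler_ln ?posrE ?invr_gt0// -[leLHS]mul1r ler_pdivrMr.
split => //.
- rewrite lerNr (le_trans _ (_ : - M' <= - M)) ?lerN2//.
  rewrite -(expRK (- M')) ler_ln ?posrE//.
  move: h2; rewrite !gtr0_norm ?invr_gt0// => h2; apply: (le_trans h2).
  by rewrite ler_piMr ?expR_ge0// invf_le1.
- apply: (le_trans MM); apply: le_trans X1.
  by rewrite ler_peMr// (le_trans ler01).
- have L0 : 0 <= - ln (lambda n) by rewrite oppr_ge0 ltW// ln_lt0 ?l0.
  apply: le_trans X1; apply: (@le_trans _ _ (M' * - ln (lambda n))).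
    by rewrite ler_wpM2r.
  by rewrite ler_wpM2l// (le_trans ler01).
Unshelve. all: by end_near. Qed.

End limits.

(** * Tests and their errors *)

Section scan.
Context {R : realType}.

Lemma ex_scan_test n M (v : 'I_M -> 'cV[R]_n) (t : R) :
  exists Phi : @test R n, forall y : n.-tuple R, Phi y = [exists k, t <= `|dotp (v k) y|].
Proof.
pose f (y : n.-tuple R) := [exists k, t <= `|dotp (v k) y|].
have mf : measurable_fun setT f.
  apply: (measurable_fun_bool true); rewrite setTI.
  rewrite (_ : f @^-1` _ = \bigcup_(k in [set: 'I_M]) [set y | t <= `|dotp (v k) y|]).
    apply: fin_bigcup_measurable => // k _.
    rewrite -[X in measurable X]setTI.
    apply: measurable_fun_le => //; apply: measurableT_comp => //.
    exact: measurable_dotp.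
  apply/seteqP; split => [y /= /existsP[k tk]|y /= [k _ tk]]; first by exists k.
  by apply/existsP; exists k.
pose H := isMeasurableFun.Build _ _ _ _ f mf.
by exists (HB.pack_for (@test R n) f H).
Qed.

Lemma test_measurable n (Phi : @test R n) b : measurable [set y | Phi y = b].
Proof.
rewrite (_ : [set y | _] = setT `&` Phi @^-1` [set b]); first exact: measurable_funP.
by rewrite setTI.
Qed.

Lemma type2_le n (Phi : @test R n) (S : 'M[R]_n) (D l : R) (b : \bar R) :
  (forall a delta : R, 0 <= a -> a + l <= 1 -> D <= `|delta| ->
    (multinormal (delta *: indicator_vec n `[a, (a + l)%R[%classic) S
       [set y | Phi y = false] <= b)%E) ->
  0 < l -> (type2_error Phi S D l <= b)%E.
Proof.
move=> H l0; apply: ge_ereal_sup => _ [I [a [a' [a0 aa' a1 al ->]]] <-].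
apply: ge_ereal_sup => _ [delta /= Dd <-].
have -> : a' = a + l by rewrite -al addrC subrK.
by apply: H => //; rewrite -al addrC subrK.
Qed.

Lemma type2_ge n (Phi : @test R n) (S : 'M[R]_n) (D l a delta : R) :
  0 < l -> 0 <= a -> a + l <= 1 -> D <= `|delta| ->
  (multinormal (delta *: indicator_vec n `[a, (a + l)%R[%classic) S [set y | Phi y = false]
   <= type2_error Phi S D l)%E.
Proof.
move=> l0 a0 al Dd; apply: (@le_trans _ _ (ereal_sup [set
  multinormal (delta *: indicator_vec n `[a, (a + l)%R[%classic) S [set y | Phi y = false]
      | delta in [set delta : R | D <= `|delta|]])).
  by apply: ereal_sup_ubound; exists delta.
apply: ereal_sup_ubound; exists (`[a, (a + l)%R[%classic) => //.
by exists a, (a + l); split => //; [rewrite ltrDl|rewrite addrC addKr].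
Qed.

Lemma type2_antitone n (Phi : @test R n) (S : 'M[R]_n) (D D' l : R) : D <= D' ->
  (type2_error Phi S D' l <= type2_error Phi S D l)%E.
Proof.
move=> DD; apply: ge_ereal_sup => _ [I Il <-].
apply: (@le_trans _ _ (ereal_sup [set
  multinormal (delta *: indicator_vec n I) S [set y | Phi y = false]
      | delta in [set delta : R | D <= `|delta|]])).
  apply: le_ereal_sup => _ [delta /= Dd <-]; exists delta => //=.
  exact: le_trans Dd.
by apply: ereal_sup_ubound; exists I.
Qed.

End scan.

(** * The scan test *)

Section scan_bounds.
Context {R : realType}.
Variables (n : nat) (S : 'M[R]_n) (l s V : R).
Hypotheses (n0 : (0 < n)%N) (Spd : posdef S) (l0 : 0 < l) (l1 : l < 1)
  (s1 : 1 <= s) (lE : l = expR (- s ^+ 2)) (V0 : 0 < V).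
Hypothesis window_le : forall a : R, 0 <= a -> a + l <= 1 ->
  bform S (indicator_vec n `[a, (a + l)[%classic) (indicator_vec n `[a, (a + l)[%classic) <= V.

Definition scan_size : nat := (Num.trunc (s / l)).+1.

(** The last starting points are moved back so that every window lies in [0, 1]. *)
Definition scan_start (k : 'I_scan_size) : R := Num.min (k%:R * (l / s)) (1 - l).

Definition scan_window (k : 'I_scan_size) : 'cV[R]_n :=
  indicator_vec n `[scan_start k, (scan_start k + l)[%classic.

Variable Phi : @test R n.
Hypothesis PhiE : forall y, Phi y =
  [exists k, Num.sqrt (2 * V) * (s + 1) <= `|dotp (scan_window k) y|].

Let s0 : 0 < s. Proof. exact: lt_le_trans s1. Qed.

Let scan_start_itv k : 0 <= scan_start k /\ scan_start k + l <= 1.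
Proof.
split; first by rewrite le_min mulr_ge0 ?divr_ge0 ?subr_ge0// ltW.
by rewrite -lerBrDr ge_min lexx orbT.
Qed.

Let scan_window_le k : bform S (scan_window k) (scan_window k) <= V.
Proof. by have [? ?] := scan_start_itv k; exact: window_le. Qed.

Let w0 : 0 < Num.sqrt (2 * V). Proof. by rewrite sqrtr_gt0 mulr_gt0. Qed.

Let w2 : Num.sqrt (2 * V) ^+ 2 = 2 * V.
Proof. by rewrite sqr_sqrtr// mulr_ge0// ltW. Qed.

(** There are about s / l windows, each crossing the threshold with probability
    at most exp (- (s + 1)^2) = l exp (- 2 s - 1). *)
Lemma scan_type1 : (type1_error Phi S <= (2 * (2 / (1 + s)))%:E)%E.
Proof.
have t0 : 0 <= Num.sqrt (2 * V) * (s + 1) by rewrite mulr_ge0// addr_ge0// ltW.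
have := multinormal_scan_tail Spd V0 t0 scan_window_le (@test_measurable _ n Phi true).
have sub : [set y | Phi y = true] `<=`
    [set y | exists k, Num.sqrt (2 * V) * (s + 1) <= `|dotp (scan_window k) y|].
  by move=> y /=; rewrite PhiE => /existsP.
move=> /(_ sub) H; apply: (le_trans H); rewrite lee_fin.
rewrite exprMn w2 (_ : - (2 * V * (s + 1) ^+ 2) / (2 * V) = - s ^+ 2 - (2 * s + 1)); last first.
  by field; rewrite gt_eqF.
rewrite expRD -lE /scan_size natrM -mulrA ler_pM2l//.
have Ml : (Num.trunc (s / l)).+1%:R <= s / l + 1.
  by rewrite -natr1 lerD2r truncn_le divr_ge0 ?ltW.
have e1 : (1 + s) ^+ 2 * expR (- (2 * s + 1)) <= 1.
  rewrite expRN ler_pdivrMr ?expR_gt0// mul1r.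
  rewrite (_ : 2 * s + 1 = s + (s + 1)) ?expRD; last by ring.
  have p0 : 0 <= 1 + s by rewrite addr_ge0// ltW.
  rewrite expr2; apply: ler_pM => //; first exact: expR_ge1Dx.
  by rewrite -expRD; apply: le_trans (expR_ge1Dx _); rewrite addrA lerDl.
have e0 : 0 < expR (- (2 * s + 1)) by exact: expR_gt0.
apply: (@le_trans _ _ ((s / l + 1) * (l * expR (- (2 * s + 1))))).
  by rewrite ler_wpM2r// mulr_ge0// ltW.
have -> : (s / l + 1) * (l * expR (- (2 * s + 1))) = (s + l) * expR (- (2 * s + 1)).
  by field; rewrite gt_eqF.
apply: (@le_trans _ _ ((1 + s) * expR (- (2 * s + 1)))).
  by rewrite ler_pM2r// addrC lerD2r ltW.
rewrite ler_pdivlMr ?addr_gt0//.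
have := e1; rewrite expr2; lra.
Qed.

Variables (f0 K c d : R).
Hypotheses (f0_gt0 : 0 < f0) (K0 : 0 < K) (VE : V = f0 * (n%:R * l) + K)
  (d0 : 0 < d) (cE : c = 1 + 2 * d) (s_large : 2 * (c + 1) <= d * s)
  (X_large : 2 * (c + K / f0 * (2 + d)) <= d * (n%:R * l)).

Let X := n%:R * l.
Let X0 : 0 < X. Proof. by rewrite mulr_gt0// ltr0n. Qed.

(** Some window starts at most l / s before the signal interval, so that it
    catches all but a fraction 1 / s of the signal. *)
Lemma scan_overlap (a : R) : 0 <= a -> a + l <= 1 ->
  exists k, X * (1 - s^-1) - 1 <=
    dot (scan_window k) (indicator_vec n `[a, (a + l)[%classic).
Proof.
move=> a0 al; have h0 : 0 < l / s by rewrite divr_gt0.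
pose m := Num.trunc (a / (l / s)).
have a1 : a <= 1 by rewrite (le_trans _ al)// lerDl ltW.
have m_lt : (m < scan_size)%N.
  rewrite ltnS; apply: le_truncn; rewrite ler_pdivrMr// mulrA divfK ?gt_eqF//.
  by rewrite divff ?gt_eqF.
have ah : 0 <= a / (l / s) by rewrite divr_ge0// ltW.
have m1 : m%:R * (l / s) <= a :> R by rewrite -ler_pdivlMr// truncn_le.
have m2 : a < m%:R * (l / s) + l / s :> R.
  by have := truncnS_gt (a / (l / s)); rewrite ltr_pdivrMr// -natr1 mulrDl mul1r.
have hl : l / s <= l by rewrite ler_pdivrMr// ler_peMr// ltW.
exists (Ordinal m_lt); rewrite /scan_window /scan_start/=.
rewrite (min_idPl _); last by rewrite lerBrDr (le_trans _ al)// lerD2r.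
have [al' lb] : a < m%:R * (l / s) + l /\ m%:R * (l / s) + l <= a + l by split; lra.
rewrite dot_indicator_overlap//.
apply: le_trans (dot_indicator_ge n0 a0 al' _); last by lra.
rewrite lerD2r /X mulrBr mulr1 -mulrA -mulrBr ler_pM2l ?ltr0n//; lra.
Qed.

(** Of the surplus c - 1 = 2 d of the signal, one half pays for the imperfect
    overlap, the end effects [K] and the summand 1 of the threshold; the other
    half puts the mean of the window statistic [d * s] times [sqrt (2 V)] above
    the threshold. *)
Lemma scan_type2 : (type2_error Phi S
  (c * Num.sqrt (2 * f0 * s ^+ 2 / X)) l <= (expR (- (d * s) ^+ 2))%:E)%E.
Proof.
have [f0p Kp dp cE' sl] := And5 f0_gt0 K0 d0 cE s_large.
apply: type2_le => // a delta a0 al Dd.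
have [k kX] := scan_overlap a0 al.
set x := indicator_vec n _ in kX *; set v := scan_window k in kX.
set t := Num.sqrt (2 * V) * (s + 1).
pose u := (if 0 <= delta then 1 else -1 : R) *: v.
have uV : bform S u u <= V.
  rewrite /u bformZl bformZr; case: ifP => _; rewrite ?mul1r ?mulN1r ?opprK;
  exact: scan_window_le.
have ux : dot u (delta *: x) = `|delta| * dot v x.
  rewrite /u dotZl dotC dotZl [dot x v]dotC; case: ler0P => dl.
    by move: dl; rewrite le_eqVlt => /orP[/eqP ->|dl]; rewrite ?lexx ?leNgt ?dl/=; ring.
  by rewrite (ltW dl) mul1r.
have sub : [set y | Phi y = false] `<=` [set y | dotp u y <= t].
  move=> y /=; rewrite PhiE => /negbT; rewrite negb_exists => /forallP/(_ k).
  rewrite -ltNge -/t -/v => H; apply: ltW; apply: le_lt_trans H.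
  rewrite /u dotpZ; case: ifP => _; first by rewrite mul1r ler_norm.
  by rewrite mulN1r ler_normr lexx orbT.
have w_le : Num.sqrt (2 * V) <= Num.sqrt (2 * f0 * X) * (1 + K / f0 / X).
  have wX0 : 0 <= Num.sqrt (2 * f0 * X) * (1 + K / f0 / X).
    by rewrite mulr_ge0// addr_ge0// !divr_ge0// ltW.
  rewrite -(ler_sqr (x := Num.sqrt (2 * V))) ?nnegrE// w2 exprMn sqr_sqrtr; last first.
    by rewrite !mulr_ge0// ltW.
  have v0 : 0 <= K / f0 / X by rewrite !divr_ge0// ltW.
  have -> : 2 * V = 2 * f0 * X * (1 + K / f0 / X).
    by rewrite VE -/X; field; rewrite !gt_eqF.
  rewrite ler_pM2l; last by rewrite mulr_gt0// mulr_gt0.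
  have v1 : 1 <= 1 + K / f0 / X by rewrite lerDl.
  by rewrite expr2 ler_peMl// (le_trans ler01).
have phiE : Num.sqrt (2 * f0 * s ^+ 2 / X) = s * Num.sqrt (2 * f0 * X) / X.
  have -> : 2 * f0 * s ^+ 2 / X = (s / X) ^+ 2 * (2 * f0 * X) by field; rewrite gt_eqF.
  rewrite sqrtrM ?sqr_ge0// sqrtr_sqr ger0_norm; last by rewrite divr_ge0// ltW.
  by rewrite mulrAC.
set w := Num.sqrt (2 * f0 * X) in w_le phiE.
have wp : 0 < w by rewrite sqrtr_gt0 mulr_gt0// mulr_gt0.
have s4 : 4 <= s by rewrite -(ler_pM2l d0); move: s_large; rewrite cE; lra.
have kap : 0 <= K / f0 by rewrite divr_ge0// ltW.
have X4 : 4 <= X.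
  rewrite -(ler_pM2l d0); apply: le_trans X_large; rewrite cE.
  have : 0 <= K / f0 * (2 + d) by rewrite mulr_ge0// addr_ge0// ltW.
  lra.
have si : s^-1 <= 4^-1 by rewrite lef_pV2 ?posrE.
have g0 : 0 <= X * (1 - s^-1) - 1 by nra.
have main : t + Num.sqrt (2 * V) * (d * s) <= dot u (delta *: x).
  rewrite ux; apply: (@le_trans _ _ (c * (s * w / X) * (X * (1 - s^-1) - 1))); last first.
    apply: ler_pM => //; last by rewrite -phiE.
    by rewrite !mulr_ge0// ?invr_ge0 ltW// cE; lra.
  have -> : c * (s * w / X) * (X * (1 - s^-1) - 1) = w * (c * s - c - c * s / X).
    by field; rewrite !gt_eqF.
  rewrite /t -mulrDr; apply: (@le_trans _ _ (w * (1 + K / f0 / X) * (s + 1 + d * s))).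
    by rewrite ler_wpM2r// !addr_ge0// ?mulr_ge0 ?ltW.
  rewrite -mulrA ler_pM2l//.
  have vb : (c * s + K / f0 * ((1 + d) * s + 1)) / X <= d * s / 2.
    rewrite ler_pdivrMr//; apply: (@le_trans _ _ (s * (c + K / f0 * (2 + d)))).
      rewrite [leRHS](_ : _ = c * s + K / f0 * ((2 + d) * s)); last by ring.
      by rewrite lerD2l ler_wpM2l//; lra.
    have := ler_wpM2l (ltW s0) X_large; rewrite -/X; lra.
  have -> : (1 + K / f0 / X) * (s + 1 + d * s) =
      (1 + d) * s + 1 + K / f0 * ((1 + d) * s + 1) / X by field; rewrite !gt_eqF.
  have e3 : (c * s + K / f0 * ((1 + d) * s + 1)) / X =
      c * s / X + K / f0 * ((1 + d) * s + 1) / X by rewrite mulrDl.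
  rewrite e3 in vb; have cs : c * s = s + 2 * (d * s) by rewrite cE; ring.
  rewrite cs in vb *; lra.
have ds0 : 0 <= d * s by rewrite mulr_ge0// ltW.
have wd0 : 0 <= Num.sqrt (2 * V) * (d * s) by rewrite mulr_ge0.
have tm : t <= dot u (delta *: x) by lra.
apply: (le_trans (multinormal_lower_tail Spd V0 uV tm (@test_measurable _ n Phi false) sub)).
rewrite lee_fin ler_expR mulNr lerN2 ler_pdivlMr ?mulr_gt0// -w2 -exprMn.
rewrite lerXn2r ?nnegrE; lra.
Qed.

End scan_bounds.

(** * The detection boundary *)

Section boundary.
Context {R : realType}.

(** The prior is uniform on [N], about 1 / l, consecutive intervals. For a signal
    of relative strength c the log-likelihood statistic has mean and variance
    close to 2 c^2 s^2 under its own alternative; it is truncated at 2 c s^2,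
    which is (1 - c) s sqrt 2 standard deviations above that mean. *)
Lemma mixture_type2 n (S : 'M[R]_n) (l s K f0 c eta : R) (Phi : @test R n) :
  (0 < n)%N -> posdef S -> 0 < l -> l <= 2^-1 -> l = expR (- s ^+ 2) ->
  0 < f0 -> 0 < K -> 3 / 4 <= c -> c < 1 -> 0 < eta ->
  let X := n%:R * l in
  let D := c * Num.sqrt (2 * f0 * s ^+ 2 / X) in
  let e := D ^+ 2 * K in
  (forall a b : R, 0 <= a -> a < b -> b <= 1 -> b - a = l ->
    let x := indicator_vec n `[a, b[%classic in
    `|bform (invmx S) x x - X / f0| <= K /\
    forall a' b', 0 <= a' -> a' < b' -> b' <= 1 -> b <= a' \/ b' <= a ->
        bform (invmx S) x (indicator_vec n `[a', b'[%classic) <= K) ->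
  (multinormal 0 S [set y | Phi y = false] <= type2_error Phi S D l +
    (eta + (4 * eta)^-1 * (2 * expR (e - 2 * ((1 - c) * s) ^+ 2) + (expR e - 1) +
       2 * expR (e - ((1 - c) * s) ^+ 2)))%:E)%E.
Proof.
move=> n0 Spd l0 l2 lE f00 K0 c34 c1 eta0 X D e est.
have c0 : 0 < c by lra.
have X0 : 0 < X by rewrite mulr_gt0// ltr0n.
have D0 : 0 <= D by rewrite mulr_ge0// ltW.
have e0 : 0 <= e by rewrite mulr_ge0 ?sqr_ge0// ltW.
have D2 : D ^+ 2 = 2 * c ^+ 2 * f0 * s ^+ 2 / X.
  have r0 : 0 <= 2 * f0 * s ^+ 2 / X.
    by rewrite divr_ge0 ?(ltW X0)// mulr_ge0 ?sqr_ge0// mulr_ge0// ltW.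
  by rewrite exprMn sqr_sqrtr//; field; rewrite gt_eqF.
have DX : D ^+ 2 * (X / f0) = 2 * c ^+ 2 * s ^+ 2.
  by rewrite D2; field; rewrite !gt_eqF.
pose N := Num.trunc l^-1.
have li : 2 <= l^-1 by rewrite -[leLHS]invrK lef_pV2 ?posrE ?invr_gt0.
have li0 : 0 <= l^-1 by rewrite invr_ge0 ltW.
have N0 : (0 < N)%N by rewrite truncn_gt0; apply: le_trans li; rewrite ler1n.
have Nl : N%:R * l <= 1 :> R by rewrite -ler_pdivlMr// mul1r truncn_le.
have NR : 0 < N%:R :> R by rewrite ltr0n.
have Ni : N%:R^-1 <= 2 * l :> R.
  have NS : l^-1 < N%:R + 1 :> R by rewrite natr1; exact: truncnS_gt.
  have : (2 * l)^-1 <= N%:R.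
    by rewrite invfM; have := li; lra.
  by move=> H; rewrite -[leRHS]invrK lef_pV2 ?posrE// invr_gt0 mulr_gt0.
pose a (k : 'I_N) : R := k%:R * l.
have a0 k : 0 <= a k by rewrite mulr_ge0// ltW.
have al k : a k + l <= 1.
  apply: le_trans Nl; rewrite /a -[X in _ + X]mul1r -mulrDl ler_pM2r//.
  by rewrite natr1 ler_nat.
have aal k : a k < a k + l by rewrite ltrDl.
pose mu k : 'cV[R]_n := D *: indicator_vec n `[a k, (a k + l)[%classic.
have diag k : `|bform (invmx S) (mu k) (mu k) - 2 * c ^+ 2 * s ^+ 2| <= e.
  have [|H _] := est (a k) (a k + l) (a0 k) (aal k) (al k); first by rewrite addrC addKr.
  rewrite /mu bformZl bformZr mulrA -expr2 -DX -mulrBr normrM.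
  by rewrite (ger0_norm (sqr_ge0 _)) ler_wpM2l// sqr_ge0.
have off k k' : k != k' -> bform (invmx S) (mu k) (mu k') <= e.
  move=> kk; have [|_ H] := est (a k) (a k + l) (a0 k) (aal k) (al k).
    by rewrite addrC addKr.
  rewrite /mu bformZl bformZr mulrA -expr2 ler_wpM2l ?sqr_ge0//; apply: H => //.
  have step (i j : 'I_N) : (i < j)%N -> a i + l <= a j.
    by move=> ij; rewrite /a -[X in _ + X]mul1r -mulrDl ler_pM2r// natr1 ler_nat.
  move: kk; rewrite neq_ltn => /orP[]; [left|right]; exact: step.
pose T := 2 * c * s ^+ 2.
pose q1 := s ^+ 2 - 2 * ((1 - c) * s) ^+ 2 + e.
pose q2 := e - ((1 - c) * s) ^+ 2.
(* the exponents minimizing the bounds [second] and [tail] *)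
pose u := 2 - c^-1; pose v := c^-1 - 1.
have ci : c^-1 <= 4 / 3 by rewrite -[leRHS]invrK lef_pV2 ?posrE ?invr_gt0//; lra.
have ci1 : 1 <= c^-1 by rewrite -[leLHS]invr1 lef_pV2 ?posrE// ltW.
have uE : 2 - u = c^-1 by rewrite /u opprB addrC subrK.
have vE : 1 + v = c^-1 by rewrite /v addrC subrK.
have u0 : 0 <= u by rewrite /u; lra.
have v0 : 0 <= v by rewrite /v; lra.
have lem (b A k : R) : - 1 <= k -> k <= 1 -> `|b - A| <= e -> b * k <= A * k + e.
  move=> k1 k2 bA; rewrite -lerBlDl -mulrBl; apply: (le_trans (ler_norm _)).
  rewrite normrM -[leRHS]mulr1; apply: ler_pM => //.
  by rewrite ler_norml k1.
have second k : (2 - u) ^+ 2 * bform (invmx S) (mu k) (mu k) / 2 -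
    bform (invmx S) (mu k) (mu k) + u * T <= q1.
  have k1 : - 1 <= (2 - u) ^+ 2 / 2 - 1 by have := sqr_ge0 (2 - u); lra.
  have k2 : (2 - u) ^+ 2 / 2 - 1 <= 1.
    rewrite uE; have : c^-1 ^+ 2 <= (4 / 3) ^+ 2.
      by rewrite lerXn2r ?nnegrE//; lra.
    rewrite !expr2; lra.
  have := lem _ _ _ k1 k2 (diag k).
  rewrite (_ : 2 * c ^+ 2 * s ^+ 2 * ((2 - u) ^+ 2 / 2 - 1) + e = q1 - u * T); last first.
    by rewrite /q1 /u /T; field; rewrite gt_eqF.
  rewrite mulrBr mulr1 mulrA [_ * (2 - u) ^+ 2]mulrC; lra.
have tail k : (1 + v) ^+ 2 * bform (invmx S) (mu k) (mu k) / 2 -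
    bform (invmx S) (mu k) (mu k) / 2 - v * T <= q2.
  have k1 : - 1 <= ((1 + v) ^+ 2 - 1) / 2 by have := sqr_ge0 (1 + v); lra.
  have k2 : ((1 + v) ^+ 2 - 1) / 2 <= 1.
    rewrite vE; have : c^-1 ^+ 2 <= (4 / 3) ^+ 2.
      by rewrite lerXn2r ?nnegrE//; lra.
    rewrite !expr2; lra.
  have := lem _ _ _ k1 k2 (diag k).
  rewrite (_ : 2 * c ^+ 2 * s ^+ 2 * (((1 + v) ^+ 2 - 1) / 2) + e = q2 + v * T); last first.
    by rewrite /q2 /v /T; field; rewrite gt_eqF.
  rewrite mulrA mulrBr mulr1 mulrBl [_ * (1 + v) ^+ 2]mulrC; lra.
have Bb k : (multinormal (mu k) S [set y | Phi y = false] <= type2_error Phi S D l)%E.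
  by apply: type2_ge => //; rewrite ger0_norm.
have := mixture_bound Spd N0 u0 v0 off second tail
  (@test_measurable _ n Phi false) eta0 Bb.
move=> H; apply: (le_trans H); rewrite leeD2l// lee_fin lerD2l ler_wpM2l//.
  by rewrite invr_ge0 mulr_ge0// ltW.
rewrite -!addrA lerD2r.
apply: (@le_trans _ _ (2 * l * expR q1)); first by rewrite ler_wpM2r ?expR_ge0.
rewrite lE -mulrA -expRD ler_pM2l// ler_expR /q1; lra.
Qed.

Lemma expR_half_le (e : R) : 0 <= e -> e <= 2^-1 -> expR e <= 2 /\ expR e - 1 <= 2 * e.
Proof.
move=> e0 e2; have := expR_ge1Dx (- e); rewrite expRN => H.
have E0 := expR_gt0 e.
have : (1 - e) * expR e <= 1 by rewrite -ler_pdivlMr// mul1r.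
have : 2^-1 * expR e <= (1 - e) * expR e by rewrite ler_pM2r//; lra.
move=> h1 h2; have E2 : expR e <= 2 by lra.
split => //; have : e * expR e <= e * 2 by rewrite ler_wpM2l.
lra.
Qed.

Lemma expRN_le (x : R) : 0 < x -> expR (- x) <= x^-1.
Proof.
move=> x0; rewrite expRN lef_pV2 ?posrE ?expR_gt0//.
by have := expR_ge1Dx x; lra.
Qed.

Lemma multinormal_test n (S : 'M[R]_n) (mu : 'cV[R]_n) (Phi : @test R n) : posdef S ->
  (multinormal mu S [set y | Phi y = true] + multinormal mu S [set y | Phi y = false] = 1)%E.
Proof.
move=> Spd; have mT := test_measurable Phi true; have mF := test_measurable Phi false.
rewrite (multinormalE mu S mT) (multinormalE mu S mF) -gexpD//.
rewrite -(gexp1 mu Spd); congr gexp; apply: funext => y; rewrite !indicE.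
rewrite (_ : (y \in [set y | Phi y = true]) = Phi y); last first.
  by apply/idP/idP; rewrite inE.
rewrite (_ : (y \in [set y | Phi y = false]) = ~~ Phi y); last first.
  by apply/idP/idP; rewrite inE/=; [move=> ->|move=> /negbTE].
by case: (Phi y); rewrite ?addr0 ?add0r.
Qed.

Variables (gamma : int -> R) (f0 cmin : R) (lambda : nat -> R).
Hypotheses (gamma_sym : forall h, gamma (- h) = gamma h)
  (gamma_total : has_total gamma f0) (f0_gt0 : 0 < f0) (cmin_gt0 : 0 < cmin)
  (toeplitz_ge : forall V, cmin * sqnorm V <= toeplitz gamma V).
Hypothesis lambda01 : forall n : nat, (0 < n)%N -> 0 < lambda n < 1.
Hypothesis regime : forall M : R, \forall n \near \oo, [/\ (0 < n)%N,
  M <= - ln (lambda n), M <= n%:R * lambda n &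
  M * - ln (lambda n) <= n%:R * lambda n].

Let rate n := Num.sqrt (- 2 * f0 * ln (lambda n) / (n%:R * lambda n)).
Let s n := Num.sqrt (- ln (lambda n)).
Let S n := toeplitz_mx gamma n.
Let Spd n : posdef (S n).
Proof. exact: posdef_toeplitz_mx gamma_sym f0_gt0 cmin_gt0 toeplitz_ge n. Qed.

Let near_s (M : R) : \forall n \near \oo, [/\ (0 < n)%N, M <= s n & M <= n%:R * lambda n].
Proof.
pose M' := Num.max 1 M; have M1 : 1 <= M' by rewrite le_max lexx.
have MM : M <= M' by rewrite le_max lexx orbT.
have := regime (M' ^+ 2); apply: filterS => n [n0 h1 h2 _]; split => //.
  apply: (le_trans MM); rewrite -[leLHS]ger0_norm; last by lra.
  by rewrite -sqrtr_sqr ler_wsqrtr.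
apply: (le_trans MM); apply: le_trans h2; rewrite expr2 ler_peMl//; lra.
Qed.

Let s_sqr n : (0 < n)%N -> s n ^+ 2 = - ln (lambda n).
Proof.
move=> n0; have /andP[h0 h1] := lambda01 n0.
by rewrite sqr_sqrtr// oppr_ge0 ltW// ln_lt0// h0.
Qed.

Let lambdaE n : (0 < n)%N -> lambda n = expR (- s n ^+ 2).
Proof.
by move=> n0; have /andP[h0 _] := lambda01 n0; rewrite s_sqr// opprK lnK.
Qed.

Let rateE n : (0 < n)%N -> rate n = Num.sqrt (2 * f0 * s n ^+ 2 / (n%:R * lambda n)).
Proof. by move=> n0; rewrite /rate s_sqr//; congr Num.sqrt; congr (_ / _); ring. Qed.

(** The threshold sqrt (2 V) (s + 1) does not involve [c], so that one sequence of
    scan tests serves all [c > 1]; its type I and type II errors even vanish. *)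
Lemma upper_boundary (alpha : R) : 0 < alpha -> upper_detection_bound S lambda rate alpha.
Proof.
move=> alpha0.
have [K K0 est] := interval_estimates gamma_sym gamma_total f0_gt0 cmin_gt0 toeplitz_ge.
pose V n := f0 * (n%:R * lambda n) + K.
pose Phi n := projT1 (cid (ex_scan_test (@scan_window R n (lambda n) (s n))
  (Num.sqrt (2 * V n) * (s n + 1)))).
have PhiE n y : Phi n y = [exists k, Num.sqrt (2 * V n) * (s n + 1) <=
    `|dotp (@scan_window R n (lambda n) (s n) k) y|].
  by rewrite /Phi; case: cid => Psi /= ->.
have V0 n : (0 < n)%N -> 0 < V n.
  move=> n0; have /andP[h0 _] := lambda01 n0.
  by rewrite addr_gt0// mulr_gt0// mulr_gt0// ltr0n.
have win n : (0 < n)%N -> forall a : R, 0 <= a -> a + lambda n <= 1 ->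
    bform (S n) (indicator_vec n `[a, (a + lambda n)[%classic)
      (indicator_vec n `[a, (a + lambda n)[%classic) <= V n.
  move=> n0 a a0 al; have /andP[h0 _] := lambda01 n0.
  have aal : a < a + lambda n by rewrite ltrDl.
  have [+ _ _] := est n a (a + lambda n) n0 a0 aal al.
  by rewrite (addrAC a) subrr add0r.
exists Phi.
  apply: near_limn_esup_le; have := near_s (Num.max 1 (4 / alpha)).
  apply: filterS => n [n0 sn _]; have /andP[h0 h1] := lambda01 n0.
  have [s1 s2] : 1 <= s n /\ 4 / alpha <= s n.
    by move: sn; rewrite ge_max => /andP[].
  apply: (le_trans (scan_type1 (Spd n) h0 h1 s1 (lambdaE n0) (V0 n n0) (win n n0) (PhiE n))).
  rewrite lee_fin mulrA ler_pdivrMr; last by lra.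
  by move: s2; rewrite ler_pdivrMr//; lra.
move=> c c1; pose d := (c - 1) / 2; have d0 : 0 < d by rewrite divr_gt0// subr_gt0.
have cE : c = 1 + 2 * d by rewrite /d; field.
apply: near_limn_esup_le.
pose M1 := Num.max (2 * (c + 1) / d) ((1 + alpha^-1) / d).
pose M2 := 2 * (c + K / f0 * (2 + d)) / d.
have := near_s (Num.max 1 (Num.max M1 M2)); apply: filterS => n [n0 sn Xn].
have /andP[h0 h1] := lambda01 n0.
move: sn; rewrite 3!ge_max => /andP[s1 /andP[/andP[s2 s3] _]].
move: Xn; rewrite 2!ge_max => /andP[_ /andP[_ X2]].
have sl : 2 * (c + 1) <= d * s n by rewrite -ler_pdivrMl// mulrC.
have Xl : 2 * (c + K / f0 * (2 + d)) <= d * (n%:R * lambda n).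
  by rewrite -ler_pdivrMl// mulrC.
rewrite rateE//.
apply: (le_trans (scan_type2 n0 (Spd n) h0 h1 s1 (V0 n n0) (win n n0) (PhiE n)
  f0_gt0 K0 (erefl (V n)) d0 cE sl Xl)).
have ds : 1 + alpha^-1 <= d * s n by rewrite -ler_pdivrMl// mulrC.
have ai : 0 < alpha^-1 by rewrite invr_gt0.
have dsq : alpha^-1 <= (d * s n) ^+ 2 by rewrite expr2; nra.
have dsq0 : 0 < (d * s n) ^+ 2 by apply: lt_le_trans dsq.
rewrite lee_fin (le_trans (expRN_le dsq0))// -[leRHS]invrK lef_pV2 ?posrE//.
Qed.

(** The type II error decreases with the strength of the signal, so [c] may be
    replaced by a larger [c' < 1]; [mixture_type2] wants at least 3 / 4. *)
Lemma lower_boundary (alpha : R) : lower_detection_bound S lambda rate alpha.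
Proof.
move=> c /andP[c0 c1] Phi level.
have [K K0 est] := interval_estimates gamma_sym gamma_total f0_gt0 cmin_gt0 toeplitz_ge.
pose c' := Num.max c (3 / 4).
have cc' : c <= c' by rewrite le_max lexx.
have c'34 : 3 / 4 <= c' by rewrite le_max lexx orbT.
have c'1 : c' < 1 by rewrite gt_max c1/=; lra.
apply/lee_addgt0Pr => eps eps0; rewrite -leeBlDr// -EFinB.
pose eta := eps / 3; have eta0 : 0 < eta by rewrite divr_gt0.
pose m := Num.min 2^-1 (eta ^+ 2).
have m0 : 0 < m by rewrite lt_min invr_gt0 ltr0n exprn_gt0.
have [m1 m2] : m <= 2^-1 /\ m <= eta ^+ 2 by rewrite !ge_min !lexx orbT.
have lt_level : (alpha%:E < (alpha + eta)%:E)%E by rewrite lte_fin ltrDl.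
have near_level := limn_esup_lt_near level lt_level.
apply: near_limn_einf_ge.
have n1 := near_s (Num.max 2 (2 / eta / (1 - c'))).
have n2 := regime (2 * f0 * K / m).
near=> n.
have [n0 sn _] : [/\ (0 < n)%N, Num.max 2 (2 / eta / (1 - c')) <= s n &
  Num.max 2 (2 / eta / (1 - c')) <= n%:R * lambda n] by near: n.
have [_ _ _ Xn] : [/\ (0 < n)%N, 2 * f0 * K / m <= - ln (lambda n),
  2 * f0 * K / m <= n%:R * lambda n &
  2 * f0 * K / m * - ln (lambda n) <= n%:R * lambda n] by near: n.
have lev : (type1_error (Phi n) (S n) <= (alpha + eta)%:E)%E by near: n.
have /andP[h0 h1] := lambda01 n0.
have X0 : 0 < n%:R * lambda n by rewrite mulr_gt0// ltr0n.
move: sn; rewrite ge_max => /andP[s2 s3].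
rewrite -s_sqr// in Xn.
have l2 : lambda n <= 2^-1.
  have s20 : 0 < s n ^+ 2 by rewrite exprn_gt0//; lra.
  rewrite lambdaE// (le_trans (expRN_le s20))// lef_pV2 ?posrE//.
  by rewrite expr2; nra.
have := @mixture_type2 n (S n) (lambda n) (s n) K f0 c' eta (Phi n) n0 (Spd n) h0 l2
  (lambdaE n0) f0_gt0 K0 c'34 c'1 eta0.
rewrite /= -rateE// => mixture.
set D := c' * rate n in mixture; set e := D ^+ 2 * K in mixture.
set r := eta + _ in mixture.
have mix : (multinormal 0 (S n) [set y | Phi n y = false] <=
    type2_error (Phi n) (S n) D (lambda n) + r%:E)%E.
  apply: mixture => a b a0 ab b1 ba; have [_ h2 h3] := est n a b n0 a0 ab b1.
  by rewrite -ba; split.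
have e_le : e <= m.
  have r0 : 0 <= 2 * f0 * s n ^+ 2 / (n%:R * lambda n).
    by rewrite divr_ge0 ?(ltW X0)// mulr_ge0 ?sqr_ge0// mulr_ge0// ltW.
  have -> : e = c' ^+ 2 * (2 * f0 * K * s n ^+ 2 / (n%:R * lambda n)).
    by rewrite /e /D rateE// exprMn sqr_sqrtr//; field; rewrite !gt_eqF// ltr0n.
  have q : 2 * f0 * K * s n ^+ 2 / (n%:R * lambda n) <= m.
    by rewrite ler_pdivrMr// -ler_pdivrMl// mulrC mulrAC.
  have q0 : 0 <= 2 * f0 * K * s n ^+ 2 / (n%:R * lambda n).
    by rewrite divr_ge0 ?(ltW X0)// mulr_ge0 ?sqr_ge0// mulr_ge0 ?(ltW K0)// mulr_ge0// ltW.
  by apply: le_trans q; rewrite ler_piMl// exprn_ile1//; lra.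
have e0 : 0 <= e by rewrite mulr_ge0 ?sqr_ge0// ltW.
have [E1 E2] := expR_half_le e0 (le_trans e_le m1).
pose Q := ((1 - c') * s n) ^+ 2.
have p0 : 0 < 1 - c' by rewrite subr_gt0.
have q1 : 2 / eta <= (1 - c') * s n by rewrite -ler_pdivrMl// mulrC.
have Q1 : 4 / eta ^+ 2 <= Q.
  rewrite (_ : 4 / eta ^+ 2 = (2 / eta) ^+ 2); last by field; rewrite gt_eqF.
  have q2 : 0 <= 2 / eta by rewrite divr_ge0// ltW.
  by rewrite lerXn2r ?nnegrE// (le_trans q2).
have Q0 : 0 < Q by apply: lt_le_trans Q1; rewrite divr_gt0// exprn_gt0.
have Qi : Q^-1 <= eta ^+ 2 / 4.
  by rewrite -[leRHS]invf_div lef_pV2 ?posrE// divr_gt0// exprn_gt0.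
have EQ : expR (- Q) <= eta ^+ 2 / 4 := le_trans (expRN_le Q0) Qi.
have EQ2 : expR (- (2 * Q)) <= eta ^+ 2 / 4.
  by apply: le_trans EQ; rewrite ler_expR; lra.
have T1 : expR (e - 2 * Q) <= 2 * (eta ^+ 2 / 4).
  by rewrite expRD; apply: ler_pM => //; exact: expR_ge0.
have T2 : expR (e - Q) <= 2 * (eta ^+ 2 / 4).
  by rewrite expRD; apply: ler_pM => //; exact: expR_ge0.
have r_le : r <= 2 * eta.
  rewrite /r -/Q (_ : 2 * eta = eta + (4 * eta)^-1 * (4 * eta ^+ 2)); last first.
    by field; rewrite gt_eqF.
  rewrite lerD2l ler_wpM2l ?invr_ge0 ?mulr_ge0 ?(ltW eta0)//; lra.
have anti : (type2_error (Phi n) (S n) D (lambda n) <=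
    type2_error (Phi n) (S n) (c * rate n) (lambda n))%E.
  by apply: type2_antitone; rewrite ler_wpM2r// sqrtr_ge0.
apply: le_trans anti.
have tot := multinormal_test 0 (Phi n) (Spd n).
have : (1 <= (alpha + eta)%:E + (type2_error (Phi n) (S n) D (lambda n) + r%:E))%E.
  by rewrite -tot; apply: leeD.
case: (type2_error (Phi n) (S n) D (lambda n)) => [t| |//]; last by move=> _; exact: leey.
rewrite -!EFinD !lee_fin => H.
have : eps = 3 * eta by rewrite /eta; field.
lra.
Unshelve. all: by end_near. Qed.

End boundary.

(** * The spectral density at frequency zero *)

Lemma cvg_real_complex (R : realType) (u : nat -> R) (l : R) : u @ \oo --> l ->
  (fun N => (u N)%:C%C : (R[i] : numFieldType)) @ \oo --> (l%:C%C : (R[i] : numFieldType)).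
Proof.
move=> ul; apply/cvgrPdist_lt => eps eps0.
have er : eps = (complex.Re eps)%:C%C.
  by move: eps0; rewrite ltcE/= => /andP[/eqP e _]; case: eps e => a b /= ->.
have re0 : 0 < complex.Re eps by rewrite -ltcR -er.
move/cvgrPdist_lt: ul => /(_ _ re0); apply: filterS => N h.
by rewrite er -rmorphB/= normc_def/= expr0n/= addr0 sqrtr_sqr ltcR.
Qed.

(** At frequency 0 the exponentials are 1. *)
Lemma spectral_density0 (R : realType) (gamma : int -> R) (f : R) :
  has_total gamma f -> spectral_density gamma 0 = f.
Proof.
move=> /has_total_cvg/cvg_real_complex cv; rewrite /spectral_density.
rewrite (_ : (fun N : nat => _) = (fun N : nat =>
    (\sum_(0 <= k < N.*2.+1) gamma (k%:Z - N%:Z))%:C%C : (R[i] : numFieldType))).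
  by rewrite (cvg_lim _ cv)//; exact: norm_hausdorff.
apply: funext => N; rewrite rmorph_sum/=; apply: eq_bigr => k _.
by rewrite /expi mulr0 cos0 sin0 mulr1.
Qed.

Lemma horner1_coef (R : realType) (p : nat) (P : {poly R}) :
  size P = p.+1 -> P`_0 = 1 -> P.[1] = 1 + \sum_(1 <= i < p.+1) P`_i.
Proof.
move=> Pp P0; rewrite horner_coef Pp -(big_mkord xpredT (fun i => P`_i * 1 ^+ i)).
rewrite big_ltn// P0 mul1r expr0; congr (_ + _); apply: eq_bigr => i _.
by rewrite expr1n mulr1.
Qed.

Theorem theorem3p1 (R : realType) (p q : nat) (phi theta : {poly R})
    (size_phi : size phi = p.+1) (size_theta : size theta = q.+1)
    (phi0 : phi`_0 = 1) (theta0 : theta`_0 = 1)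
    (no_common_root : forall z : R[i],
       ~ (complex_root phi z /\ complex_root theta z))
    (no_root_in_disc : forall z : R[i], `|z| <= 1 ->
       ~ complex_root phi z /\ ~ complex_root theta z)
    (d : measure_display) (T : measurableType d) (P : probability T R)
    (Z zeta : int -> {RV P >-> R})
    (armaZ : stationary_arma phi theta Z zeta)
    (lambda : nat -> R)
    (lambda01 : forall n : nat, (0 < n)%N -> 0 < lambda n < 1)
    (lambda_lower : (fun n : nat => n%:R * lambda n / ln n%:R) @ \oo --> +oo)
    (lambda_upper : lambda =o_\oo (fun n : nat => (ln n%:R)^-1)) :
  let f := spectral_density (autocovariance Z) in
  let Sigma := covariance_mx Z in
  let varphi n :=
    Num.sqrt (- 2 * f 0 * ln (lambda n) / (n%:R * lambda n)) in
  (forall n : nat, (0 < n)%N ->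
     varphi n =
     `|(1 + \sum_(1 <= i < q.+1) theta`_i) / (1 + \sum_(1 <= i < p.+1) phi`_i)|
     * Num.sqrt (- 2 * ln (lambda n) / (n%:R * lambda n))) /\
  minimax_detection_boundary Sigma lambda varphi.
Proof.
pose gamma := acov Z.
have phi_root z (z1 : `|z| <= 1) : ~ complex_root phi z := (no_root_in_disc z z1).1.
have theta_root z (z1 : `|z| <= 1) : ~ complex_root theta z := (no_root_in_disc z z1).2.
have phi_neq0 : phi != 0 by rewrite -size_poly_eq0 size_phi.
have theta_neq0 : theta != 0 by rewrite -size_poly_eq0 size_theta.
have phi1 := horner1_neq0 phi_root; have theta1 := horner1_neq0 theta_root.
have bounded : exists K, forall h, `|gamma h| <= K.
  by exists (gamma 0); exact: acov_bounded armaZ.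
have equation := acov_eq armaZ.
have total := arma_total phi_neq0 phi_root bounded equation.
have [c c0 ge_c] := arma_toeplitz_ge phi_neq0 theta_neq0 phi_root theta_root bounded equation.
have sym h : gamma (- h) = gamma h.
  by rewrite /gamma -[h]subr0 opprB -!(cov_acov armaZ) covC.
set f0 := (_ / _) ^+ 2 in total.
have f0_gt0 : 0 < f0 by rewrite exprn_even_gt0//= mulf_neq0 ?invr_eq0.
move=> f Sigma varphi.
have fE : f 0 = f0 by rewrite /f (autocovariance_acov armaZ phi1); exact: spectral_density0.
have SE : Sigma = toeplitz_mx gamma.
  by apply: functional_extensionality_dep => n; exact: covariance_mx_acov armaZ n.
split=> [n n0|alpha /andP[alpha0 _]].
  rewrite /varphi fE (_ : -2 * f0 * _ / _ =
      f0 * (- 2 * ln (lambda n) / (n%:R * lambda n))); last by ring.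
  rewrite sqrtrM ?(ltW f0_gt0)// sqrtr_sqr.
  by rewrite (horner1_coef size_theta theta0) (horner1_coef size_phi phi0).
have regime := sparse_regime lambda01 lambda_lower lambda_upper.
rewrite /varphi fE SE; split.
- exact: (upper_boundary sym total f0_gt0 c0 ge_c lambda01 regime alpha0).
- exact: (lower_boundary sym total f0_gt0 c0 ge_c lambda01 regime).
Qed.
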